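(* Let $n$ be a positive integer and let $\sigma,\sigma'$ be $m$-component welded string links. Then $\sigma$ and $\sigma'$ are $(V^{n}+\mathrm{sv})$-equivalent if and only if $\mu^{\mathrm w}_{\sigma}(I)\equiv\mu^{\mathrm w}_{\sigma'}(I)\pmod n$ for every non-repeated sequence $I$ of elements of $\{1,\dots,m\}$.
   Context: An $m$-component virtual string link diagram is an ordered, oriented string link diagram of $m$ strands in the plane whose transverse double points are either classical crossings or virtual crossings. A welded string link is an equivalence class of such diagrams under welded Reidemeister moves: classical Reidemeister moves R1–R3, virtual moves V1–V4 (virtual Reidemeister moves and the mixed move), and the overcrossings commute move OC. A sequence of such moves is a welded isotopy. Welded Milnor invariants. Given a virtual diagram $D=D_1\cup\dots\cup D_m$ of $\sigma$, an arc is a piece of strand whose boundary points are strand endpoints or classical undercrossings and whose interior contains no classical undercrossing. Label the arcs of $D_i$ as $a_{i1},\dots,a_{ir(i)}$ in order along the orientation. The group $G(\sigma)$ has the Wirtinger presentation with generators $a_{ij}$ and relations $a_{i,j+1}^{-1}u_{ij}^{-1}a_{ij}u_{ij}$, where $u_{ij}$ is the over-arc generator at the crossing separating $a_{ij}$ and $a_{i,j+1}$ or its inverse, according to the crossing sign. Put $v_{ij}=u_{i1}\cdots u_{ij}$; the preferred $i$th longitude is $l_i=a_{i1}^{s}v_{i,r(i)-1}$ with $s$ chosen so that the total exponent of generators of the $i$th component in $l_i$ is zero. Modulo the $q$th lower central series term $G(\sigma)_q$, $l_i$ is represented by a word $\lambda_i$ in the images $\alpha_1,\dots,\alpha_m$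 of $a_{11},\dots,a_{m1}$. With the Magnus expansion $E(\alpha_i)=1+X_i$, $E(\alpha_i^{-1})=1-X_i+X_i^2-\cdots$ into $\mathbb Z\langle\langle X_1,\dots,X_m\rangle\rangle$, for $I=j_1\dots j_k i$ ($k<q$) the invariant $\mu^{\mathrm w}_\sigma(I)$ is the coefficient of $X_{j_1}\cdots X_{j_k}$ in $E(\lambda_i)$. A sequence is non-repeated if its entries are pairwise distinct. A $V^n$-move is the following local move on two oriented strands in a disk: two parallel strands without crossings are replaced by a configuration in which one strand passes under the other strand $n$ times consecutively at classical crossings all of the same sign, returning across the other strand through a virtual crossing after each classical crossing (so the two strands meet in $n$ classical and $n$ virtual crossings), and the inverse move. ($V^1$-move is equivalent to crossing virtualization.) A self-crossing virtualization replaces a classical crossing between two strands of the same component by a virtual crossing or conversely. The $(V^n+\mathrm{sv})$-equivalence is generated by $V^n$-moves, self-crossing virtualizations and welded isotopy. *)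

(* Defs.v *)
(* Welded string links are encoded by Gauss diagrams. *)
From Stdlib Require Import Relations ClassicalEpsilon.
From HB Require Import structures.
From mathcomp Require Import all_boot all_order all_algebra.
Set Implicit Arguments. Unset Strict Implicit. Unset Printing Implicit Defensive.
Import Order.TTheory GRing.Theory Num.Theory.

(* A crossing endpoint: (crossing id, is_over, sign), where is_over = true
   means the endpoint lies on the over strand (tail of the Gauss arrow),
   and sign = true means a positive crossing. *)
Definition letter := (nat * bool * bool)%type.
Definition lid (l : letter) : nat := l.1.1.
Definition lover (l : letter) : bool := l.1.2.
Definition lsgn (l : letter) : bool := l.2.

(* A diagram: the list of strands (strand i = component i), each strand being
   the sequence of crossing endpoints met along its orientation. *)
Definition gdiag := seq (seq letter).

Definition wf (m : nat) (d : gdiag) : Prop :=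
  size d = m /\
  (forall c : nat,
     count (fun l => (lid l == c) && lover l) (flatten d) =
     count (fun l => (lid l == c) && ~~ lover l) (flatten d) /\
     count (fun l => (lid l == c) && lover l) (flatten d) <= 1) /\
  (forall x y, x \in flatten d -> y \in flatten d -> lid x = lid y ->
     lsgn x = lsgn y).

Definition del (C : seq nat) (d : gdiag) : gdiag :=
  map (filter (fun l => lid l \notin C)) d.

Definition at_pair (d : gdiag) (i p : nat) (x y : letter) : Prop :=
  exists u v, nth [::] d i = u ++ [:: x; y] ++ v /\ size u = p.

Definition swap_at (d : gdiag) (i p : nat) : gdiag :=
  let s := nth [::] d i in
  set_nth [::] d i
    (take p s ++ [:: nth (0, false, false) s p.+1; nth (0, false, false) s p]
              ++ drop p.+2 s).

Definition has_block (d : gdiag) (w : seq letter) : Prop :=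
  exists i u v, nth [::] d i = u ++ w ++ v.

Definition relabel (f : nat -> nat) (d : gdiag) : gdiag :=
  map (map (fun l : letter => (f (lid l), lover l, lsgn l))) d.

Definition Tl (c : nat) (e : bool) : letter := (c, true, e).
Definition Hl (c : nat) (e : bool) : letter := (c, false, e).

Definition R1_step (d d' : gdiag) : Prop :=
  exists c x y, d = del [:: c] d' /\ lid x = c /\ lid y = c /\
    has_block d' [:: x; y].

Definition R2_step (d d' : gdiag) : Prop :=
  exists c c' e, d = del [:: c; c'] d' /\
    (has_block d' [:: Tl c e; Tl c' (~~ e)] \/
     has_block d' [:: Tl c' (~~ e); Tl c e]) /\
    (has_block d' [:: Hl c e; Hl c' (~~ e)] \/
     has_block d' [:: Hl c' (~~ e); Hl c e]).

(* R3: crossings a (top over middle), b (top over bottom), c (middle over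
   bottom); the endpoint pairs on the middle and bottom segments are
   transposed (the two adjacent tails on the top segment are unchanged). *)
Definition R3_step (d d' : gdiag) : Prop :=
  exists a b c ea eb ec i1 p1 i2 p2,
    (has_block d [:: Tl a ea; Tl b eb] \/ has_block d [:: Tl b eb; Tl a ea]) /\
    at_pair d i1 p1 (Hl a ea) (Tl c ec) /\
    ((at_pair d i2 p2 (Hl b eb) (Hl c ec) /\ ea = eb) \/
     (at_pair d i2 p2 (Hl c ec) (Hl b eb) /\ ea = ~~ eb)) /\
    d' = swap_at (swap_at d i1 p1) i2 p2.

Definition OC_step (d d' : gdiag) : Prop :=
  exists i p x y, lover x /\ lover y /\ at_pair d i p x y /\
    d' = swap_at d i p.

Definition relabel_step (d d' : gdiag) : Prop :=
  exists f, injective f /\ d' = relabel f d.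

Definition Vn_step (n : nat) (d d' : gdiag) : Prop :=
  exists (C : seq nat) (e : bool) (wo wu : seq letter),
    uniq C /\ size C = n /\ d = del C d' /\
    size wo = n /\ size wu = n /\
    all (fun l => lover l && (lid l \in C) && (lsgn l == e)) wo /\
    all (fun l => ~~ lover l && (lid l \in C) && (lsgn l == e)) wu /\
    has_block d' wo /\ has_block d' wu.

(* self-crossing virtualization: d' = d plus one crossing with both endpoints
   on the same strand (= same component) *)
Definition sv_step (d d' : gdiag) : Prop :=
  exists c i, d = del [:: c] d' /\
    has (fun l => lid l == c) (nth [::] d' i) /\
    count (fun l => lid l == c) (nth [::] d' i) = 2.

Definition welded_step (m : nat) (d d' : gdiag) : Prop :=
  wf m d /\ wf m d' /\
  (R1_step d d' \/ R2_step d d' \/ R3_step d d' \/ OC_step d d' \/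
   relabel_step d d').

Definition welded_isotopic (m : nat) : relation gdiag :=
  clos_refl_sym_trans gdiag (welded_step m).

Definition Vn_sv_step (m n : nat) (d d' : gdiag) : Prop :=
  wf m d /\ wf m d' /\
  (R1_step d d' \/ R2_step d d' \/ R3_step d d' \/ OC_step d d' \/
   relabel_step d d' \/ Vn_step n d d' \/ sv_step d d').

Definition Vn_sv_equiv (m n : nat) : relation gdiag :=
  clos_refl_sym_trans gdiag (Vn_sv_step m n).

(* generator (i, k) = arc a_{i,k+1} (0-based: k-th arc of strand i) *)
Definition gen := (nat * nat)%type.
(* word letter: (generator, true = exponent +1 / false = exponent -1) *)
Definition word := seq (gen * bool).

Definition winv (w : word) : word := rev (map (fun x => (x.1, ~~ x.2)) w).

Definition over_arc (d : gdiag) (c : nat) : gen :=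
  let isov := fun l : letter => (lid l == c) && lover l in
  let i := find (fun s => has isov s) d in
  let s := nth [::] d i in
  (i, count (fun l => ~~ lover l) (take (find isov s) s)).

Definition u_word (d : gdiag) (i : nat) : word :=
  [seq (over_arc d (lid l), lsgn l) | l <- nth [::] d i & ~~ lover l].

Definition dfltg : gen * bool := ((0, 0), true).

Definition is_relator (d : gdiag) (r : word) : Prop :=
  exists i j, i < size d /\ j < size (u_word d i) /\
    r = [:: ((i, j.+1), false)] ++ winv [:: nth dfltg (u_word d i) j] ++
        [:: ((i, j), true); nth dfltg (u_word d i) j].

(* left-normed commutators of weight k of arbitrary words: they normally
   generate the k-th lower central series term F_k (F_1 = F) *)
Inductive is_comm : nat -> word -> Prop :=
| comm1 w : is_comm 1 w
| commS k w v : is_comm k w -> is_comm k.+1 (winv w ++ winv v ++ w ++ v).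

(* elementary steps presenting G(sigma) / G(sigma)_q = F / <<R, F_q>> *)
Inductive wstep (d : gdiag) (q : nat) : word -> word -> Prop :=
| ws_free u v x : wstep d q (u ++ [:: x; (x.1, ~~ x.2)] ++ v) (u ++ v)
| ws_rel u v r : is_relator d r -> wstep d q (u ++ r ++ v) (u ++ v)
| ws_comm u v r : is_comm q r -> wstep d q (u ++ r ++ v) (u ++ v).

Definition congr_q (d : gdiag) (q : nat) : relation word :=
  clos_refl_sym_trans word (wstep d q).

Definition longitude (d : gdiag) (i : nat) : word :=
  let v := u_word d i in
  let pos := count (fun x : gen * bool => (x.1.1 == i) && x.2) v in
  let neg := count (fun x : gen * bool => (x.1.1 == i) && ~~ x.2) v in
  (if pos <= neg then nseq (neg - pos) ((i, 0), true)
   else nseq (pos - neg) ((i, 0), false)) ++ v.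

(* words in alpha_1..alpha_m : (j, exponent sign), alpha_j = image of a_{j1} *)
Definition emb (lam : seq (nat * bool)) : word :=
  map (fun x => ((x.1, 0), x.2)) lam.

Definition blockc (pos : bool) (p : nat) : int :=
  if pos then Posz (p <= 1) else ((-1) ^+ p)%R.

(* coefficient of the monomial X_{M_1} ... X_{M_k} in E(lam), where
   E(alpha_j) = 1 + X_j, E(alpha_j^-1) = 1 - X_j + X_j^2 - ... *)
Fixpoint mcoef (lam : seq (nat * bool)) (M : seq nat) : int :=
  match lam with
  | [::] => Posz (M == [::])
  | x :: lam' =>
      \sum_(p < (size M).+1)
        (if take p M == nseq p x.1
         then blockc x.2 p * mcoef lam' (drop p M) else 0)
  end%R.

Definition IsMuRep (m : nat) (d : gdiag) (I : seq 'I_m) (c : int) : Prop :=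
  exists (q : nat) (lam : seq (nat * bool)),
    size I <= q /\ all (fun x => x.1 < m) lam /\
    congr_q d q (longitude d (last 0 (map val I))) (emb lam) /\
    c = mcoef lam (take (size I).-1 (map val I)).

Definition mu_w (m : nat) (d : gdiag) (I : seq 'I_m) : int :=
  epsilon (inhabits 0%R) (IsMuRep d I).

(* Main.v *)
(* Send the Wirtinger generators into the Magnus ring over Z/n with all monomials
   having a repeated variable killed.  Degree by degree, a Gauss diagram has exactly
   one such coloring starting with 1 + X_i on strand i, and the coefficients of the
   i-th longitude at monomials without X_i are the non-repeated Milnor numbers mod n.
   Each move transports colorings: conjugates of 1 + X_i commute with each other,
   which takes care of self-crossings, and their n-th power is 1, which takes care
   of V^n-moves.

   Conversely, after deleting the self-arrows of a strand, R2 and R3 let its tails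
   slide in front of its heads; treating the strands one after the other ends in a
   diagram with all tails first on every strand, which up to OC is just a word
   in the generators for each strand.  On the i-th word R2, V^n and sv give free
   reduction, n-th powers of generators and deletion of a_i, and a self-arrow on
   another strand j makes the conjugates of a_j commute.  These are the relations
   of the reduced free group modulo n-th powers of its generators, and there the
   reduced Magnus expansion mod n is faithful: the conjugates of a generator x span
   an abelian normal subgroup in which x^h is the product of the iterated commutators
   [x, a_{j_1}, ..., a_{j_k}] with the Magnus coefficients of h as exponents. *)
Require Import Defs.
From Stdlib Require Import Relations ClassicalEpsilon.
From HB Require Import structures.
From mathcomp Require Import all_boot all_order all_algebra zify ring generic_quotient.
Set Implicit Arguments. Unset Strict Implicit. Unset Printing Implicit Defensive.
Import Order.TTheory GRing.Theory Num.Theory.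

(** * Reduced Magnus coefficients *)

(** Everything done degree by degree rests on one gain: a letter conjugated by a word known below
    degree q is known below degree q + 1, since its own variable uses up one degree. The lower
    central series has the same gain, with weights for degrees. [mu_w] is defined by a choice, so a
    representing word has to be produced as well as shown to determine the value; the gain in the
    group does the former, evaluation through a coloring the latter. The modulus is a parameter of
    all congruences: colorings are built for modulus 0, that is, over the integers, and reduced
    modulo n for the moves.

    In the converse, no move on strand i alone makes conjugates of a_j commute: the self-arrow that
    does so sits on strand j, at the end of an arc whose meridian is the conjugate in question. Such
    an arc is made by writing g g^-1 in the word of strand j and is removed afterwards. Relations
    are therefore stated between families of words, one word per strand, and for all diagrams
    realizing them; this is legitimate because a tails-first diagram is determined by its words up
    to OC and relabelling. *)

Definition aword := seq (nat * bool).

(** The base type is left open because the same formal inverses serve words in the [alpha_j] and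
    words in the Wirtinger generators; on the latter [ginv] is convertible to [winv]. *)
Section Inverse.
Variable T : Type.
Implicit Types (x : T * bool) (u v : seq (T * bool)).

Definition linv x := (x.1, ~~ x.2).
Definition ginv u := rev (map linv u).
Definition wconj y h := ginv h ++ y ++ h.
Definition gpow u (e : bool) := if e then u else ginv u.

Lemma linvK x : linv (linv x) = x.
Proof. by case: x => a b; rewrite /linv /= negbK. Qed.

Lemma ginv_cat u v : ginv (u ++ v) = ginv v ++ ginv u.
Proof. by rewrite /ginv map_cat rev_cat. Qed.

Lemma ginvK u : ginv (ginv u) = u.
Proof.
rewrite /ginv map_rev revK -map_comp.
by rewrite (eq_map (g := id)) ?map_id // => x /=; rewrite linvK.
Qed.

Lemma ginv_cons x u : ginv (x :: u) = ginv u ++ [:: linv x].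
Proof. by rewrite -cat1s ginv_cat. Qed.

Lemma conj_cat y g h : wconj y (g ++ h) = wconj (wconj y g) h.
Proof. by rewrite /wconj ginv_cat !catA. Qed.

Lemma ginv_conj y h : ginv (wconj y h) = wconj (ginv y) h.
Proof. by rewrite /wconj !ginv_cat ginvK catA. Qed.

Lemma ginv_gpow u e : ginv (gpow u e) = gpow u (~~ e).
Proof. by case: e => //=; rewrite ginvK. Qed.

Lemma gpow_conj y h e : gpow (wconj y h) e = wconj (gpow y e) h.
Proof. by case: e => //=; rewrite ginv_conj. Qed.

End Inverse.

Definition sg (e : bool) : int := if e then 1%R else (-1)%R.

Lemma sgN e : sg (~~ e) = (- sg e)%R.
Proof. by case: e => //=; rewrite opprK. Qed.

(* The coefficient of X_M in the Magnus expansion with the monomials having a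
   repeated variable killed, so that the inverse of 1 + X is 1 - X.  It is
   meaningful only for duplicate-free M. *)
Fixpoint rcoef (w : aword) (M : seq nat) : int :=
  match w with
  | [::] => Posz (M == [::])
  | x :: w' => rcoef w' M +
      (if M is k :: M' then
         if k == x.1 then sg x.2 * rcoef w' M' else 0
       else 0)
  end%R.

Lemma rcoef_nil w : rcoef w [::] = 1%R.
Proof. by elim: w => //= x w ->; rewrite addr0. Qed.

(** A block of length p >= 2 would need the same variable p times in M, so only p = 0 and p = 1
    contribute, and there 1 - X + X^2 - ... agrees with 1 - X. *)
Lemma mcoef_rcoef w M : uniq M -> mcoef w M = rcoef w M.
Proof.
elim: w M => [|[j e] w IH] M uM //=.
rewrite big_ord_recl /= take0 drop0 eqxx IH //.
have -> : (blockc e 0 = 1)%R by case: e.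
rewrite mul1r; congr (_ + _)%R.
case: M uM => [|k M] uM; first by rewrite big_ord0.
rewrite big_ord_recl /= take0 drop0.
rewrite big1 => [|p _]; last first.
  rewrite /bump /=; case: ifP => // /eqP Hp; move: p Hp.
  case: M uM => [|k' M] uM [p plt] //= Hp.
  by move: Hp uM; case=> -> -> _ /=; rewrite inE eqxx.
rewrite addr0 eqseq_cons andbT IH; last by case/andP: uM.
by case: ifP => // _; case: e => //=; rewrite ?expr1.
Qed.

(** The Cauchy product holds for every M, repeated variables included: [rcoef] multiplies factors 1
    + X and 1 - X in the free associative algebra. Repetitions are excluded only where inverses or
    commutation enter. *)
Lemma rcoef_cat u v M : rcoef (u ++ v) M =
  (\sum_(p < (size M).+1) rcoef u (take p M) * rcoef v (drop p M))%R.
Proof.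
elim: u M => [|x u IH] M /=.
  rewrite big_ord_recl /= take0 drop0 eqxx mul1r big1 ?addr0 // => p _.
  by rewrite /bump /=; case: M p => [|k M] p //=; [case: p | rewrite mul0r].
rewrite IH; under [RHS]eq_bigr => p _ do rewrite mulrDl.
rewrite big_split /=; congr (_ + _)%R.
case: M => [|k M]; first by rewrite big_ord1 /= mul0r.
rewrite big_ord_recl /= mul0r add0r.
case: ifP => kx; last by rewrite big1 // => p _; rewrite mul0r.
by rewrite IH mulr_sumr; apply: eq_bigr => p _; rewrite mulrA.
Qed.

(** * Congruence of truncated expansions modulo n *)

Definition eqm (n : nat) (a b : int) : bool := (Posz n %| (a - b)%R)%Z.

Section Eqm.
Variable n : nat.
Lemma eqm_refl a : eqm n a a. Proof. by rewrite /eqm subrr dvdz0. Qed.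
Lemma eqm_sym a b : eqm n a b -> eqm n b a.
Proof. by rewrite /eqm -opprB rpredN. Qed.
Lemma eqm_trans a b c : eqm n a b -> eqm n b c -> eqm n a c.
Proof.
rewrite /eqm => ab bc; rewrite (_ : (a - c = (a - b) + (b - c))%R); last by ring.
exact: rpredD.
Qed.
Lemma eqmD a b c d : eqm n a b -> eqm n c d -> eqm n (a + c)%R (b + d)%R.
Proof.
rewrite /eqm => ab cd; rewrite (_ : (_ - _ = (a - b) + (c - d))%R); last by ring.
exact: rpredD.
Qed.
Lemma eqmM a b c d : eqm n a b -> eqm n c d -> eqm n (a * c)%R (b * d)%R.
Proof.
rewrite /eqm => ab cd.
rewrite (_ : (_ - _ = (a - b) * c + b * (c - d))%R); last by ring.
by apply: rpredD; [exact: dvdz_mulr | exact: dvdz_mull].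
Qed.
Lemma eqm_sum (I : Type) (r : seq I) (P : pred I) (F G : I -> int) :
  (forall i, P i -> eqm n (F i) (G i)) ->
  eqm n (\sum_(i <- r | P i) F i)%R (\sum_(i <- r | P i) G i)%R.
Proof.
move=> FG; apply: (big_ind2 (eqm n)) => //; first exact: eqm_refl.
by move=> *; apply: eqmD.
Qed.
Lemma eqm_sum0 (I : Type) (r : seq I) (P : pred I) (F : I -> int) :
  (forall i, P i -> eqm n (F i) 0%R) -> eqm n (\sum_(i <- r | P i) F i)%R 0%R.
Proof.
move=> F0; apply: (big_ind (fun a => eqm n a 0%R)) => //; first exact: eqm_refl.
by move=> a b; rewrite -{3}[0%R]addr0; apply: eqmD.
Qed.
End Eqm.

Lemma eqm0 a b : eqm 0 a b -> a = b.
Proof. by rewrite /eqm dvd0z subr_eq0 => /eqP. Qed.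

Lemma eqm_of0 n a b : eqm 0 a b -> eqm n a b.
Proof. by move/eqm0 ->; apply: eqm_refl. Qed.

(* Equality of reduced Magnus expansions modulo n, in degrees < q and over the
   variables in D; n = 0 gives equality over the integers. *)
Definition weq n q (D : pred nat) (u v : aword) : Prop :=
  forall M, uniq M -> size M < q -> all D M -> eqm n (rcoef u M) (rcoef v M).

Section Weq.
Variables (n q : nat) (D : pred nat).
Local Notation "u =w v" := (weq n q D u v) (at level 70).

Lemma weq_refl u : u =w u. Proof. by move=> M _ _ _; apply: eqm_refl. Qed.
Lemma weq_sym u v : u =w v -> v =w u.
Proof. by move=> uv M *; apply/eqm_sym/uv. Qed.
Lemma weq_trans u v w : u =w v -> v =w w -> u =w w.
Proof. by move=> uv vw M *; apply: eqm_trans (uv _ _ _ _) (vw _ _ _ _). Qed.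

Lemma weq_cat u u' v v' : u =w u' -> v =w v' -> u ++ v =w u' ++ v'.
Proof.
move=> uu vv M uM sM DM; rewrite !rcoef_cat; apply: eqm_sum => p _.
apply: eqmM; [apply: uu | apply: vv].
- exact: take_uniq.
- by rewrite size_take; case: ifP => // /ltn_trans ->.
- by apply/allP => x /mem_take; apply/allP.
- exact: drop_uniq.
- by rewrite size_drop; apply: leq_ltn_trans sM; apply: leq_subr.
- by apply/allP => x /mem_drop; apply/allP.
Qed.

(** (1 + X)(1 - X) = 1 - X^2, and X^2 is not a duplicate-free monomial. *)
Lemma weq_free x : [:: x; linv x] =w [::].
Proof.
case: x => j e; move=> M uM _ _ /=; case: M uM => [|k M] /=.
  by rewrite !addr0 eqm_refl.
case: M => [|k' M] /=; (case: eqP => [kj|_] //=; first subst k); rewrite ?addr0 ?add0r ?eqm_refl //.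
  by rewrite sgN mulr1 mulr1 addNr eqm_refl.
rewrite inE negb_or eq_sym => /andP[/andP[/negPf -> _] _].
by rewrite !mulr0 eqm_refl.
Qed.

Lemma weq_mulV w : w ++ ginv w =w [::].
Proof.
elim/last_ind: w => [|w x IH]; first exact: weq_refl.
rewrite -cats1 ginv_cat -catA; apply: weq_trans IH.
apply: weq_cat; first exact: weq_refl.
rewrite catA -[X in _ =w X]cat0s; apply: weq_cat; last exact: weq_refl.
exact: weq_free.
Qed.

Lemma weq_mulVw w : ginv w ++ w =w [::].
Proof. by have := weq_mulV (ginv w); rewrite ginvK. Qed.

Lemma weq_inv u v : u =w v -> ginv u =w ginv v.
Proof.
move=> uv; apply: (@weq_trans _ (ginv u ++ (v ++ ginv v))).
  rewrite -[X in X =w _]cats0; apply: weq_cat; first exact: weq_refl.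
  exact/weq_sym/weq_mulV.
rewrite catA -[X in _ =w X]cat0s; apply: weq_cat; last exact: weq_refl.
apply: weq_trans (weq_mulVw u).
by apply: weq_cat; [apply: weq_refl | apply: weq_sym].
Qed.

Lemma weq_conj y y' h h' : y =w y' -> h =w h' -> wconj y h =w wconj y' h'.
Proof. by move=> yy hh; do 2?apply: weq_cat => //; apply: weq_inv. Qed.

Lemma weq_gpow u v e : u =w v -> gpow u e =w gpow v e.
Proof. by case: e => //=; apply: weq_inv. Qed.

Lemma weq_conj_nil y h : y =w [::] -> wconj y h =w [::].
Proof.
move=> yn; apply: weq_trans (weq_mulVw h).
apply: weq_cat; first exact: weq_refl.
by rewrite -[X in _ =w X]cat0s; apply: weq_cat => //; apply: weq_refl.
Qed.

(** Constant terms are 1, so (1 + a)(1 + b) reads 1 + a + b at M once the mixed terms vanish. Since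
    a + b is symmetric, commutation results follow. *)
Lemma rcoef_cat_ends u v M : M != [::] ->
  (forall p, 0 < p < size M -> eqm n (rcoef u (take p M) * rcoef v (drop p M))%R 0%R) ->
  eqm n (rcoef (u ++ v) M) (rcoef u M + rcoef v M)%R.
Proof.
move=> M0 mid; rewrite rcoef_cat.
case: M M0 mid => [//|k M] _ mid.
rewrite big_ord_recr big_ord_recl /= take_size drop_size rcoef_nil rcoef_nil.
rewrite mul1r mulr1 addrAC [(rcoef v _ + _)%R]addrC -[X in eqm _ _ X]addr0.
apply: eqmD; first exact: eqm_refl.
apply: eqm_sum0 => i _.
by apply: (mid (i.+1)); rewrite /= ltnS; apply: ltn_ord.
Qed.

End Weq.

Arguments weq_refl : clear implicits.
Arguments weq_free : clear implicits.
Arguments weq_mulV : clear implicits.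
Arguments weq_mulVw : clear implicits.

Lemma weq_sub n q q' (D D' : pred nat) u v : q' <= q -> subpred D' D ->
  weq n q D u v -> weq n q' D' u v.
Proof.
move=> qq DD uv M uM sM DM; apply: uv => //; first exact: leq_trans sM qq.
exact: sub_all DM.
Qed.

Lemma weq_le n q q' D u v : q' <= q -> weq n q D u v -> weq n q' D u v.
Proof. by move=> qq; apply: weq_sub. Qed.

Lemma weq_of0 n q D u v : weq 0 q D u v -> weq n q D u v.
Proof. by move=> uv M *; apply/eqm_of0/uv. Qed.

(** The gain of one degree: h^-1 (1 + X) h = h^-1 h + h^-1 X h, where the first summand is 1 and in
    the second the factor X leaves at most degree q - 1 to the two copies of h. *)
Lemma weq_conj_succ n q x h h' : weq n q predT h h' ->
  weq n q.+1 predT (wconj [:: x] h) (wconj [:: x] h').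
Proof.
move=> hh M uM sM _; rewrite !rcoef_cat.
have key g : rcoef (wconj [:: x] g) M = (rcoef (ginv g ++ g) M +
  \sum_(p < (size M).+1) rcoef (ginv g) (take p M) *
     (if drop p M is k :: M' then if k == x.1 then sg x.2 * rcoef g M' else 0 else 0))%R.
  rewrite /wconj !rcoef_cat -big_split /=; apply: eq_bigr => p _.
  by rewrite -mulrDr.
rewrite -!rcoef_cat -!/(wconj _ _) !key; apply: eqmD.
  have q1 : size M < (size M).+1 by [].
  have aM : all predT M by apply/allP.
  by have := weq_trans (weq_mulVw n (size M).+1 predT h)
      (weq_sym (weq_mulVw n (size M).+1 predT h')); apply.
apply: eqm_sum => p _.
case E: (drop p M) => [|k M']; first by rewrite !mulr0 eqm_refl.
have sz : size (take p M) + (size M').+1 = size M.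
  by rewrite -[RHS](congr1 size (cat_take_drop p M)) size_cat E.
have uM' : uniq M' by have := drop_uniq p uM; rewrite E => /andP[].
apply: eqmM; first by apply: weq_inv hh _ _ _ _; [exact: take_uniq | lia | apply/allP].
case: ifP => _; last exact: eqm_refl.
by apply: eqmM; [exact: eqm_refl | apply: hh => //; [lia | apply/allP]].
Qed.

(** If w - 1 starts in degree q, a proper cut of a monomial of degree q leaves w a coefficient that
    vanishes, so only w + v survives there. This is what places commutators of weight q in degrees
    at least q. *)
Lemma weq_comm_succ n q D w v : 0 < q -> weq n q D w [::] ->
  weq n q.+1 D (w ++ v) (v ++ w).
Proof.
move=> q0 wn M uM; rewrite ltnS leq_eqVlt => /orP[/eqP sM|sM] DM; last first.
  apply: eqm_trans (weq_cat wn (weq_refl n q D v) uM sM DM) _.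
  have := weq_cat (weq_refl n q D v) wn uM sM DM.
  by rewrite cats0; apply: eqm_sym.
have M0 : M != [::] by rewrite -size_eq0 sM -lt0n.
apply: (@eqm_trans _ _ (rcoef w M + rcoef v M)%R).
  apply: rcoef_cat_ends => // p /andP[p0 ps]; rewrite -[0%R](mul0r (rcoef v (drop p M))).
  apply: eqmM; last exact: eqm_refl.
  have sp : size (take p M) = p by rewrite size_take ps.
  have := wn (take p M); rewrite sp /= -size_eq0 sp (gtn_eqF p0); apply.
  - exact: take_uniq.
  - by rewrite -sM.
  - by apply/allP => x /mem_take; apply/allP.
rewrite addrC; apply: eqm_sym; apply: rcoef_cat_ends => // p /andP[p0 ps].
rewrite -[0%R](mulr0 (rcoef v (take p M))); apply: eqmM; first exact: eqm_refl.
have sp : size (drop p M) = size M - p by rewrite size_drop.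
have := wn (drop p M); rewrite /= -size_eq0 sp subn_eq0 [size M <= p]leqNgt ps; apply.
- exact: drop_uniq.
- by lia.
- by apply/allP => x /mem_drop; apply/allP.
Qed.

Lemma weq_letter n q (D : pred nat) x : ~~ D x.1 -> weq n q D [:: x] [::].
Proof.
move=> Dx [|k M] _ _ /= DM; first exact: eqm_refl.
by case: eqP DM Dx => [->|_] /=; [case: (D _) | rewrite add0r eqm_refl].
Qed.

Lemma weq_conj_letter n q D x h : ~~ D x.1 -> weq n q D (wconj [:: x] h) [::].
Proof. by move=> Dx; apply/weq_conj_nil/weq_letter. Qed.

(** Every nonconstant term of a conjugate of 1 + X contains X, so a product of two such terms
    repeats X and is killed. *)
Lemma weq_conj_comm n q D x x' h h' : x.1 = x'.1 ->
  weq n q D (wconj [:: x] h ++ wconj [:: x'] h') (wconj [:: x'] h' ++ wconj [:: x] h).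
Proof.
move=> xx M uM _ _; apply: eqm_of0.
(* Setting the variable of y to 0 turns the conjugate into 1, hence no coefficient survives at a
   nonempty monomial that avoids it. *)
have van y (g : aword) (P : seq nat) : y.1 = x.1 -> x.1 \notin P -> P != [::] ->
    uniq P -> rcoef (wconj [:: y] g) P = 0%R.
  move=> yx xP P0 uP.
  have := @weq_conj_letter 0 (size P).+1 (fun k => k != y.1) y g.
  rewrite eqxx => /(_ isT P uP (ltnSn _)) /=; rewrite (negPf P0) => H.
  apply/eqm0/H; apply/allP => z zP; apply/eqP => zy.
  by rewrite -yx -zy zP in xP.
have main y y' (g g' : aword) : y.1 = x.1 -> y'.1 = x.1 -> M != [::] ->
    eqm 0 (rcoef (wconj [:: y] g ++ wconj [:: y'] g') M)
          (rcoef (wconj [:: y] g) M + rcoef (wconj [:: y'] g') M)%R.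
  move=> yx y'x M0; apply: rcoef_cat_ends => // p /andP[p0 ps].
  have [xT|xT] := boolP (x.1 \in take p M).
    rewrite [rcoef _ (drop _ _)](van y') ?mulr0 ?eqm_refl //.
    - apply/negP => xD; have := uM; rewrite -(cat_take_drop p M) cat_uniq.
      by case/and3P=> _ /hasPn /(_ _ xD) /=; rewrite xT.
    - by rewrite -size_eq0 size_drop subn_eq0 -ltnNge.
    - exact: drop_uniq.
  rewrite van ?mul0r ?eqm_refl ?take_uniq //.
  by rewrite -size_eq0 size_take ps -lt0n.
have [-> | M0] := eqVneq M [::]; first by rewrite !rcoef_nil eqm_refl.
apply: eqm_trans (main x x' h h' erefl (esym xx) M0) _.
by rewrite addrC; apply/eqm_sym/main.
Qed.

(** (1 + X)^n = 1 + nX and (1 - X)^n = 1 - nX modulo X^2; this is the algebraic content of the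
    V^n-move. *)
Lemma weq_nseq n q D j e : weq n q D (nseq n (j, e)) [::].
Proof.
move=> M uM _ _.
have H k : rcoef (nseq k (j, e)) M = (rcoef [::] M + k%:R * sg e * (M == [:: j])%:R)%R.
  elim: k M uM => [|k IH] M uM; first by rewrite !mul0r addr0.
  rewrite [LHS]/= IH //; case: M uM => [|i M] /=; first by rewrite !mulr0 !addr0.
  case/andP=> iM uM; rewrite eqseq_cons; case: eqP => [ij|_] /=; last by rewrite !mulr0 !addr0.
  rewrite IH // -natr1; have -> : (M == [:: j]) = false.
    by apply/negbTE/eqP => E; rewrite E ij inE eqxx in iM.
  by case: M {IH uM iM} => [|? ?] /=; ring.
rewrite H /eqm [(rcoef [::] M + _)%R]addrC addrK -mulrA dvdz_mulr //.
by rewrite natz dvdzz.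
Qed.

(** * The reduced free group modulo n-th powers *)

Section GroupFacts.
Local Open Scope group_scope.
Variables (G : groupType).
Implicit Types (x u v : G).

Definition gsgn u (e : bool) := if e then u else u^-1.

Lemma commute_conj u v g : commute u v -> commute (u ^ g) (v ^ g).
Proof. by rewrite /commute -!conjMg => ->. Qed.

(* Membership in the double centralizer of the conjugacy class of x. *)
Definition cc x u := forall z, (forall g, commute z (x ^ g)) -> commute u z.

Lemma cc_id x : cc x x.
Proof. by move=> z /(_ 1); rewrite conjg1; apply: commute_sym. Qed.
Lemma ccM x u v : cc x u -> cc x v -> cc x (u * v).
Proof.
move=> cu cv z cz; apply/commute_sym/commuteM; apply/commute_sym; [exact: cu | exact: cv].
Qed.
Lemma ccV x u : cc x u -> cc x u^-1.
Proof. by move=> cu z cz; apply/commute_sym/commuteV/commute_sym/cu. Qed.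
Lemma ccJ x u g : cc x u -> cc x (u ^ g).
Proof.
move=> cu z cz; rewrite -[z](conjgKV g); apply/commute_conj/cu => h.
by rewrite -[x ^ h](conjgK g) -(conjgM x h g); apply/commute_conj/cz.
Qed.

Section Abelian.
Variable x : G.
Hypothesis ab : forall g, commute x (x ^ g).

Lemma cc_commute_conj u g : cc x u -> commute u (x ^ g).
Proof.
move=> cu; apply: cu => h.
rewrite -[x ^ g](conjgKV h) -(conjgM x g).
exact/commute_conj/commute_sym.
Qed.

(** [cc x] replaces the normal closure of x: it contains x, is stable under products, inverses and
    conjugation, and is abelian as soon as the conjugates of x commute, with no subgroup to be
    generated. *)
Lemma cc_commute u v : cc x u -> cc x v -> commute u v.
Proof.
by move=> cu cv; apply/commute_sym/cv => g; apply: cc_commute_conj.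
Qed.
End Abelian.

Lemma cc_commg1 x u : cc x u -> forall v, cc x [~ u, v].
Proof. by move=> cu v; rewrite commgEl; apply: ccM; [apply: ccV | apply: ccJ]. Qed.
Lemma cc_commg2 u v : cc v [~ u, v].
Proof.
rewrite (_ : [~ u, v] = v^-1 ^ u * v).
  by apply: ccM; [apply/ccJ/ccV/cc_id | apply: cc_id].
by rewrite /commg !conjgE !mulgA.
Qed.

End GroupFacts.

Lemma rcoef_erase x w M : x \notin M ->
  rcoef (filter (fun y => y.1 != x) w) M = rcoef w M.
Proof.
elim: w M => [|[j f] w IHw] J xJ //=.
case: eqP => [->|_] /=.
  rewrite IHw //; case: J xJ => [|i J]; first by rewrite addr0.
  by rewrite inE negb_or => /andP[/negPf xi _]; rewrite eq_sym xi addr0.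
rewrite IHw //; case: J xJ => [//|i J]; rewrite inE negb_or => /andP[_ xJ].
by rewrite IHw.
Qed.

Lemma rcoef_absent x w M : x \in M -> rcoef (filter (fun y => y.1 != x) w) M = 0%R.
Proof.
elim: w M => [|[j f] v IHv] M xM /=; first by case: M xM.
case: eqP => [_|jx] /=; first exact: IHv.
rewrite IHv //; case: M xM => [//|i M]; rewrite inE add0r.
case: (i =P j) => [->|//] /orP[/eqP E|xM]; first by rewrite E in jx.
by rewrite IHv ?mulr0.
Qed.

(** * Faithfulness of the reduced Magnus expansion modulo n *)

Section ReducedFreeQuotient.
Local Open Scope group_scope.
Variables (G : groupType) (n : nat) (a : nat -> G).
Hypothesis a_conj : forall k g, commute (a k) (a k ^ g).
Hypothesis a_pow : forall k, a k ^+ n = 1.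

Definition gev (w : aword) : G := \prod_(x <- w) gsgn (a x.1) x.2.

Lemma gev_nil : gev [::] = 1. Proof. by rewrite /gev big_nil. Qed.
Lemma gev_cons x w : gev (x :: w) = gsgn (a x.1) x.2 * gev w.
Proof. by rewrite /gev big_cons. Qed.
Lemma gev_cat u v : gev (u ++ v) = gev u * gev v.
Proof. by rewrite /gev big_cat. Qed.

Definition itc (x : nat) (J : seq nat) : G :=
  foldl (fun u k => [~ u, a k]) (a x) J.

Lemma itc_rcons x J k : itc x (rcons J k) = [~ itc x J, a k].
Proof. by rewrite /itc -cats1 foldl_cat. Qed.

(** An iterated commutator lies in the normal closure of each of its entries. Hence those with a
    common entry x commute, and bracketing with an entry already present gives 1. *)
Lemma itc_cc x J k : k \in x :: J -> cc (a k) (itc x J).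
Proof.
elim/last_ind: J => [|J j IH]; first by rewrite inE => /eqP ->; apply: cc_id.
rewrite itc_rcons -rcons_cons mem_rcons inE => /orP[/eqP -> | /IH].
  exact: cc_commg2.
by move=> c; apply: cc_commg1.
Qed.

Lemma itc_comm x J K : commute (itc x J) (itc x K).
Proof. by apply: (@cc_commute _ (a x)) => //; apply: itc_cc; rewrite mem_head. Qed.

(** [u, a] = u^-1 u^a is a product of two commuting elements, whose n-th powers are 1 by
    induction. *)
Lemma itc_pow x J : itc x J ^+ n = 1.
Proof.
elim/last_ind: J => [|J j IH]; first exact: a_pow.
rewrite itc_rcons commgEl expgMn.
  by rewrite expVgn -conjXg IH conj1g mulg1 invg1.
have cx : cc (a x) (itc x J) by apply: itc_cc; rewrite mem_head.
by apply: (@cc_commute _ (a x)) => //; [apply: ccV | apply: ccJ].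
Qed.

Lemma itc_repeat x J : ~~ uniq (x :: J) -> itc x J = 1.
Proof.
elim/last_ind: J => [|J j IH]; first by rewrite /=.
rewrite -rcons_cons rcons_uniq negb_and negbK itc_rcons => /orP[xJ | /IH ->]; last first.
  exact: comm1g.
apply/eqP/commgP; apply/commute_sym; rewrite -[a j]conjg1; apply/commute_sym.
by apply: cc_commute_conj => //; apply: itc_cc.
Qed.

(* Conjugating itc x I by a word multiplies out as u ^ a_k = u [u, a_k];
   the list records the signed commutators that appear. *)
Fixpoint expand (h : aword) (I : seq nat) : seq (bool * seq nat) :=
  if h is (k, e) :: h' then
    expand h' I ++ [seq (z.1 == e, z.2) | z <- expand h' (rcons I k)]
  else [:: (true, I)].

Definition pev x (z : seq (bool * seq nat)) : G := \prod_(s <- z) gsgn (itc x s.2) s.1.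

Lemma gsgn_comm u v e f : @commute G u v -> commute (gsgn u e) (gsgn v f).
Proof.
have aux (s t : G) f' : commute s t -> commute s (gsgn t f').
  by case: f' => //= st; apply: commuteV.
by move=> uv; apply: (aux); apply/commute_sym/aux/commute_sym.
Qed.

Lemma pev_sign x z e : pev x [seq (s.1 == e, s.2) | s <- z] = gsgn (pev x z) e.
Proof.
elim: z => [|[f I] z IH]; first by rewrite /pev /= !big_nil; case: e; rewrite //= invg1.
rewrite /pev /= !big_cons -!/(pev _ _) IH /=.
have c : commute (gsgn (itc x I) f) (pev x z).
  by apply: commute_prod => t _; apply/gsgn_comm/itc_comm.
by case: e {IH}; case: f c => //= c; rewrite ?c invgM ?invgK // -[in RHS]c ?invgM.
Qed.

(** For an inverse letter, [u, a] commutes with a, both lying in the normal closure of a, so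
    conjugating u by a^-1 gives u [u, a]^-1. Either sign thus adds one signed commutator, just as 1
    + X and 1 - X add one signed monomial. *)
Lemma itc_conj x I h : itc x I ^ gev h = pev x (expand h I).
Proof.
elim: h I => [|[k e] h IH] I /=; first by rewrite gev_nil conjg1 /pev big_seq1.
rewrite gev_cons /= conjgM /pev big_cat -!/(pev _ _) pev_sign -!IH.
have -> : itc x I ^ gsgn (a k) e = itc x I * gsgn (itc x (rcons I k)) e.
  rewrite itc_rcons commgEl; set u := itc x I.
  case: e => /=; first by rewrite mulVKg.
  have: commute [~ u, a k] (a k).
    rewrite -[X in commute _ X]conjg1; apply: cc_commute_conj => //; exact: cc_commg2.
  move=> c; apply: (canLR (conjgK (a k))); rewrite conjMg conjVg -commgEl.
  have -> : [~ u, a k] ^ a k = [~ u, a k] by rewrite conjgE c mulKg.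
  by rewrite commgEl invgM invgK mulVKg.
by rewrite conjMg; case: e => //=; rewrite conjVg.
Qed.

Definition mult (z : seq (bool * seq nat)) (J : seq nat) : int :=
  (\sum_(s <- z) (s.2 == J)%:R * sg s.1)%R.

Lemma mult_cat z z' J : mult (z ++ z') J = (mult z J + mult z' J)%R.
Proof. by rewrite /mult big_cat. Qed.

Lemma mult_sign z e J : mult [seq (s.1 == e, s.2) | s <- z] J = (sg e * mult z J)%R.
Proof.
rewrite /mult big_map mulr_sumr; apply: eq_bigr => s _ /=; rewrite mulrCA; congr (_ * _)%R.
by case: e s.1 => [] [].
Qed.

Lemma expand_prefix h I s : s \in expand h I -> prefix I s.2.
Proof.
elim: h I s => [|[k e] h IH] I s /=; first by rewrite inE => /eqP -> /=; apply: prefix_refl.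
rewrite mem_cat => /orP[/IH //|/mapP[t /IH pt ->]] /=.
by apply: prefix_trans pt; apply: prefix_rcons.
Qed.

(** [expand] and [rcoef] obey the same recursion on the first letter k of h: lists in the second
    half of [expand] begin with I followed by k, so they count only when M begins with k. *)
Lemma mult_expand h I M : mult (expand h I) (I ++ M) = rcoef h M.
Proof.
elim: h I M => [|[k e] h IH] I M /=.
  rewrite /mult big_seq1 /= mulr1 -{1}[I]cats0 eqseq_cat // eqxx /= eq_sym.
  by case: eqP.
rewrite mult_cat IH mult_sign; congr (_ + _)%R.
case: M => [|j M] /=.
  rewrite cats0 /mult big_seq big1 ?mulr0 // => s /expand_prefix ps.
  case: eqP ps => [->|_ _]; last by rewrite mul0r.
  by move/size_prefix; rewrite size_rcons ltnn.
case: eqP => [->|jk]; first by rewrite -cat_rcons IH.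
rewrite /mult big_seq big1 ?mulr0 // => s /expand_prefix ps.
case: eqP ps => [->|_ _]; last by rewrite mul0r.
case/prefixP=> t; rewrite cat_rcons => /eqP; rewrite eqseq_cat // eqxx /=.
by rewrite eqseq_cons => /andP[/eqP].
Qed.

Lemma pev_filter x z P : pev x z = pev x (filter P z) * pev x (filter (predC P) z).
Proof.
elim: z => [|s z IH] /=; first by rewrite /pev !big_nil mulg1.
rewrite /pev big_cons -/(pev x z) IH; case: (P s) => /=; rewrite big_cons -!/(pev _ _).
  by rewrite mulgA.
rewrite !mulgA; congr (_ * _); apply: commute_prod => t _.
exact/gsgn_comm/itc_comm.
Qed.

Lemma pev_const x J z : all (fun s => s.2 == J) z ->
  (Posz n %| mult z J)%Z -> pev x z = 1.
Proof.
move=> zJ; set u := itc x J.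
have key : forall z, all (fun s => s.2 == J) z ->
   exists p m, mult z J = (Posz p - Posz m)%R /\ pev x z = u ^+ p * u ^- m.
  elim=> [|[e I] z' IH] /=.
    by exists 0, 0; rewrite /mult /pev !big_nil mulgV.
  case/andP=> /eqP -> /IH[p [m [E1 E2]]].
  rewrite /mult /pev !big_cons /= eqxx mul1r -/(mult z' J) -/(pev x z') E1 E2 -/u.
  case: e => /=.
    by exists p.+1, m; rewrite expgS mulgA; split=> //; lia.
  exists p, m.+1; split; first by lia.
  have c : commute u^-1 (u ^+ p) by apply: commuteX; apply/commute_sym/commuteV.
  by rewrite mulgA c -mulgA; congr (_ * _); rewrite -invgM -expgSr.
case: (key z zJ) => p [m [-> ->]] ndv.
have [n0|n0] := posnP n.
  have -> : p = m by move: ndv; rewrite n0 dvd0z subr_eq0 => /eqP[].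
  by rewrite mulgV.
have mo k : u ^+ k = u ^+ (k %% n).
  by rewrite {1}(divn_eq k n) expgnDr mulnC expgnA itc_pow expg1n mul1g.
have -> : u ^+ p = u ^+ m; last by rewrite mulgV.
rewrite mo [RHS]mo; congr (_ ^+ _); apply/eqP.
by move: ndv; rewrite -eqz_mod_dvd !modz_nat => /eqP[->].
Qed.

(** The factors commute and may be collected by J: a J repeating an entry gives 1, any other J
    carries an exponent divisible by n. *)
Lemma pev_trivial x z :
  (forall J, uniq (x :: J) -> (Posz n %| mult z J)%Z) -> pev x z = 1.
Proof.
have [k] := ubnP (size z); elim: k z => [//|k IH] [|[e I] z] sz mz.
  by rewrite /pev big_nil.
rewrite (pev_filter _ _ (fun s => s.2 == I)).
have fe J : mult (filter (fun s => s.2 == I) ((e, I) :: z)) J =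
    (if J == I then mult ((e, I) :: z) J else 0)%R.
  rewrite /mult big_filter; case: eqP => [->|JI].
    by rewrite big_mkcond /=; apply: eq_bigr => s _; case: eqP => //; rewrite mul0r.
  by rewrite big1 // => s /eqP ->; rewrite eq_sym (introF eqP JI) mul0r.
have fn J : mult (filter (predC (fun s => s.2 == I)) ((e, I) :: z)) J =
    (if J == I then 0 else mult ((e, I) :: z) J)%R.
  rewrite /mult big_filter; case: eqP => [->|JI].
    by rewrite big1 // => s /= /negPf ->; rewrite mul0r.
  rewrite big_mkcond /=; apply: eq_bigr => s _; case: eqP => //= ->.
  by case: eqP => [/esym|] //; rewrite mul0r.
rewrite [X in _ * X]IH ?mulg1.
- have [uI|nI] := boolP (uniq (x :: I)).
    apply: (@pev_const _ I); first exact: filter_all.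
    by rewrite fe eqxx; apply: mz.
  rewrite /pev big_filter big1 // => s /eqP ->.
  by rewrite itc_repeat //; case: s.1; rewrite //= invg1.
- rewrite /= eqxx /= (leq_trans _ (_ : (size z).+1 <= k)) // ltnS size_filter.
  exact: count_size.
- by move=> J uJ; rewrite fn; case: ifP => // _; apply: mz.
Qed.

(** Each letter x is moved to the right end by u v = v u^v. It becomes a conjugate of a_x by the
    letters crossed, which splits into iterated commutators; their exponents add up to the
    coefficients of w at monomials starting with x. *)
Lemma gev_erase x w :
  exists z, gev w = gev (filter (fun y => y.1 != x) w) * pev x z /\
    forall J, x \notin J -> mult z J = rcoef w (x :: J).
Proof.
elim: w => [|[k e] w [z [IH1 IH2]]].
  exists [::]; split; first by rewrite gev_nil /pev big_nil mulg1.
  by move=> J _; rewrite /mult big_nil.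
rewrite gev_cons IH1 /=; case: eqP => [->|kx] /=; last first.
  exists z; split; first by rewrite gev_cons mulgA.
  by move=> J xJ; rewrite IH2 //; case: eqP => [/esym //|_]; rewrite addr0.
set w' := filter _ _.
exists ([seq (s.1 == e, s.2) | s <- expand w' [::]] ++ z); split.
  rewrite /pev big_cat -!/(pev _ _) pev_sign -itc_conj mulgA mulgA; congr (_ * _).
  rewrite -[itc x [::]]/(a x).
  have -> : gsgn (a x ^ gev w') e = gsgn (a x) e ^ gev w' by case: e => //=; rewrite conjVg.
  exact: conjgC.
move=> J xJ; rewrite mult_cat mult_sign IH2 // eqxx addrC -[J]cat0s mult_expand.
by rewrite rcoef_erase.
Qed.

(** Induction on the number of distinct generators in w. The coefficients at monomials starting with
    x kill the factor split off by [gev_erase], and erasing x leaves the coefficients at monomials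
    without x unchanged. *)
Theorem gev_trivial w :
  (forall M, M != [::] -> uniq M -> (Posz n %| rcoef w M)%Z) -> gev w = 1.
Proof.
have [k] := ubnP (size (undup (map fst w))).
elim: k w => [//|k IH] [|y w] sz wM; first exact: gev_nil.
set x := y.1; case: (gev_erase x (y :: w)) => z [-> mz].
rewrite pev_trivial ?mulg1.
  apply: IH => [|M M0 uM].
    apply: leq_trans (_ : size (undup (map fst (y :: w))) <= k); last by [].
    have -> : map fst (filter (fun t => t.1 != x) (y :: w)) =
       filter (fun j => j != x) (map fst (y :: w)) by rewrite filter_map.
    rewrite -filter_undup size_filter -(count_predC (fun j => j != x)) -addn1 leq_add2l.
    by rewrite -has_count; apply/hasP; exists x; [rewrite mem_undup mem_head | rewrite /= eqxx].
  have [xM|xM] := boolP (x \in M); last by rewrite rcoef_erase ?wM.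
  by rewrite rcoef_absent // dvdz0.
by move=> J /= /andP[xJ uJ]; rewrite mz //; apply: wM; rewrite //= xJ.
Qed.

End ReducedFreeQuotient.

Local Notation lets D := (all (fun x : nat * bool => D x.1)).

(* The relations of the reduced free group on D modulo n-th powers of the
   generators, closed under multiplication on both sides. *)
Inductive wcong (n : nat) (D : pred nat) : aword -> aword -> Prop :=
| wcong_refl u : wcong n D u u
| wcong_sym u v : wcong n D u v -> wcong n D v u
| wcong_trans u v w : wcong n D u v -> wcong n D v w -> wcong n D u w
| wcong_cat u u' v v' : wcong n D u u' -> wcong n D v v' -> wcong n D (u ++ v) (u' ++ v')
| wcong_free x : D x.1 -> wcong n D [:: x; linv x] [::]
| wcong_pow j : D j -> wcong n D (nseq n (j, true)) [::]
| wcong_comm j g : D j -> lets D g ->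
    wcong n D (wconj [:: (j, true)] g) (wconj [:: (j, true)] (rcons g (j, true))).

(** The quotient on D is a retract of the one on all generators: killing the letters outside D turns
    each relation into a relation on D or an identity. *)
Lemma wcong_erase n (D : pred nat) u v : wcong n predT u v ->
  wcong n D (filter (fun x => D x.1) u) (filter (fun x => D x.1) v).
Proof.
have inv g : filter (fun x => D x.1) (ginv g) = ginv (filter (fun x => D x.1) g).
  rewrite /ginv filter_rev filter_map; congr (rev _).
elim=> {u v} [u|u v _ IH|u v w _ IH1 _ IH2|u u' v v' _ IH1 _ IH2|x _|j _|j g _ _].
- exact: wcong_refl.
- exact: wcong_sym.
- exact: wcong_trans IH1 IH2.
- by rewrite !filter_cat; apply: wcong_cat.
- by rewrite /=; case Dx: (D x.1); [apply: wcong_free | apply: wcong_refl].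
- have [Dj|Dj] := boolP (D j).
    by rewrite (all_filterP _) ?all_nseq ?Dj ?orbT //; apply: wcong_pow.
  rewrite (_ : filter _ _ = [::]); first exact: wcong_refl.
  by apply/eqP; rewrite -[_ == _]negbK -has_filter has_nseq (negPf Dj) andbF.
- rewrite /wconj !filter_cat !inv filter_rcons /=.
  set g' := filter _ _; have Dg : lets D g' by apply: filter_all.
  case: ifP => Dj; first exact: wcong_comm.
  exact: wcong_refl.
Qed.

(** * The group presented by these relations *)

Section QuotientGroup.
Variable n : nat.

(** The quotient construction takes a Boolean equivalence, so the inductive relation is decided
    classically. *)
Definition wcongb u v : bool :=
  if excluded_middle_informative (wcong n predT u v) then true else false.

Lemma wcongbP u v : reflect (wcong n predT u v) (wcongb u v).
Proof. by rewrite /wcongb; case: excluded_middle_informative => H; constructor. Qed.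

Lemma wcongb_refl : reflexive wcongb. Proof. by move=> u; apply/wcongbP/wcong_refl. Qed.
Lemma wcongb_sym : symmetric wcongb.
Proof. by move=> u v; apply/wcongbP/wcongbP; apply: wcong_sym. Qed.
Lemma wcongb_trans : transitive wcongb.
Proof. by move=> v u w /wcongbP uv /wcongbP vw; apply/wcongbP/(wcong_trans uv). Qed.
Canonical wcongb_equiv := EquivRel wcongb wcongb_refl wcongb_sym wcongb_trans.

Definition rfq := {eq_quot wcongb}%qT.
HB.instance Definition _ := Choice.on rfq.

Definition rpi (u : aword) : rfq := (\pi_({eq_quot wcongb}) u)%qT.
Definition rrepr (x : rfq) : aword := @repr _ ({eq_quot wcongb}%qT) x.

Lemma rpiP u v : rpi u = rpi v <-> wcong n predT u v.
Proof. by split=> [/eqmodP/wcongbP|/wcongbP/eqmodP]. Qed.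
Lemma rreprK x : rpi (rrepr x) = x. Proof. exact: reprK. Qed.
Lemma wcong_repr u : wcong n predT (rrepr (rpi u)) u.
Proof. by apply/rpiP; rewrite rreprK. Qed.

Lemma wcong_inv u v : wcong n predT u v -> wcong n predT (ginv u) (ginv v).
Proof.
have mulV w : wcong n predT (w ++ ginv w) [::].
  elim/last_ind: w => [|w x IH]; first exact: wcong_refl.
  rewrite -cats1 ginv_cat -catA; apply: wcong_trans IH.
  apply: wcong_cat; first exact: wcong_refl.
  rewrite catA -[X in wcong _ _ _ X]cat0s; apply: wcong_cat; last exact: wcong_refl.
  exact: wcong_free.
move=> uv; apply: (@wcong_trans _ _ _ (ginv u ++ (v ++ ginv v))).
  rewrite -{1}[ginv u]cats0; apply: wcong_cat; first exact: wcong_refl.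
  exact/wcong_sym.
rewrite catA -[X in wcong _ _ _ X]cat0s; apply: wcong_cat; last exact: wcong_refl.
have := mulV (ginv u); rewrite ginvK; apply: wcong_trans.
by apply: wcong_cat; [apply: wcong_refl | apply: wcong_sym].
Qed.

Definition rmul (x y : rfq) := rpi (rrepr x ++ rrepr y).
Definition rinv (x : rfq) := rpi (ginv (rrepr x)).

Lemma rpi_mul u v : rmul (rpi u) (rpi v) = rpi (u ++ v).
Proof. by apply/rpiP/wcong_cat; apply: wcong_repr. Qed.
Lemma rpi_inv u : rinv (rpi u) = rpi (ginv u).
Proof. by apply/rpiP/wcong_inv/wcong_repr. Qed.

Lemma rpi_mulV u : rpi (ginv u ++ u) = rpi [::].
Proof.
apply/rpiP; elim: u => [|x u IH]; first exact: wcong_refl.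
apply: wcong_trans IH; rewrite ginv_cons -catA; apply: wcong_cat; first exact: wcong_refl.
rewrite -[[:: linv x] ++ _]/([:: linv x; x] ++ u) -[X in wcong _ _ _ X]cat0s.
apply: wcong_cat; last exact: wcong_refl.
by have := @wcong_free n predT (linv x) isT; rewrite linvK.
Qed.

Lemma rmulA : associative rmul.
Proof. by move=> x y z; rewrite -[x]rreprK -[y]rreprK -[z]rreprK !rpi_mul catA. Qed.
Lemma rmul1 : left_id (rpi [::]) rmul.
Proof. by move=> x; rewrite -[x]rreprK rpi_mul. Qed.
Lemma rmulr1 : right_id (rpi [::]) rmul.
Proof. by move=> x; rewrite -[x]rreprK rpi_mul cats0. Qed.
Lemma rmulV : left_inverse (rpi [::]) rinv rmul.
Proof. by move=> x; rewrite -[x]rreprK rpi_inv rpi_mul rpi_mulV. Qed.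
Lemma rmulrV : right_inverse (rpi [::]) rinv rmul.
Proof.
by move=> x; rewrite -[x]rreprK rpi_inv rpi_mul -{1}[rrepr x]ginvK rpi_mulV.
Qed.

HB.instance Definition _ := isGroup.Build rfq rmulA rmul1 rmulr1 rmulV rmulrV.

Definition rgen k : rfq := rpi [:: (k, true)].

Lemma rgev w : gev rgen w = rpi w.
Proof.
elim: w => [|[k e] w IH]; first by rewrite gev_nil.
rewrite gev_cons IH -cat1s -rpi_mul; congr (rmul _ _); case: e => //=.
exact: rpi_inv.
Qed.

(** [wcong_comm] says a^g = a^(g a), that is, a^g is fixed under conjugation by a. *)
Lemma rgen_conj k g : commute (rgen k) (rgen k ^ g)%g.
Proof.
apply: commute_sym; rewrite /commute conjgC; congr (_ * _)%g.
rewrite -[g]rreprK -conjgM.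
have cj u : (rgen k ^ rpi u)%g = rpi (wconj [:: (k, true)] u).
  rewrite conjgE; rewrite -[(_ * _)%g]/(rmul (rinv _) (rmul _ _)).
  by rewrite /rgen rpi_inv rpi_mul rpi_mul.
rewrite -[(rpi _ * _)%g]/(rmul _ _) rpi_mul !cj.
by apply/rpiP/wcong_sym; rewrite cats1; apply: wcong_comm => //; apply/allP.
Qed.

Lemma rgen_pow k : (rgen k ^+ n)%g = 1%g.
Proof.
have -> : (rgen k ^+ n)%g = rpi (nseq n (k, true)).
  elim: n => [//|j IH]; rewrite expgS IH -[(_ * _)%g]/(rmul _ _) rpi_mul //.
exact/rpiP/wcong_pow.
Qed.

End QuotientGroup.

(** Faithfulness is applied to v^-1 u in the group on all generators, and the congruence obtained
    there is brought back to D by erasing letters. *)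
Theorem wcong_of_rcoef n (D : pred nat) u v : lets D u -> lets D v ->
  (forall M, uniq M -> all D M -> eqm n (rcoef u M) (rcoef v M)) -> wcong n D u v.
Proof.
move=> Du Dv uv.
(* At a monomial with a variable outside D both coefficients are 0. *)
have eT : forall M, uniq M -> eqm n (rcoef u M) (rcoef v M).
  move=> M uM; have [|/allPn[x xM Dx]] := boolP (all D M); first exact: uv.
  have era w : lets D w -> rcoef w M = 0%R.
    move=> Dw; rewrite -(@rcoef_absent x w M) //; congr rcoef.
    apply/esym/all_filterP; apply: sub_all Dw => y Dy.
    by apply: contraNneq Dx => <-.
  by rewrite !era ?eqm_refl.
suff: wcong n predT u v by move/(wcong_erase D); rewrite !(all_filterP _).
apply/rpiP; rewrite -!rgev; apply: (mulgI (gev (rgen n) (ginv v))).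
rewrite -!gev_cat [RHS]rgev (rpi_mulV n v).
apply: (@gev_trivial _ n); [exact: rgen_conj | exact: rgen_pow | move=> M M0 uM].
have q : weq n (size M).+1 predT (ginv v ++ u) [::].
  apply: weq_trans (weq_mulVw n (size M).+1 predT v).
  apply: weq_cat; first exact: weq_refl.
  by move=> P uP _ _; apply: eT.
have := q M uM (ltnSn _); rewrite /eqm /= (negPf M0) subr0; apply.
exact/allP.
Qed.

(** * Gauss diagrams *)

(** With the sign left out, distinctness of all keys says that a crossing has at most one tail and
    one head. *)
Definition key (l : letter) : nat * bool := (lid l, lover l).
Definition keys (d : gdiag) := map key (flatten d).

Lemma count_mem_uniq_le1 (T : eqType) (s : seq T) :
  (forall x, count_mem x s <= 1) -> uniq s.
Proof.
elim: s => //= x s IH H; apply/andP; split.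
  by have := H x; rewrite eqxx add1n ltnS leqn0 => /eqP/count_memPn.
by apply: IH => y; apply: leq_trans (H y); apply: leq_addl.
Qed.

Lemma wfP m d : wf m d <-> [/\ size d = m, uniq (keys d),
  forall c, ((c, true) \in keys d) = ((c, false) \in keys d) &
  forall x y, x \in flatten d -> y \in flatten d -> lid x = lid y -> lsgn x = lsgn y].
Proof.
have E c b : count_mem (c, b) (keys d) =
    count (fun l => (lid l == c) && (if b then lover l else ~~ lover l)) (flatten d).
  rewrite count_map; apply: eq_count => l /=; rewrite /key xpair_eqE.
  by case: b; case: (lover l).
split=> [[sd [cd sg]]|[sd uk kk sg]].
  have le1 c b : count_mem (c, b) (keys d) <= 1.
    have [eqc lec] := cd c; rewrite E; case: b => //.
    by rewrite -eqc.
  have uk : uniq (keys d) by apply: count_mem_uniq_le1 => -[c b].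
  split=> // c; have [eqc _] := cd c.
  have := E c true; have := E c false; rewrite /= -eqc.
  rewrite !count_uniq_mem // => <- [].
  by case: (_ \in _); case: (_ \in _).
split=> //; split=> // c; have := E c true; have := E c false => /= <- <-.
by rewrite !count_uniq_mem // kk; split=> //; case: (_ \in _).
Qed.

Lemma keys_mem d l : l \in flatten d -> key l \in keys d.
Proof. by move=> ld; apply/map_f. Qed.

Lemma mem_flatten_nth (T : eqType) (ss : seq (seq T)) x k :
  x \in nth [::] ss k -> x \in flatten ss.
Proof.
move=> xk; apply/flattenP; exists (nth [::] ss k) => //; apply: mem_nth.
by rewrite ltnNge; apply: contraTN xk => /(nth_default _) ->.
Qed.

Lemma nth_in_range (T : eqType) (ss : seq (seq T)) x k :
  x \in nth [::] ss k -> k < size ss.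
Proof. by rewrite ltnNge => xk; apply: contraTN xk => /(nth_default _) ->. Qed.

Lemma flatten_nthP (T : eqType) (ss : seq (seq T)) x :
  reflect (exists2 k, k < size ss & x \in nth [::] ss k) (x \in flatten ss).
Proof.
apply: (iffP idP) => [/flattenP[s /(nthP [::])[k ks <-] xs]|[k _ /mem_flatten_nth //]].
by exists k.
Qed.

Lemma uniq_flatten_nth (T : eqType) (ss : seq (seq T)) x i j :
  uniq (flatten ss) -> x \in nth [::] ss i -> x \in nth [::] ss j -> i = j.
Proof.
elim: ss i j => [|s ss IH] i j /=; first by rewrite nth_nil.
rewrite cat_uniq => /and3P[us /hasPn dis uss].
case: i j => [|i] [|j] //= xi xj; last by congr _.+1; apply: IH.
  by have /= := dis x (mem_flatten_nth xj); rewrite xi.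
by have /= := dis x (mem_flatten_nth xi); rewrite xj.
Qed.

Lemma keys_flatten d : keys d = flatten (map (map key) d).
Proof. exact: map_flatten. Qed.

Lemma nth_map_map (T U : Type) (f : T -> U) (d : seq (seq T)) k :
  nth [::] (map (map f) d) k = map f (nth [::] d k).
Proof.
have [kd|kd] := ltnP k (size d); first by rewrite (nth_map [::]).
by rewrite !nth_default ?size_map.
Qed.

Lemma nth_del C d k : nth [::] (del C d) k = filter (fun l => lid l \notin C) (nth [::] d k).
Proof.
have [kd|kd] := ltnP k (size d); first by rewrite (nth_map [::]).
by rewrite !nth_default ?size_map.
Qed.

Lemma uniq_keys_strand d k : uniq (keys d) -> uniq (map key (nth [::] d k)).
Proof.
rewrite keys_flatten -nth_map_map; elim: (map (map key) d) k => [|s ss IH] [|k] //=.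
  by rewrite cat_uniq => /andP[].
by rewrite cat_uniq => /and3P[_ _ /IH].
Qed.

Lemma key_strand d x y i j : uniq (keys d) ->
  x \in nth [::] d i -> y \in nth [::] d j -> key x = key y -> i = j.
Proof.
rewrite keys_flatten => uk xi yj xy.
apply: (uniq_flatten_nth (x := key x) uk); rewrite nth_map_map; first exact: map_f.
by rewrite xy; apply: map_f.
Qed.

Lemma uniq_keys_flatten d : uniq (keys d) -> uniq (flatten d).
Proof. exact: map_uniq. Qed.

Lemma wf_letter_eq m d x y : wf m d -> x \in flatten d -> y \in flatten d ->
  key x = key y -> x = y.
Proof.
move=> /wfP[_ _ _ sgn] xd yd; case: x y xd yd => [[c o] e] [[c' o'] e'] xd yd.
rewrite /key /lid /lover /= => -[e1 e2].
by subst c' o'; have /= -> := sgn _ _ xd yd erefl.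
Qed.

Lemma wf_other m d l : wf m d -> l \in flatten d ->
  (lid l, ~~ lover l, lsgn l) \in flatten d.
Proof.
move=> /wfP[_ _ kk sgn] ld.
have : (lid l, ~~ lover l) \in keys d.
  have := keys_mem ld; rewrite /key; case: (lover l) => /=; first by rewrite kk.
  by rewrite -kk.
case/mapP=> l' l'd [e1 e2]; have e3 := sgn _ _ ld l'd e1.
by rewrite e1 e2 e3; case: l' l'd {e1 e2 e3} => [[? ?] ?].
Qed.

Lemma key_block d i u w v x y k : uniq (keys d) -> nth [::] d i = u ++ w ++ v ->
  x \in w -> y \in nth [::] d k -> key x = key y ->
  [/\ k = i, y \notin u & y \notin v].
Proof.
move=> uk E xw yk xy.
have xi : x \in nth [::] d i by rewrite E !mem_cat xw orbT.
have <- := key_strand uk xi yk xy; split=> //.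
  have := uniq_keys_strand i uk; rewrite E map_cat cat_uniq => /and3P[_ /hasPn H _].
  apply/negP => yu; have /H : key x \in map key (w ++ v).
    by apply: map_f; rewrite mem_cat xw.
  by rewrite /= xy map_f.
have := uniq_keys_strand i uk; rewrite E !map_cat !cat_uniq => /and3P[_ _ /and3P[_ /hasPn H _]].
by apply/negP => yv; have /H := map_f key yv; rewrite /= -xy map_f.
Qed.

Lemma wf_size m d : wf m d -> size d = m. Proof. by case. Qed.

Definition isov c (l : letter) := (lid l == c) && lover l.
Definition tstrand (d : gdiag) (c : nat) := find (has (isov c)) d.

Lemma tstrand_eq d k l : uniq (keys d) -> l \in nth [::] d k -> lover l ->
  tstrand d (lid l) = k.
Proof.
move=> uk lk ol; have kd := nth_in_range lk.
have hk : has (isov (lid l)) (nth [::] d k).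
  by apply/hasP; exists l; rewrite // /isov eqxx.
have hd : has (has (isov (lid l))) d.
  by apply/hasP; exists (nth [::] d k) => //; apply: mem_nth.
have := nth_find [::] hd => /hasP[l' l'k /andP[/eqP e1 e2]].
by apply/esym/(key_strand uk lk l'k); rewrite /key e1 e2 ol.
Qed.

Lemma find_isov d k u l v : uniq (keys d) -> nth [::] d k = u ++ l :: v -> lover l ->
  find (isov (lid l)) (nth [::] d k) = size u.
Proof.
move=> uk E ol; have := uniq_keys_strand k uk.
rewrite E map_cat cat_uniq => /and3P[_ /hasPn H _].
rewrite find_cat /= /isov eqxx ol /= addn0 ifN //.
apply/hasPn => x xu; apply/negP => /andP[/eqP e1 e2].
have /H : key l \in map key (l :: v) by rewrite map_f ?mem_head.
by rewrite /= (_ : key l = key x) ?map_f // /key e1 ol e2.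
Qed.

Lemma over_arcE d k u l v : uniq (keys d) -> nth [::] d k = u ++ l :: v -> lover l ->
  over_arc d (lid l) = (k, count (fun l => ~~ lover l) u).
Proof.
move=> uk E ol; rewrite /over_arc.
have lk : l \in nth [::] d k by rewrite E mem_cat mem_head orbT.
rewrite -/(isov (lid l)) -/(tstrand d (lid l)) (tstrand_eq uk lk ol).
by rewrite (find_isov uk E ol) E take_size_cat.
Qed.

Definition exch (x y : letter) (l : letter) : letter :=
  if l == x then y else if l == y then x else l.

Lemma exch_id x y s : x \notin s -> y \notin s -> map (exch x y) s = s.
Proof.
move=> xs ys; rewrite -[RHS]map_id; apply/eq_in_map => l ls; rewrite /exch.
by case: eqP => [E|_]; [rewrite -E ls in xs | case: eqP => [E|//]; rewrite -E ls in ys].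
Qed.

(* Endpoints occur only once, so transposing two adjacent endpoints is the
   global exchange of the two letters. *)
Lemma swap_at_exch d i p x y : uniq (flatten d) -> at_pair d i p x y ->
  swap_at d i p = map (map (exch x y)) d.
Proof.
move=> ud [u [v [E sp]]]; rewrite /swap_at E.
have id : i < size d by apply: (@nth_in_range _ d x); rewrite E mem_cat mem_head orbT.
have xi : x \in nth [::] d i by rewrite E mem_cat mem_head orbT.
have yi : y \in nth [::] d i by rewrite E mem_cat !inE eqxx !orbT.
have us : uniq (u ++ [:: x; y] ++ v).
  rewrite -E; elim: d i ud {E id xi yi} => [|s ss IH] [|i] //=.
    by rewrite cat_uniq => /andP[].
  by rewrite cat_uniq => /and3P[_ _ /IH].
apply: (@eq_from_nth _ [::]) => [|k].
  by rewrite size_set_nth size_map; apply/maxn_idPr.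
rewrite size_set_nth (maxn_idPr id) nth_set_nth /= => kd.
rewrite nth_map_map; case: eqP => [->|ki].
  rewrite E take_size_cat // !nth_cat sp ltnn ltnNge leqnSn /= subnn subSnn /=.
  have -> : drop p.+2 (u ++ [:: x, y & v]) = v.
    by rewrite -sp -addn2 drop_cat ltnNge leq_addr /= addKn /= drop0.
  rewrite map_cat /=.
  move: us; rewrite cat_uniq => /and3P[_ /hasPn H].
  have xu : x \notin u by apply: H; rewrite mem_head.
  have yu : y \notin u by apply: H; rewrite !inE eqxx orbT.
  rewrite cons_uniq inE negb_or => /and3P[/andP[xy xv] yv _].
  rewrite !exch_id // /exch !eqxx.
  by rewrite [y == x]eq_sym (negPf xy).
rewrite exch_id //.
  by apply/negP => xk; apply: ki; apply: uniq_flatten_nth ud xk xi.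
by apply/negP => yk; apply: ki; apply: uniq_flatten_nth ud yk yi.
Qed.

Lemma wf_del m C d : wf m d -> wf m (del C d).
Proof.
have E : flatten (del C d) = filter (fun l => lid l \notin C) (flatten d).
  by rewrite filter_flatten.
have EK : keys (del C d) = filter (fun k => k.1 \notin C) (keys d).
  by rewrite /keys E filter_map.
move=> /wfP[sd uk kk sgn]; apply/wfP; split.
- by rewrite size_map.
- by rewrite EK filter_uniq.
- by move=> c; rewrite EK !mem_filter /= kk.
- by move=> x y; rewrite E !mem_filter => /andP[_ xd] /andP[_ yd]; apply: sgn.
Qed.

Lemma count_lid c (s : seq letter) : count (fun l => lid l == c) s =
  count_mem (c, true) (map key s) + count_mem (c, false) (map key s).
Proof.
rewrite !count_map -count_predUI [X in _ = _ + X](_ : _ = 0) ?addn0; last first.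
  apply/eqP; rewrite -leqn0 leqNgt -has_count; apply/hasPn => l _ /=.
  by rewrite /key !xpair_eqE; case: (lover l); rewrite ?andbF.
by apply: eq_count => l /=; rewrite /key !xpair_eqE; case: (lover l); rewrite ?andbT ?andbF ?orbF.
Qed.

(** A kink is a self-crossing, so R1 is absorbed by sv. *)
Lemma R1_sv m d d' : wf m d' -> R1_step d d' -> sv_step d d'.
Proof.
move=> /wfP[_ uk _ _] [c [x [y [-> [xc [yc [i [u [v E]]]]]]]]].
exists c, i; split=> //.
have us := uniq_keys_strand i uk.
have two : 1 < count (fun l => lid l == c) (nth [::] d' i).
  by rewrite E !count_cat /= xc yc eqxx; lia.
split; first by rewrite has_count; lia.
apply/eqP; rewrite eqn_leq two andbT.
rewrite count_lid.
by rewrite !count_uniq_mem //; case: (_ \in _); case: (_ \in _).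
Qed.

Lemma perm_flatten_nth (d d' : gdiag) : size d = size d' ->
  (forall k, perm_eq (nth [::] d k) (nth [::] d' k)) -> perm_eq (flatten d) (flatten d').
Proof.
elim: d d' => [|s d IH] [|s' d'] //= [sz] H.
by apply: perm_cat; [apply: (H 0) | apply: IH => // k; apply: (H k.+1)].
Qed.

Lemma wf_perm m (d d' : gdiag) : size d = size d' -> perm_eq (flatten d) (flatten d') ->
  wf m d -> wf m d'.
Proof.
move=> sz pe /wfP[sd uk kk sgn]; have pk : perm_eq (keys d) (keys d') by apply: perm_map.
apply/wfP; split.
- by rewrite -sz.
- by rewrite -(perm_uniq pk).
- by move=> c; rewrite -!(perm_mem pk).
- by move=> x y; rewrite -!(perm_mem pe); apply: sgn.
Qed.

Lemma swap_atE d i p x y : at_pair d i p x y -> exists u v,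
  [/\ nth [::] d i = u ++ [:: x; y] ++ v, size (swap_at d i p) = size d,
   nth [::] (swap_at d i p) i = u ++ [:: y; x] ++ v &
   forall k, k != i -> nth [::] (swap_at d i p) k = nth [::] d k].
Proof.
case=> u [v [E sp]]; exists u, v.
have id : i < size d by apply: (@nth_in_range _ d x); rewrite E mem_cat mem_head orbT.
rewrite /swap_at; split=> //.
- by rewrite size_set_nth; apply/maxn_idPr.
- rewrite nth_set_nth /= eqxx E take_size_cat //.
  rewrite !nth_cat sp ltnn ltnNge leqnSn /= subnn subSnn /=.
  by rewrite -sp -addn2 drop_cat ltnNge leq_addr /= addKn /= drop0.
by move=> k /negPf ki; rewrite nth_set_nth /= ki.
Qed.

Lemma perm_swap_at d i p x y : at_pair d i p x y ->
  forall k, perm_eq (nth [::] (swap_at d i p) k) (nth [::] d k).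
Proof.
move=> /swap_atE[u [v [E _ Ei Ek]]] k; have [->|ki] := eqVneq k i; last by rewrite Ek.
by rewrite E Ei perm_cat2l perm_cat2r; apply/permP => P /=; rewrite !addn0 addnC.
Qed.

Lemma wf_swap_at m d i p x y : at_pair d i p x y -> wf m d -> wf m (swap_at d i p).
Proof.
move=> ap; have [_ [_ [_ sz _ _]]] := swap_atE ap.
apply: wf_perm => //; apply: perm_flatten_nth => // k.
by rewrite perm_sym; apply: (perm_swap_at ap).
Qed.

Lemma at_pair_exch d i p x y u v : u <> x -> u <> y -> v <> x -> v <> y ->
  at_pair d i p u v -> at_pair (map (map (exch x y)) d) i p u v.
Proof.
move=> ux uy vx vy [a [b [E sa]]]; exists (map (exch x y) a), (map (exch x y) b).
rewrite nth_map_map E map_cat /= size_map; split=> //.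
by rewrite /exch !(introF eqP).
Qed.

Lemma del_exch C x y d : lid x \in C -> lid y \in C -> del C (map (map (exch x y)) d) = del C d.
Proof.
move=> xC yC; rewrite /del -map_comp; apply: eq_map => s /=.
elim: s => //= l s ->; rewrite /exch; case: eqP => [->|_]; first by rewrite xC yC.
by case: eqP => [->|//]; rewrite xC yC.
Qed.

Lemma self_sv m d i x y : wf m d -> x \in nth [::] d i -> y \in nth [::] d i ->
  lid x = lid y -> lover x -> ~~ lover y -> sv_step (del [:: lid x] d) d.
Proof.
move=> /wfP[_ uk _ _] xi yi xy ox oy; exists (lid x), i; split=> //.
have us := uniq_keys_strand i uk; split.
  by apply/hasP; exists x.
rewrite count_lid !count_uniq_mem //.
have := map_f key xi; rewrite {1}/key ox => ->.
by have := map_f key yi; rewrite {1}/key -xy (negPf oy) => ->.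
Qed.

(** * Colorings and Milnor numbers *)

(** t gives the value of the over-arc of each crossing. One block is kept per head, so that the
    first k blocks form the conjugator of the k-th arc. *)
Definition hblocks (t : nat -> aword) (s : seq letter) : seq aword :=
  [seq gpow (t (lid l)) (lsgn l) | l <- s & ~~ lover l].
Definition hword t s : aword := flatten (hblocks t s).

Lemma hword_cat t u v : hword t (u ++ v) = hword t u ++ hword t v.
Proof. by rewrite /hword /hblocks filter_cat map_cat flatten_cat. Qed.

Lemma weq_hword n q D t t' s :
  (forall l, l \in s -> ~~ lover l -> weq n q D (t (lid l)) (t' (lid l))) ->
  weq n q D (hword t s) (hword t' s).
Proof.
elim: s => [_|l s IH H]; first exact: weq_refl.
have IHs : weq n q D (hword t s) (hword t' s).
  by apply: IH => x xs; apply: H; rewrite inE xs orbT.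
rewrite /hword /hblocks /=; case: ifP => // ol /=.
by apply: weq_cat => //; apply/weq_gpow/H => //; rewrite mem_head.
Qed.

(* y is the value at the start of s of the Wirtinger generator of the strand;
   tc and hc give the over-arc values as seen from the tails and from the heads. *)
Fixpoint scol n q (tc hc : nat -> aword) (y : aword) (s : seq letter) : Prop :=
  if s is l :: s' then
    if lover l then weq n q predT (tc (lid l)) y /\ scol n q tc hc y s'
    else scol n q tc hc (wconj y (gpow (hc (lid l)) (lsgn l))) s'
  else True.

(** Values at crossings suffice, since any arc of strand k carries 1 + X_k conjugated by the heads
    met before. Tails and heads see the same t here; [scol] keeps them apart for the halfway diagram
    of R3. *)
Definition coloring n q (d : gdiag) (t : nat -> aword) : Prop :=
  forall k, k < size d -> scol n q t t [:: (k, true)] (nth [::] d k).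

Lemma conj0 (T : Type) (y : seq (T * bool)) : wconj y [::] = y.
Proof. by rewrite /wconj cats0. Qed.

Lemma col_cat n q tc hc y u v :
  scol n q tc hc y (u ++ v) <-> scol n q tc hc y u /\ scol n q tc hc (wconj y (hword hc u)) v.
Proof.
elim: u y => [|l u IH] y /=; first by rewrite conj0; split=> [|[]].
rewrite /hword /hblocks /=; case ol: (lover l) => /=.
  by split=> [[H /IH[]]|[[H1 H2] H3]]; do ?split=> //; apply/IH.
by rewrite conj_cat -/(hword hc u); exact: IH.
Qed.

Lemma col_tail n q tc hc y u l v : scol n q tc hc y (u ++ l :: v) -> lover l ->
  weq n q predT (tc (lid l)) (wconj y (hword hc u)).
Proof. by case/col_cat => _ /= + ol; rewrite ol => -[]. Qed.

Lemma colI n q tc hc y s :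
  (forall u l v, s = u ++ l :: v -> lover l ->
     weq n q predT (tc (lid l)) (wconj y (hword hc u))) -> scol n q tc hc y s.
Proof.
elim: s y => //= l s IH y H; case: ifP => ol.
  split; first by have := H [::] l s erefl ol; rewrite conj0.
  apply: IH => u x v E ox; have := H (l :: u) x v (congr1 (cons l) E) ox.
  by rewrite /hword /hblocks /= ol.
apply: IH => u x v E ox; have := H (l :: u) x v (congr1 (cons l) E) ox.
by rewrite /hword /hblocks /= ol /= conj_cat.
Qed.

Lemma col_weq n q tc hc tc' hc' y y' s : weq n q predT y y' ->
  (forall l, l \in s -> lover l -> weq n q predT (tc (lid l)) (tc' (lid l))) ->
  (forall l, l \in s -> ~~ lover l -> weq n q predT (hc (lid l)) (hc' (lid l))) ->
  scol n q tc hc y s -> scol n q tc' hc' y' s.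
Proof.
elim: s y y' => //= l s IH y y' yy Ht Hh.
have Ht' : forall x, x \in s -> lover x -> weq n q predT (tc (lid x)) (tc' (lid x)).
  by move=> x xs; apply: Ht; rewrite inE xs orbT.
have Hh' : forall x, x \in s -> ~~ lover x -> weq n q predT (hc (lid x)) (hc' (lid x)).
  by move=> x xs; apply: Hh; rewrite inE xs orbT.
case: ifP => ol; last first.
  apply: IH => //; apply: weq_conj => //; apply/weq_gpow/Hh; first exact: mem_head.
  by rewrite ol.
case=> H /IH; move=> K; split; last exact: K.
apply: weq_trans yy; apply: weq_trans H; apply/weq_sym/Ht => //; exact: mem_head.
Qed.

(** Agreement below degree r at all heads gives agreement below degree r + 1 at all tails, by
    [weq_conj_succ]; a head takes over the value of its tail. *)
Lemma coloring_unique m n q d t t' l : wf m d -> coloring n q d t -> coloring n q d t' ->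
  l \in flatten d -> weq n q predT (t (lid l)) (t' (lid l)).
Proof.
move=> wd ct ct' ld.
suff H : forall r, r <= q -> forall l, l \in flatten d ->
   weq n r predT (t (lid l)) (t' (lid l)) by exact: H.
elim=> [|r IH] rq {}l {}ld; first by move=> M _; rewrite ltn0.
wlog ol : l ld / lover l => [W|].
  have [ol|ol] := boolP (lover l); first exact: W.
  by have /= := W _ (wf_other wd ld); rewrite /lover /=; apply.
have /flatten_nthP[k ks] := ld; case/splitPr E : _ / => [u v].
have := ct k ks; rewrite E => /col_tail/(_ ol) e1.
have := ct' k ks; rewrite E => /col_tail/(_ ol) e2.
apply: weq_trans (weq_le rq e1) (weq_trans _ (weq_sym (weq_le rq e2))).
apply: weq_conj_succ; apply: weq_hword => x xu _; apply: IH; first exact: ltnW.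
by apply: (@mem_flatten_nth _ _ _ k); rewrite E mem_cat xu.
Qed.

Definition arcv t (d : gdiag) (g : gen) : aword :=
  wconj [:: (g.1, true)] (flatten (take g.2 (hblocks t (nth [::] d g.1)))).

Lemma arcv_over t d k u l v : uniq (keys d) -> nth [::] d k = u ++ l :: v -> lover l ->
  arcv t d (over_arc d (lid l)) = wconj [:: (k, true)] (hword t u).
Proof.
move=> uk E ol; rewrite (over_arcE uk E ol) /arcv /= E /hblocks filter_cat map_cat.
by rewrite -size_filter -(size_map (fun l => gpow (t (lid l)) (lsgn l))) take_size_cat.
Qed.

(** Successive approximation over the integers: each pass recomputes all over-arc values from the
    previous ones and settles one more degree. *)
Fixpoint tcol (d : gdiag) (r : nat) : nat -> aword :=
  if r is r'.+1 then fun c => arcv (tcol d r') d (over_arc d c) else fun=> [::].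

Lemma weq_flatten n q D us vs : size us = size vs ->
  (forall i, weq n q D (nth [::] us i) (nth [::] vs i)) ->
  weq n q D (flatten us) (flatten vs).
Proof.
elim: us vs => [|u us IH] [|v vs] //= E H; first exact: weq_refl.
apply: weq_cat; first exact: (H 0).
by apply: IH => [|i]; [case: E | exact: (H i.+1)].
Qed.

Lemma weq_arcv n q t t' d g : (forall c, weq n q predT (t c) (t' c)) ->
  weq n q.+1 predT (arcv t d g) (arcv t' d g).
Proof.
move=> H; apply: weq_conj_succ; apply: weq_flatten => [|i].
  by rewrite !size_take !size_map.
have [ig|gi] := ltnP i g.2; last first.
  have A (ss : seq aword) : nth [::] (take g.2 ss) i = [::].
    by rewrite nth_default // (leq_trans _ gi) // size_take_min geq_minl.
  by rewrite !A; apply: weq_refl.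
rewrite !nth_take // /hblocks; set s := filter _ _.
have [is_|si] := ltnP i (size s); last first.
  by rewrite !nth_default ?size_map //; apply: weq_refl.
by rewrite !(nth_map (0, true, true)) //; apply: weq_gpow.
Qed.

Lemma tcol_stable d r c : weq 0 r predT (tcol d r c) (tcol d r.+1 c).
Proof.
elim: r c => [|r IH] c; first by move=> M _; rewrite ltn0.
exact: weq_arcv.
Qed.

Lemma tcol_coloring m d q : wf m d -> coloring 0 q d (tcol d q).
Proof.
move=> /wfP[_ uk _ _] k ks; apply: colI => u l v E ol.
have st := @tcol_stable d q (lid l); move: st => /=.
by rewrite (arcv_over _ uk E ol).
Qed.

Lemma coloring_of0 n q d t : coloring 0 q d t -> coloring n q d t.
Proof.
move=> ct k ks; apply: colI => u l v E ol; apply: weq_of0.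
by have := ct k ks; rewrite E => /col_tail; apply.
Qed.

Definition wev t d (w : word) : aword := flatten [seq gpow (arcv t d x.1) x.2 | x <- w].

Lemma wev_cat t d u v : wev t d (u ++ v) = wev t d u ++ wev t d v.
Proof. by rewrite /wev map_cat flatten_cat. Qed.

Lemma wev_inv t d w : wev t d (winv w) = ginv (wev t d w).
Proof.
elim: w => [//|x w IH]; rewrite -cat1s wev_cat ginv_cat -IH.
rewrite -[winv _]/(ginv (T := gen) ([:: x] ++ w)) ginv_cat wev_cat; congr (_ ++ _).
by rewrite /wev /= !cats0 ginv_gpow.
Qed.

Lemma wev_emb t d lam : wev t d (emb lam) = lam.
Proof.
elim: lam => [//|[j e] lam IH]; rewrite /= -cat1s wev_cat IH -[RHS]cat1s; congr (_ ++ _).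
by rewrite /wev /= cats0 /arcv /= take0 conj0; case: e.
Qed.

Lemma wev_comm n t d k w : is_comm k w -> weq n k predT (wev t d w) [::].
Proof.
elim=> {k w} [w|k w v cw IH].
  by move=> M _; rewrite ltnS leqn0 => /nilP -> _; rewrite rcoef_nil eqm_refl.
have k0 : 0 < k by case: cw.
rewrite !wev_cat !wev_inv; set W := wev t d w in IH *; set V := wev t d v.
apply: weq_trans (weq_mulVw n k.+1 predT (V ++ W)).
rewrite ginv_cat -catA; do 2![apply: weq_cat; first exact: weq_refl].
exact: weq_comm_succ.
Qed.

Lemma arcv_over_weq m n q d t i : wf m d -> coloring n q d t ->
  forall l, l \in nth [::] d i ->
  weq n q predT (arcv t d (over_arc d (lid l))) (t (lid l)).
Proof.
move=> wd ct l li; have ld := mem_flatten_nth li.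
wlog ol : l {li} ld / lover l => [W|].
  have [ol|ol] := boolP (lover l); first exact: W.
  by have /= := W _ (wf_other wd ld); rewrite /lover /=; apply.
have /wfP[_ uk _ _] := wd.
have /flatten_nthP[k ks] := ld; case/splitPr E : _ / => [u v].
rewrite (arcv_over _ uk E ol).
by have := ct k ks; rewrite E => /col_tail/(_ ol)/weq_sym.
Qed.

Lemma wev_u_wordE t d i : wev t d (u_word d i) =
  flatten [seq gpow (arcv t d (over_arc d (lid l))) (lsgn l) | l <- nth [::] d i & ~~ lover l].
Proof. by rewrite /wev /u_word -map_comp. Qed.

Lemma weq_u_word m n q d t i : wf m d -> coloring n q d t ->
  weq n q predT (wev t d (u_word d i)) (hword t (nth [::] d i)).
Proof.
move=> wd ct; rewrite wev_u_wordE.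
have H := arcv_over_weq (i := i) wd ct.
rewrite -[flatten _]/(hword (fun c => arcv t d (over_arc d c)) (nth [::] d i)).
by apply: weq_hword => l li _; apply: H.
Qed.

Lemma wev_relator m n q d t r : wf m d -> coloring n q d t -> is_relator d r ->
  weq n q predT (wev t d r) [::].
Proof.
move=> wd ct [i [j [id [jd ->]]]]; rewrite !wev_cat wev_inv.
set s := filter (fun l => ~~ lover l) (nth [::] d i).
have js : j < size s by move: jd; rewrite size_map.
set l := nth (0, true, true) s j.
have ls : l \in nth [::] d i by have := mem_nth (0, true, true) js; rewrite mem_filter => /andP[].
have -> : nth dfltg (u_word d i) j = (over_arc d (lid l), lsgn l).
  by rewrite (nth_map (0, true, true)).
have H := arcv_over_weq wd ct ls.
rewrite /wev /= !cats0.
have -> : arcv t d (i, j.+1) = wconj (arcv t d (i, j)) (gpow (t (lid l)) (lsgn l)).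
  rewrite /arcv /= (take_nth [::]) ?size_map // flatten_rcons conj_cat.
  by rewrite (nth_map (0, true, true)).
set a := arcv t d (i, j); set U := gpow (arcv _ _ _) _.
have UU := weq_gpow (lsgn l) H; rewrite -/U in UU.
apply: weq_trans (weq_mulVw n q predT (wconj a U)).
apply: weq_cat; last exact: weq_refl.
by apply/weq_inv/weq_conj; [apply: weq_refl | apply: weq_sym].
Qed.

Lemma wev_congr m n q d t w w' : wf m d -> coloring n q d t ->
  congr_q d q w w' -> weq n q predT (wev t d w) (wev t d w').
Proof.
move=> wd ct; elim=> {w w'} [w w' st|w|w w' _ IH|u v w _ IH1 _ IH2].
- have K u r v : weq n q predT (wev t d r) [::] ->
     weq n q predT (wev t d (u ++ r ++ v)) (wev t d (u ++ v)).
    move=> rn; rewrite !wev_cat; apply: weq_cat; first exact: weq_refl.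
    by rewrite -[X in weq _ _ _ _ X]cat0s; apply: weq_cat => //; apply: weq_refl.
  case: st => {w w'} [u v x|u v r rel|u v r cm]; apply: K.
  + by rewrite /wev /= cats0 -ginv_gpow; apply: weq_mulV.
  + exact: (wev_relator wd ct rel).
  + by apply: wev_comm cm.
- exact: weq_refl.
- exact: weq_sym.
- exact: weq_trans IH1 IH2.
Qed.

Lemma weq_longitude m n q d t i : wf m d -> coloring n q d t ->
  weq n q (predC1 i) (wev t d (longitude d i)) (hword t (nth [::] d i)).
Proof.
move=> wd ct; rewrite /longitude wev_cat -[X in weq _ _ _ _ X]cat0s.
apply: weq_cat; last by apply: weq_sub (weq_u_word i wd ct).
have H k e : weq n q (predC1 i) (wev t d (nseq k (i, 0, e))) [::].
  elim: k => [|k IH]; first exact: weq_refl.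
  rewrite /wev /= -/(wev t d _) -[X in weq _ _ _ _ X]cat0s; apply: weq_cat => //.
  rewrite /arcv /= take0 conj0.
  by case: e {IH}; apply: weq_letter; rewrite /= eqxx.
by case: ifP.
Qed.

Definition mu_index m (I : seq 'I_m) : nat := last 0 (map val I).
Definition mu_seq m (I : seq 'I_m) : seq nat := take (size I).-1 (map val I).

Lemma mu_seqP m (I : seq 'I_m) : I != [::] -> uniq I ->
  [/\ uniq (mu_seq I), size (mu_seq I) < size I & all (predC1 (mu_index I)) (mu_seq I)].
Proof.
rewrite /mu_seq /mu_index; case/lastP: I => [//|I i] _ uI.
have E : take (size (rcons I i)).-1 [seq val k | k <- rcons I i] = map val I.
  by rewrite size_rcons /= map_rcons -cats1 take_size_cat ?size_map.
rewrite E map_rcons last_rcons size_map size_rcons; split=> //.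
  by move: uI; rewrite rcons_uniq (map_inj_uniq val_inj) => /andP[].
apply/allP => k /mapP[j jI ->] /=; apply/eqP => /val_inj ij.
by move: uI; rewrite rcons_uniq -ij jI.
Qed.

(** Independence of the chosen level and word: evaluation through a coloring respects the relators
    and the lower central series, fixes [lam], and sends the longitude to its head word up to
    X_i. *)
Lemma IsMuRep_rcoef m n q d t (I : seq 'I_m) c : wf m d -> I != [::] -> uniq I ->
  size I <= q -> coloring n q d t -> IsMuRep d I c ->
  eqm n c (rcoef (hword t (nth [::] d (mu_index I))) (mu_seq I)).
Proof.
move=> wd I0 uI Iq ct [r [lam [Ir [_ [cg ->]]]]].
have [uM sM aM] := mu_seqP I0 uI.
rewrite -/(mu_seq I) mcoef_rcoef //.
have ct0 := tcol_coloring r wd.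
have E1 := weq_sub (D' := predC1 (mu_index I)) (leqnn r) (fun _ _ => isT)
   (wev_congr wd ct0 cg).
have E2 := weq_longitude (i := mu_index I) wd ct0.
rewrite wev_emb in E1.
have E3 := weq_trans (weq_sym E1) E2.
apply: eqm_trans (_ : eqm n _ (rcoef (hword (tcol d r) (nth [::] d (mu_index I))) (mu_seq I))) _.
  by apply: eqm_of0; apply: E3 => //; apply: leq_trans sM Ir.
(* The level r chosen with [lam] and the given q may differ; both colorings are truncated to
   [size I], where uniqueness compares them. *)
have le x : weq n (size I) x (hword (tcol d r) (nth [::] d (mu_index I)))
   (hword t (nth [::] d (mu_index I))).
  apply: weq_hword => l lk _; apply: (@weq_sub n (size I) _ predT) => //.
  have sub q' t' : size I <= q' -> coloring n q' d t' -> coloring n (size I) d t'.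
    move=> Iq' ct' k ks; apply: colI => u x' v E ol; apply: weq_le Iq' _.
    by have := ct' k ks; rewrite E => /col_tail; apply.
  apply: (coloring_unique wd) (mem_flatten_nth lk); first exact: (sub _ _ Ir (@coloring_of0 n _ _ _ ct0)).
  exact: (sub _ _ Iq ct).
exact: le aM.
Qed.

(** * Words modulo the relators and the lower central series *)

Section Congr.
Variables (d : gdiag) (q : nat).
Local Notation "u ~q v" := (congr_q d q u v) (at level 70).

Lemma congr_refl w : w ~q w. Proof. exact: rst_refl. Qed.
Lemma congr_sym u v : u ~q v -> v ~q u. Proof. exact: rst_sym. Qed.
Lemma congr_trans u v w : u ~q v -> v ~q w -> u ~q w. Proof. exact: rst_trans. Qed.

Lemma congr_ctx a u v b : u ~q v -> a ++ u ++ b ~q a ++ v ++ b.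
Proof.
elim=> {u v} [u v st|u|u v _|u v w _ IH1 _ IH2].
- apply: rst_step; case: st => {u v} [u v x|u v r rel|u v r cm].
  + by have := ws_free d q (a ++ u) (v ++ b) x; rewrite -!catA.
  + by have := ws_rel q (a ++ u) (v ++ b) rel; rewrite -!catA.
  + by have := ws_comm d (a ++ u) (v ++ b) cm; rewrite -!catA.
- exact: congr_refl.
- exact: congr_sym.
- exact: congr_trans IH1 IH2.
Qed.

Lemma congr_cat u u' v v' : u ~q u' -> v ~q v' -> u ++ v ~q u' ++ v'.
Proof.
move=> uu vv; apply: (@congr_trans _ (u' ++ v)).
  exact: (@congr_ctx [::] u u' v).
by have := congr_ctx u' [::] vv; rewrite !cats0.
Qed.

Lemma congr_free (x : gen * bool) : [:: x; linv x] ~q [::].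
Proof. by apply: rst_step; apply: (@ws_free d q [::] [::] x). Qed.

Lemma congr_mulV (w : word) : w ++ ginv w ~q [::].
Proof.
elim/last_ind: w => [|w x IH]; first exact: congr_refl.
rewrite -cats1 ginv_cat -catA; apply: congr_trans IH.
by rewrite catA -[X in _ ~q X]/(w ++ [::] ++ ginv w) catA -!catA; apply: congr_ctx (congr_free x).
Qed.

Lemma congr_mulVw (w : word) : ginv w ++ w ~q [::].
Proof. by have := congr_mulV (ginv w); rewrite ginvK. Qed.

Lemma congr_inv (u v : word) : u ~q v -> ginv u ~q ginv v.
Proof.
move=> uv; apply: (@congr_trans _ (ginv u ++ (v ++ ginv v))).
  rewrite -[X in X ~q _]cats0; apply: congr_cat; first exact: congr_refl.
  exact/congr_sym/congr_mulV.
rewrite catA -[X in _ ~q X]cat0s; apply: congr_cat; last exact: congr_refl.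
apply: congr_trans (congr_mulVw u).
by apply: congr_cat; [apply: congr_refl | apply: congr_sym].
Qed.

Lemma congr_conj (y y' h h' : word) : y ~q y' -> h ~q h' -> wconj y h ~q wconj y' h'.
Proof. by move=> yy hh; do 2?apply: congr_cat => //; apply: congr_inv. Qed.

Lemma congr_relator r : is_relator d r -> r ~q [::].
Proof. by move=> rel; have := ws_rel q [::] [::] rel; rewrite cats0 => ?; apply: rst_step. Qed.

Lemma congr_comm r : is_comm q r -> r ~q [::].
Proof. by move=> cm; have := ws_comm d [::] [::] cm; rewrite cats0 => ?; apply: rst_step. Qed.

End Congr.

(** The gain of one degree in the group: if r has weight q, then [r, b^-1] = b^r b^-1 has weight q +
    1, so b^r and b agree one level further. *)
Lemma congr_conj_succ d q (a w w' : word) : congr_q d q w w' ->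
  congr_q d q.+1 (wconj a w) (wconj a w').
Proof.
elim=> {w w'} [w w' st|w|w w' _|u v w _ IH1 _ IH2]; last 3 first.
- exact: congr_refl.
- exact: congr_sym.
- exact: congr_trans IH1 IH2.
have K u r v : (forall b, congr_q d q.+1 (wconj b r) b) ->
    congr_q d q.+1 (wconj a (u ++ r ++ v)) (wconj a (u ++ v)).
  move=> H; rewrite !conj_cat; apply: congr_conj; [exact: H | exact: congr_refl].
have nilK r : congr_q d q.+1 r [::] -> forall b, congr_q d q.+1 (wconj b r) b.
  move=> rn b; rewrite -[X in congr_q _ _ _ X]conj0.
  by apply: congr_conj => //; apply: congr_refl.
case: st => {w w'} [u v x|u v r rel|u v r cm]; apply: K.
- by apply: nilK; apply: congr_free.
- by apply: nilK; apply: congr_relator.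
move=> b; have := congr_comm d (commS (ginv b) cm).
have -> : winv r ++ winv (ginv b) ++ r ++ ginv b = wconj b r ++ ginv b.
  by rewrite -[winv (ginv b)]/(ginv (ginv b)) ginvK /wconj -!catA.
move=> H; have := congr_cat H (congr_refl d q.+1 b); rewrite -catA /=.
apply: congr_trans; rewrite -[X in congr_q _ _ X _]cats0.
by apply: congr_cat; [apply: congr_refl | apply/congr_sym/congr_mulVw].
Qed.

(** * Existence of words representing the longitudes *)

Section MuExists.
Variables (m : nat) (d : gdiag).
Hypothesis wd : wf m d.

Definition in_range (g : gen) : bool := (g.1 < m) && (g.2 <= size (u_word d g.1)).

Lemma u_word_range i : all (fun x => in_range x.1) (u_word d i).
Proof.
have /wfP[sd uk _ _] := wd.
apply/allP => x /mapP[l]; rewrite mem_filter => /andP[ol li] -> /=.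
have := wf_other wd (mem_flatten_nth li); rewrite ol /=.
set l' := (_, _, _) => /flatten_nthP[k ks]; case/splitPr E : _ / => [u v].
have ol' : lover l' by [].
have := over_arcE uk E ol'; rewrite /lid /= -/(lid l) => ->.
by rewrite /in_range /= -sd ks /u_word size_map size_filter E count_cat leq_addr.
Qed.

Lemma arc_conj q i k : i < m -> k <= size (u_word d i) ->
  congr_q d q [:: ((i, k), true)] (wconj [:: ((i, 0), true)] (take k (u_word d i))).
Proof.
move=> im; elim: k => [|k IH] ks; first by rewrite take0 conj0; apply: congr_refl.
have /wfP[sd _ _ _] := wd.
rewrite (take_nth dfltg) // -cats1 conj_cat; set U := [:: nth _ _ _].
have rel : is_relator d ([:: ((i, k.+1), false)] ++ winv U ++ [:: ((i, k), true)] ++ U).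
  by exists i, k; rewrite sd.
apply: (@congr_trans _ _ _ (wconj [:: ((i, k), true)] U)); last first.
  by apply: congr_conj; [apply/IH/ltnW | apply: congr_refl].
have := congr_cat (congr_refl d q [:: ((i, k.+1), true)]) (congr_relator q rel).
rewrite cats0 catA => H; apply: congr_trans (congr_sym H) _.
rewrite -[X in congr_q _ _ _ X]cat0s; apply: congr_cat; last exact: congr_refl.
exact: congr_free.
Qed.

Lemma word_rep_of_gen q :
  (forall g, in_range g -> exists lam,
     all (fun x => x.1 < m) lam /\ congr_q d q [:: (g, true)] (emb lam)) ->
  forall w, all (fun x => in_range x.1) w -> exists lam,
     all (fun x => x.1 < m) lam /\ congr_q d q w (emb lam).
Proof.
move=> gr; elim=> [_|[h e] w IHw] /=; first by exists [::]; split=> //; apply: congr_refl.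
case/andP=> hr /IHw[lw [aw cw]]; have [lh [ah ch]] := gr h hr.
exists (gpow lh e ++ lw); split.
  rewrite all_cat aw andbT; case: e => //=.
  by rewrite all_rev all_map; apply: sub_all ah.
rewrite -cat1s /emb map_cat; apply: congr_cat => //; case: e => //=.
have := congr_inv ch; rewrite /= => /congr_trans; apply.
by rewrite /emb /ginv map_rev -!map_comp; apply: congr_refl.
Qed.

(** Milnor's induction: an arc is a conjugate of the first arc of its strand, and a conjugator
    rewritten in the [alpha_j] at level q yields the arc at level q + 1. *)
Lemma gen_rep q g : 0 < q -> in_range g -> exists lam,
  all (fun x => x.1 < m) lam /\ congr_q d q [:: (g, true)] (emb lam).
Proof.
elim: q g => [//|q IH] g _ gr.
(* At level 1 every word is a commutator of weight 1, so the empty word represents the arc. *)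
have [q0|q0] := posnP q.
  exists [::]; split=> //; rewrite q0; apply: congr_comm; exact: comm1.
have W w : all (fun x => in_range x.1) w -> exists lam,
    all (fun x => x.1 < m) lam /\ congr_q d q w (emb lam).
  by apply: word_rep_of_gen => h hr; apply: IH.
case: g gr => i k /andP[/= im ks].
have [|lam [al cl]] := W (take k (u_word d i)).
  by apply/allP => x /mem_take; apply: (allP (u_word_range i)).
exists (wconj [:: (i, true)] lam); split.
  rewrite /wconj !all_cat al /= im /= andbT.
  by rewrite all_rev all_map; apply: sub_all al.
apply: congr_trans (arc_conj q.+1 im ks) _.
have := congr_conj_succ [:: ((i, 0), true)] cl; move/congr_trans; apply.
rewrite /wconj /emb !map_cat /ginv !map_rev -!map_comp; exact: congr_refl.
Qed.

Lemma word_rep q w : 0 < q -> all (fun x => in_range x.1) w -> exists lam,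
  all (fun x => x.1 < m) lam /\ congr_q d q w (emb lam).
Proof.
by move=> q0; apply: word_rep_of_gen => g; apply: gen_rep.
Qed.

Lemma mu_w_rcoef n q t (I : seq 'I_m) : I != [::] -> uniq I -> size I <= q ->
  coloring n q d t ->
  eqm n (mu_w d I) (rcoef (hword t (nth [::] d (mu_index I))) (mu_seq I)).
Proof.
move=> I0 uI Iq ct; apply: IsMuRep_rcoef ct _ => //.
apply: epsilon_spec.
have im : mu_index I < m.
  rewrite /mu_index; case/lastP: I I0 {uI Iq} => [//|J i] _.
  by rewrite map_rcons last_rcons; apply: ltn_ord.
have [|//|lam [al cl]] := @word_rep (size I) (longitude d (mu_index I)).
- by rewrite lt0n size_eq0.
- rewrite /longitude all_cat u_word_range andbT.
  by case: ifP => _; apply/allP => x; rewrite mem_nseq => /andP[_ /eqP ->];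
    rewrite /in_range /= im.
by exists (mcoef lam (mu_seq I)), (size I), lam; split.
Qed.

End MuExists.

(** * Invariance of the longitudes *)

(* Discarding X_i in the i-th longitude makes the normalizing power of a_{i1},
   and any self-crossing met by strand i, invisible. *)
Definition same_long n d d' := forall q t t', coloring n q d t -> coloring n q d' t' ->
  forall i, weq n q (predC1 i) (hword t (nth [::] d i)) (hword t' (nth [::] d' i)).

Section SameLong.
Variables (m n : nat).

Lemma same_long_sym d d' : same_long n d d' -> same_long n d' d.
Proof. by move=> H q t t' ct ct' i; apply/weq_sym/H. Qed.

Lemma same_long_trans d d' d'' : wf m d' ->
  same_long n d d' -> same_long n d' d'' -> same_long n d d''.
Proof.
move=> wd H1 H2 q t t'' ct ct'' i; have c0 := @coloring_of0 n _ _ _ (tcol_coloring q wd).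
by apply: weq_trans (H1 _ _ _ ct c0 i) (H2 _ _ _ c0 ct'' i).
Qed.

(** Colorings of d being unique, a single one with matching longitudes is enough. *)
Lemma same_long_transport d d' : wf m d ->
  (forall q t', coloring n q d' t' -> exists t, coloring n q d t /\
    forall i, weq n q (predC1 i) (hword t (nth [::] d i)) (hword t' (nth [::] d' i))) ->
  same_long n d d'.
Proof.
move=> wd H q t t' ct ct' i; have [t1 [c1 H1]] := H q t' ct'.
apply: weq_trans (H1 i); apply: weq_hword => l li _.
apply: (@weq_sub n q _ predT) => //.
exact: (coloring_unique wd ct c1 (mem_flatten_nth li)).
Qed.

Lemma hword_filter t s (P : pred letter) : (forall l, l \in s -> ~~ lover l -> P l) ->
  hword t (filter P s) = hword t s.
Proof.
move=> H; rewrite /hword /hblocks -filter_predI; congr (flatten (map _ _)).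
by apply: eq_in_filter => l ls /=; case: (boolP (lover l)) => //= /H ->.
Qed.

Lemma col_filter q tc hc y s (P : pred letter) : (forall l, l \in s -> ~~ lover l -> P l) ->
  scol n q tc hc y s -> scol n q tc hc y (filter P s).
Proof.
elim: s y => //= l s IH y H.
have H' : forall x, x \in s -> ~~ lover x -> P x by move=> x xs; apply: H; rewrite inE xs orbT.
case ol: (lover l); last first.
  by move=> cs; rewrite H ?mem_head ?ol //= ol; apply: IH.
by case=> wl cs; case: ifP => _ /=; rewrite ?ol; do ?split=> //; apply: IH.
Qed.

(** Common shape of R2, V^n and sv: the heads of the deleted crossings form a block w. It has to fix
    the value of the arc it ends and to vanish without X_i; both are asked because for a
    self-crossing w itself need not be trivial. *)
Lemma same_long_del d C i u w v : wf m d -> nth [::] d i = u ++ w ++ v ->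
  all (fun l => ~~ lover l && (lid l \in C)) w ->
  (forall c, c \in C -> exists2 x, x \in w & lid x = c) ->
  (forall q t, coloring n q d t ->
     weq n q predT (wconj (wconj [:: (i, true)] (hword t u)) (hword t w))
       (wconj [:: (i, true)] (hword t u)) /\
     weq n q (predC1 i) (hword t w) [::]) ->
  same_long n (del C d) d.
Proof.
move=> wd E aw Cw H; have /wfP[_ uk _ _] := wd.
have pos k y : y \in nth [::] d k -> ~~ lover y -> lid y \in C ->
    [/\ k = i, y \notin u & y \notin v].
  move=> yk oy /Cw[x xw xy]; have /andP[ox _] := allP aw _ xw.
  apply: key_block uk E xw yk _.
  by rewrite /key xy (negPf ox) (negPf oy).
have iu x : x \in u -> x \in nth [::] d i by rewrite E mem_cat => ->.
have iv x : x \in v -> x \in nth [::] d i by rewrite E !mem_cat => ->; rewrite !orbT.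
have keepu l : l \in u -> ~~ lover l -> lid l \notin C.
  by move=> lu ol; apply/negP => /(pos _ _ (iu _ lu) ol)[_]; rewrite lu.
have keepv l : l \in v -> ~~ lover l -> lid l \notin C.
  by move=> lv ol; apply/negP => /(pos _ _ (iv _ lv) ol)[_ _]; rewrite lv.
have keepk k : k <> i -> forall l, l \in nth [::] d k -> ~~ lover l -> lid l \notin C.
  by move=> ki l lk ol; apply/negP => /(pos _ _ lk ol)[].
have fw : filter (fun l => lid l \notin C) w = [::].
  apply/eqP; rewrite -[_ == _]negbK -has_filter; apply/hasPn => l /(allP aw).
  by rewrite negbK => /andP[].
apply: same_long_transport; first exact: wf_del.
move=> q t ct; have [h1 h2] := H q t ct.
exists t; split=> k.
  rewrite size_map => kd; rewrite nth_del; have := ct k kd.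
  have [->|/eqP ki] := eqVneq k i; last exact/col_filter/keepk.
  rewrite E !filter_cat fw /= => /col_cat[cu /col_cat[_ cv]].
  apply/col_cat; split; first exact: col_filter.
  rewrite hword_filter //; apply: col_filter => //.
  by apply: col_weq cv => [//||] *; apply: weq_refl.
rewrite nth_del; have [->|/eqP ki] := eqVneq k i; last first.
  by rewrite hword_filter; [apply: weq_refl | apply: keepk].
rewrite E !filter_cat fw /= !hword_cat !hword_filter //.
apply: weq_cat; first exact: weq_refl.
rewrite -[X in weq _ _ _ X _]cat0s; apply: weq_cat; last exact: weq_refl.
exact: weq_sym.
Qed.

Lemma coloring_tails q d t j a w b : coloring n q d t ->
  nth [::] d j = a ++ w ++ b -> all lover w -> forall x, x \in w ->
  weq n q predT (t (lid x)) (wconj [:: (j, true)] (hword t a)).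
Proof.
move=> ct E aw x xw.
have jd : j < size d.
  by apply: (@nth_in_range _ d x); rewrite E !mem_cat xw orbT.
have := ct j jd; rewrite E => /col_cat[_ /col_cat[cw _]].
case/splitPr: xw aw cw => [p r] aw cw.
have ox : lover x by apply: (allP aw); rewrite mem_cat mem_head orbT.
have := col_tail cw ox; rewrite (_ : hword t p = [::]) ?conj0 //.
rewrite /hword /hblocks (_ : filter _ _ = [::]) //.
apply/eqP; rewrite -[_ == _]negbK -has_filter; apply/hasPn => l lp.
by rewrite negbK; apply: (allP aw); rewrite mem_cat lp.
Qed.

Lemma same_long_trivial d C i u w v : wf m d -> nth [::] d i = u ++ w ++ v ->
  all (fun l => ~~ lover l && (lid l \in C)) w ->
  (forall c, c \in C -> exists2 x, x \in w & lid x = c) ->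
  (forall q t, coloring n q d t -> weq n q predT (hword t w) [::]) ->
  same_long n (del C d) d.
Proof.
move=> wd E aw Cw H; apply: (same_long_del wd E aw Cw) => q t ct; split.
  rewrite -[X in weq _ _ _ _ X]conj0; apply: weq_conj; first exact: weq_refl.
  exact: H.
by apply: weq_sub (H q t ct).
Qed.

Lemma same_long_sv d d' : wf m d' -> sv_step d d' -> same_long n d d'.
Proof.
move=> wd [c [i [-> [_ c2]]]]; have /wfP[_ uk kk _] := wd.
have us := uniq_keys_strand i uk.
set s := nth [::] d' i in c2 us *.
have ex b : exists2 l, l \in s & lid l = c /\ lover l = b.
  have : (c, b) \in map key s.
    move: c2; rewrite count_lid !count_uniq_mem //.
    by case: b; case: (_ \in _); case: (_ \in _).
  by case/mapP=> l ls [-> ->]; exists l.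
have [h hs [hc ho]] := ex false; have [l ls [lc lo]] := ex true.
case/splitPr Eh : _ / hs => [u v].
apply: (@same_long_del d' [:: c] i u [:: h] v) => //.
- by rewrite /= ho hc inE eqxx.
- by move=> c'; rewrite inE => /eqP ->; exists h; rewrite ?mem_head.
move=> q t ct.
case/splitPr El : _ / ls => [p r].
have id : i < size d' by apply: (@nth_in_range _ d' h); rewrite -/s Eh mem_cat mem_head orbT.
have := ct i id; rewrite -/s El => /col_tail/(_ lo); rewrite lc => tc.
have -> : hword t [:: h] = gpow (t c) (lsgn h).
  by rewrite /hword /hblocks /= ho /= cats0 hc.
have tc' D : weq n q D (gpow (t c) (lsgn h)) (wconj [:: (i, lsgn h)] (hword t p)).
  apply: (@weq_sub n q _ predT) => //; apply: weq_trans (weq_gpow _ tc) _.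
  rewrite gpow_conj (_ : gpow _ _ = [:: (i, lsgn h)]); first exact: weq_refl.
  by case: (lsgn h).
split.
  set y := wconj [:: (i, true)] _; set g := gpow _ _.
  (* The tail lies on strand i too, so the head acts by a conjugate of the letter i or its inverse,
     which commutes with the arc value y, itself a conjugate of that letter. *)
  have e1 : weq n q predT (y ++ g) (g ++ y).
    apply: weq_trans (weq_cat (weq_refl _ _ _ y) (tc' predT)) _.
    have cc := @weq_conj_comm n q predT (i, true) (i, lsgn h) (hword t u) (hword t p) erefl.
    apply: weq_trans cc _.
    by apply: weq_cat; [apply/weq_sym/tc' | apply: weq_refl].
  rewrite /wconj; apply: weq_trans (weq_cat (weq_refl _ _ _ (ginv g)) e1) _.
  rewrite catA -[X in weq _ _ _ _ X]cat0s; apply: weq_cat; last exact: weq_refl.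
  exact: weq_mulVw.
by apply: weq_trans (tc' _) _; apply: weq_conj_letter; rewrite /= eqxx.
Qed.

Lemma same_long_R2 d d' : wf m d' -> R2_step d d' -> same_long n d d'.
Proof.
move=> wd [c [c' [e [-> [tb hb]]]]].
have [j [a [b [wo [Ej ao mo]]]]] : exists j a b wo, [/\ nth [::] d' j = a ++ wo ++ b,
    all lover wo & (Tl c e \in wo) && (Tl c' (~~ e) \in wo)].
  case: tb => [[j [a [b E]]]|[j [a [b E]]]].
    by exists j, a, b, [:: Tl c e; Tl c' (~~ e)]; rewrite E !inE !eqxx !orbT.
  by exists j, a, b, [:: Tl c' (~~ e); Tl c e]; rewrite E !inE !eqxx !orbT.
have {mo} [mc mc'] := andP mo.
have col2 q t : coloring n q d' t ->
    weq n q predT (t c) (wconj [:: (j, true)] (hword t a)) /\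
    weq n q predT (t c') (wconj [:: (j, true)] (hword t a)).
  by move=> ct; split; have := coloring_tails ct Ej ao; [move/(_ _ mc)|move/(_ _ mc')].
case: hb => [[i [u [v E]]]|[i [u [v E]]]]; apply: (same_long_trivial wd E).
- by rewrite /= !inE !eqxx ?orbT.
- move=> x; rewrite !inE => /orP[/eqP ->|/eqP ->]; [exists (Hl c e) => //|exists (Hl c' (~~ e)) => //];
  by rewrite !inE eqxx ?orbT.
- move=> q t /col2[tc tc']; rewrite /hword /hblocks /= cats0 /lid /lsgn /=.
  apply: weq_trans (weq_cat (weq_gpow e tc) (weq_gpow (~~ e) tc')) _.
  by rewrite -ginv_gpow; apply: weq_mulV.
- by rewrite /= !inE !eqxx ?orbT.
- move=> x; rewrite !inE => /orP[/eqP ->|/eqP ->]; [exists (Hl c e) => //|exists (Hl c' (~~ e)) => //];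
  by rewrite !inE eqxx ?orbT.
- move=> q t /col2[tc tc']; rewrite /hword /hblocks /= cats0 /lid /lsgn /=.
  apply: weq_trans (weq_cat (weq_gpow (~~ e) tc') (weq_gpow e tc)) _.
  by rewrite -ginv_gpow; apply: weq_mulVw.
Qed.

Lemma weq_power_conj q D k x h :
  weq n q D (flatten (nseq k (wconj [:: x] h))) (wconj (nseq k x) h).
Proof.
elim: k => [|k IH] /=; first exact/weq_sym/weq_mulVw.
apply: weq_trans (weq_cat (weq_refl _ _ _ _) IH) _.
rewrite /wconj -!catA; apply: weq_cat; first exact: weq_refl.
rewrite -[X in weq _ _ _ _ X]/([:: x] ++ (nseq k x ++ h)).
apply: weq_cat; first exact: weq_refl.
rewrite catA -[X in weq _ _ _ _ X]cat0s; apply: weq_cat; last exact: weq_refl.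
exact: weq_mulV.
Qed.

(** Pigeonhole: endpoints of one level have distinct ids, and [size C] of them lying in C exhaust
    C. *)
Lemma ids_of_block m' (d : gdiag) C w b i u v : wf m' d -> uniq C ->
  nth [::] d i = u ++ w ++ v -> size w = size C ->
  all (fun l => (lover l == b) && (lid l \in C)) w ->
  forall c, c \in C -> exists2 x, x \in w & lid x = c.
Proof.
move=> /wfP[_ uk _ _] uC E sw aw c cC.
have uw : uniq (map lid w).
  have := uniq_keys_strand i uk; rewrite E !map_cat !cat_uniq => /and3P[_ _ /and3P[uw _ _]].
  have Ek : map key w = map (fun c => (c, b)) (map lid w).
    rewrite -map_comp; apply/eq_in_map => l /(allP aw)/andP[/eqP ob _].
    by rewrite /key ob.
  by move: uw; rewrite Ek => /map_uniq.
have sub : {subset map lid w <= C} by move=> x /mapP[l /(allP aw)/andP[_ lC] ->].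
have [|_ e] := uniq_min_size uw sub; first by rewrite size_map sw.
by move: cC; rewrite -e => /mapP[x xw ->]; exists x.
Qed.

Lemma same_long_Vn d d' : wf m d' -> Vn_step n d d' -> same_long n d d'.
Proof.
move=> wd [C [e [wo [wu [uC [sC [-> [so [su [ao [au [[j [a [b Ej]]] [i [u [v Ei]]]]]]]]]]]]]]].
have Co := @ids_of_block _ _ C wo true _ _ _ wd uC Ej.
have Cu := @ids_of_block _ _ C wu false _ _ _ wd uC Ei.
apply: (same_long_trivial wd Ei).
- by apply: sub_all au => l /andP[].
- apply: Cu; first by rewrite su sC.
  by apply: sub_all au => l /andP[/andP[/negPf -> ->]].
move=> q t ct; set z := wconj [:: (j, true)] (hword t a).
have tz c : c \in C -> weq n q predT (t c) z.
  move=> cC; have [||x xw <-] := Co _ _ c cC; first by rewrite so sC.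
    by apply: sub_all ao => l /andP[/andP[-> ->]].
  apply: (coloring_tails ct Ej _ xw).
  by apply: sub_all ao => l /andP[/andP[]].
have E : weq n q predT (hword t wu) (flatten (nseq n (gpow z e))).
  rewrite /hword /hblocks (all_filterP _); last by apply: sub_all au => l /andP[/andP[]].
  rewrite -[in nseq _ _]su; elim: wu au {su Ei Cu} => [_|l w IH] /=; first exact: weq_refl.
  case/andP=> /andP[/andP[_ lC] /eqP le] aw; apply: weq_cat; last exact: IH.
  by rewrite le; apply/weq_gpow/tz.
apply: weq_trans E _; rewrite /z gpow_conj.
have -> : gpow [:: (j, true)] e = [:: (j, e)] by case: (e).
apply: weq_trans (@weq_power_conj _ _ _ _ _) _.
exact/weq_conj_nil/weq_nseq.
Qed.

Lemma same_long_relabel f d : wf m d -> same_long n d (relabel f d).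
Proof.
move=> wd; apply: same_long_transport => // q t ct.
have E k : nth [::] (relabel f d) k =
   map (fun l : letter => (f (lid l), lover l, lsgn l)) (nth [::] d k).
  exact: nth_map_map.
have hE s : hword (t \o f) s = hword t (map (fun l : letter => (f (lid l), lover l, lsgn l)) s).
  by rewrite /hword /hblocks filter_map -map_comp.
exists (t \o f); split=> k; last by rewrite E hE; apply: weq_refl.
move=> kd; have := ct k; rewrite size_map => /(_ kd); rewrite E.
elim: (nth _ _ _) [:: (k, true)] => //= l s IH y.
by rewrite {1}/lover /=; case: ifP => _; [case=> H /IH | move/IH].
Qed.

Lemma same_long_OC d d' : wf m d -> wf m d' -> OC_step d d' -> same_long n d d'.
Proof.
move=> wd wd' [i [p [x [y [ox [oy [ap Ed]]]]]]].
have [u [v [E sz Ei Ek]]] := swap_atE ap; rewrite -Ed in sz Ei Ek.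
apply: same_long_sym; apply: same_long_transport => // q t ct; exists t.
have hE k : hword t (nth [::] d' k) = hword t (nth [::] d k).
  have [->|ki] := eqVneq k i; last by rewrite Ek.
  by rewrite Ei E !hword_cat; congr (_ ++ (_ ++ _)); rewrite /hword /hblocks /= ox oy.
split=> k; last by rewrite hE; apply: weq_refl.
rewrite sz => kd; have := ct k kd.
have [->|ki] := eqVneq k i; last by rewrite Ek.
rewrite E Ei => /col_cat[cu cv]; apply/col_cat; split=> //.
by move: cv => /=; rewrite ox oy => -[? [? ?]].
Qed.

Lemma same_long_self d i x y : wf m d -> x \in nth [::] d i -> y \in nth [::] d i ->
  lid x = lid y -> lover x -> ~~ lover y -> same_long n (del [:: lid x] d) d.
Proof.
by move=> wd xi yi xy ox oy; apply: same_long_sv => //; apply: self_sv wd xi yi xy ox oy.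
Qed.

Lemma same_long_self2 d i a b ea ea' eb eb' : wf m d -> a != b ->
  Tl a ea \in nth [::] d i -> Hl a ea' \in nth [::] d i ->
  Tl b eb \in nth [::] d i -> Hl b eb' \in nth [::] d i ->
  same_long n (del [:: b] (del [:: a] d)) d.
Proof.
move=> wd ab Ta Ha Tb Hb; have wd1 : wf m (del [:: a] d) by apply: wf_del.
apply: (@same_long_trans _ (del [:: a] d)) => //.
  apply: (@same_long_self _ i (Tl b eb) (Hl b eb')) => //.
    by rewrite nth_del mem_filter inE eq_sym ab.
  by rewrite nth_del mem_filter inE eq_sym ab.
exact: (@same_long_self _ i (Tl a ea) (Hl a ea')).
Qed.

(** Only the over-arc of c changes: its tail moves in front of the head of a, and its value goes
    from Y^g to Y. On the bottom strand a and b share an over-arc, and the sign conditions turn the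
    claim into g Y^g = Y g or Y^g g^-1 = g^-1 Y, with Y raised to the sign of c. *)
Lemma same_long_R3 d d' : wf m d -> wf m d' -> R3_step d d' -> same_long n d d'.
Proof.
move=> wd wd' [a [b [c [ea [eb [ec [i1 [p1 [i2 [p2 [tb [ap1 [hb Ed]]]]]]]]]]]]].
have /wfP[_ uk _ _] := wd; have ud := uniq_keys_flatten uk.
have [j [r1 [r2 [wo [Ej ao mo]]]]] : exists j r1 r2 wo, [/\ nth [::] d j = r1 ++ wo ++ r2,
    all lover wo & [/\ Tl a ea \in wo, Tl b eb \in wo & uniq wo -> a != b]].
  have K s : uniq (map key (nth [::] d s)) by apply: uniq_keys_strand.
  case: tb => [[j [r1 [r2 E]]]|[j [r1 [r2 E]]]]; exists j, r1, r2.
    exists [:: Tl a ea; Tl b eb]; rewrite E !inE !eqxx !orbT; split=> //; split=> // _.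
    have := K j; rewrite E !map_cat !cat_uniq => /and3P[_ _ /and3P[+ _ _]].
    by rewrite /= andbT mem_seq1 /key xpair_eqE andbT.
  exists [:: Tl b eb; Tl a ea]; rewrite E !inE !eqxx !orbT; split=> //; split=> // _.
  have := K j; rewrite E !map_cat !cat_uniq => /and3P[_ _ /and3P[+ _ _]].
  by rewrite /= andbT mem_seq1 /key xpair_eqE andbT eq_sym.
have [Ta Tb ab] := mo.
have {ab} ab : a != b.
  apply: ab; have := uniq_keys_strand j uk.
  by rewrite Ej !map_cat !cat_uniq => /and3P[_ _ /and3P[/map_uniq + _ _]].
have inj1 x : x \in wo -> x \in nth [::] d j by move=> xw; rewrite Ej !mem_cat xw orbT.
have [u1 [v1 [E1 sz1 E1' Ek1]]] := swap_atE ap1.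
set d1 := swap_at d i1 p1 in Ed sz1 E1' Ek1 *.
have d1E : d1 = map (map (exch (Hl a ea) (Tl c ec))) d by apply: swap_at_exch.
have wd1 : wf m d1 := wf_swap_at ap1 wd.
have /wfP[_ uk1 _ _] := wd1; have ud1 := uniq_keys_flatten uk1.
have [ac|ac] := eqVneq a c.
  (* A degenerate triangle only involves self-crossings. *)
  subst c.
  have Ha1 : Hl a ea \in nth [::] d i1 by rewrite E1 mem_cat mem_head orbT.
  have Ta1 : Tl a ec \in nth [::] d i1 by rewrite E1 mem_cat !inE eqxx !orbT.
  have ji : j = i1 by apply: (key_strand uk (inj1 _ Ta) Ta1).
  have [Hb2 Ha2] : Hl b eb \in nth [::] d i2 /\ Hl a ec \in nth [::] d i2.
    by case: hb => [] [[u [v [-> _]]] _]; rewrite !mem_cat !inE !eqxx !orbT.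
  have i21 : i2 = i1 by apply: (key_strand uk Ha2 Ha1).
  subst j i2.
  have s1 : same_long n (del [:: b] (del [:: a] d)) d.
    by apply: (same_long_self2 wd ab Ta1 Ha1 (inj1 _ Tb) Hb2).
  (* The first transposition may have moved a letter of the second pair, so that pair is known only
     up to the exchange. *)
  have [x [y [xy xa ya]]] : exists x y,
      [/\ at_pair d1 i1 p2 x y, lid x \in [:: a; b] & lid y \in [:: a; b]].
    case: hb => [] [[u [v [E su]]] _]; rewrite d1E.
      exists (exch (Hl a ea) (Tl a ec) (Hl b eb)), (exch (Hl a ea) (Tl a ec) (Hl a ec)).
      split; last 2 first.
      - by rewrite /exch; do 2?case: ifP => _; rewrite !inE eqxx ?orbT.
      - by rewrite /exch; do 2?case: ifP => _; rewrite !inE eqxx ?orbT.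
      exists (map (exch (Hl a ea) (Tl a ec)) u), (map (exch (Hl a ea) (Tl a ec)) v).
      by rewrite nth_map_map E map_cat size_map.
    exists (exch (Hl a ea) (Tl a ec) (Hl a ec)), (exch (Hl a ea) (Tl a ec) (Hl b eb)).
    split; last 2 first.
    - by rewrite /exch; do 2?case: ifP => _; rewrite !inE eqxx ?orbT.
    - by rewrite /exch; do 2?case: ifP => _; rewrite !inE eqxx ?orbT.
    exists (map (exch (Hl a ea) (Tl a ec)) u), (map (exch (Hl a ea) (Tl a ec)) v).
    by rewrite nth_map_map E map_cat size_map.
  have P k : perm_eq (nth [::] d' k) (nth [::] d k).
    by rewrite Ed; apply: perm_trans (perm_swap_at xy k) (perm_swap_at ap1 k).
  have s2 : same_long n (del [:: b] (del [:: a] d')) d'.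
    by apply: (same_long_self2 wd' ab (i := i1)); rewrite (perm_mem (P i1));
      [exact: Ta1 | exact: Ha1 | exact: inj1 Tb | exact: Hb2].
  have dd g : del [:: b] (del [:: a] g) = del [:: a; b] g.
    rewrite /del -map_comp; apply: eq_map => s /=; rewrite -filter_predI.
    by apply: eq_filter => l /=; rewrite !inE negb_or andbC.
  have Edel : del [:: a; b] d' = del [:: a; b] d.
    rewrite Ed (swap_at_exch ud1 xy) del_exch // d1E del_exch //; rewrite inE eqxx //.
  rewrite !dd Edel in s1 s2.
  by apply: same_long_trans (same_long_sym s1) s2; apply: wf_del.
have bc : b != c.
  have K := uniq_keys_strand i2 uk.
  by case: hb => [] [[u [v [E _]]] _]; move: K;
    rewrite E !map_cat !cat_uniq => /and3P[_ _ /and3P[+ _ _]];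
    rewrite /= andbT mem_seq1 /key xpair_eqE andbT // eq_sym.
have [x [y [hxy ap2]]] : exists x y,
   ((x = Hl b eb /\ y = Hl c ec /\ ea = eb) \/ (x = Hl c ec /\ y = Hl b eb /\ ea = ~~ eb))
   /\ at_pair d1 i2 p2 x y.
  have nb : Hl b eb <> Hl a ea by case=> ba; rewrite ba eqxx in ab.
  have nc : Hl c ec <> Hl a ea by case=> ca; rewrite ca eqxx in ac.
  case: hb => [[ap2 e]|[ap2 e]]; [exists (Hl b eb), (Hl c ec)|exists (Hl c ec), (Hl b eb)];
    (split; first by [left|right]); rewrite d1E; exact: at_pair_exch.
have [u2 [v2 [E2 sz2 E2' Ek2]]] := swap_atE ap2; rewrite -Ed in sz2 E2' Ek2.
apply: same_long_sym; apply: same_long_transport => // q t ct.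
set Y := wconj [:: (i1, true)] (hword t u1).
set g := gpow (t a) ea.
set t' := fun k => if k == c then Y else t k.
have i1d : i1 < size d by apply: (@nth_in_range _ d (Hl a ea)); rewrite E1 mem_cat mem_head orbT.
have i2d : i2 < size d1 by apply: (@nth_in_range _ d1 x); rewrite E2 mem_cat mem_head orbT.
have tab : weq n q predT (t a) (t b).
  exact: weq_trans (coloring_tails ct Ej ao Ta) (weq_sym (coloring_tails ct Ej ao Tb)).
have tcY : weq n q predT (t c) (wconj Y g).
  by have := ct i1 i1d; rewrite E1 => /col_cat[_ /=]; rewrite /lover /= => -[].
have t'c : t' c = Y by rewrite /t' eqxx.
have t'n k : k != c -> t' k = t k by rewrite /t' => /negPf ->.
have notc k l : l \in nth [::] d k -> lover l -> (k != i1) || ((l \in u1) || (l \in v1)) -> lid l != c.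
  move=> lk ol side; apply/eqP => lc.
  have [] := @key_block d i1 u1 [:: Hl a ea; Tl c ec] v1 (Tl c ec) l k uk E1 _ lk.
  - by rewrite !inE eqxx orbT.
  - by rewrite /key ol -lc.
  by move=> ki /negPf lu /negPf lv; move: side; rewrite ki eqxx lu lv.
(* Halfway only the tail of c has moved: tails are read with the new values, heads still with the
   old ones. *)
have step1 k : k < size d -> scol n q t' t [:: (k, true)] (nth [::] d1 k).
  move=> kd; have := ct k kd; have [->|ki] := eqVneq k i1; last first.
    rewrite Ek1 //; apply: col_weq => [|l lk ol|l _ _]; try exact: weq_refl.
    by rewrite t'n; [apply: weq_refl | apply: (notc k) => //; rewrite ki].
  rewrite E1 E1' => /col_cat[cu /col_cat[_ cv]].
  apply/col_cat; split; last (apply/col_cat; split; first by split; [rewrite t'c; apply: weq_refl|]).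
    apply: col_weq cu => [|l lk ol|l _ _]; try exact: weq_refl.
    rewrite t'n; first exact: weq_refl.
    by apply: (notc i1); rewrite ?E1 ?mem_cat ?lk ?orbT.
  apply: col_weq cv => [|l lk ol|l _ _]; try exact: weq_refl.
  rewrite t'n; first exact: weq_refl.
  by apply: (notc i1); rewrite ?E1 ?mem_cat ?lk ?orbT.
have h1 k : hword t (nth [::] d1 k) = hword t (nth [::] d k).
  by have [->|ki] := eqVneq k i1; [rewrite E1 E1' !hword_cat | rewrite Ek1].
have xyc : (Hl c ec \in [:: x; y]).
  by case: hxy => [[-> [-> _]]|[-> [-> _]]]; rewrite !inE eqxx ?orbT.
have noth k l : l \in nth [::] d1 k -> ~~ lover l -> (k != i2) || ((l \in u2) || (l \in v2)) -> lid l != c.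
  move=> lk ol side; apply/eqP => lc.
  have [] := @key_block d1 i2 u2 [:: x; y] v2 (Hl c ec) l k uk1 E2 xyc lk.
  - by rewrite /key (negPf ol) -lc.
  by move=> ki /negPf lu /negPf lv; move: side; rewrite ki eqxx lu lv.
have mid : weq n q predT (hword t' [:: y; x]) (hword t [:: x; y]).
  have gb : weq n q predT (gpow (t b) eb) (gpow (t a) eb) by apply/weq_gpow/weq_sym.
  have gc : weq n q predT (gpow (t c) ec) (wconj (gpow Y ec) g).
    by rewrite -gpow_conj; apply: weq_gpow.
  case: hxy => [[-> [-> eab]]|[-> [-> eab]]];
    rewrite /hword /hblocks /= !cats0 /lid /lsgn /= t'c (t'n b) //.
    apply: weq_trans (weq_sym (weq_cat gb gc)).
    apply: weq_trans (weq_cat (weq_refl _ _ _ _) gb) _.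
    rewrite -eab -/g /wconj catA -[X in weq _ _ _ X _]cat0s.
    by apply: weq_cat; [apply/weq_sym/weq_mulV | apply: weq_refl].
  apply: weq_trans (weq_sym (weq_cat gc gb)).
  apply: weq_trans (weq_cat gb (weq_refl _ _ _ _)) _.
  have -> : gpow (t a) eb = ginv g by rewrite /g eab ginv_gpow negbK.
  rewrite /wconj -!catA; apply: weq_cat; first exact: weq_refl.
  rewrite -[X in weq _ _ _ X _]cats0; apply: weq_cat; first exact: weq_refl.
  exact/weq_sym/weq_mulV.
have hu2 : forall s, (forall l, l \in s -> ~~ lover l -> lid l != c) ->
   weq n q predT (hword t' s) (hword t s).
  by move=> s H; apply: weq_hword => l ls ol; rewrite t'n ?H //; apply: weq_refl.
have nu l : l \in u2 -> ~~ lover l -> lid l != c.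
  by move=> lu ol; apply: (noth i2); rewrite ?E2 ?mem_cat ?lu ?orbT.
have nv l : l \in v2 -> ~~ lover l -> lid l != c.
  by move=> lu ol; apply: (noth i2); rewrite ?E2 ?mem_cat ?lu ?orbT.
exists t'; split=> k.
  rewrite sz2 sz1 => kd; have := step1 k kd; have [->|ki] := eqVneq k i2; last first.
    rewrite Ek2 //; apply: col_weq => [|l _ _|l lk ol]; try exact: weq_refl.
    by rewrite t'n; [apply: weq_refl | apply: (noth k) => //; rewrite ki].
  rewrite E2 E2' => /col_cat[cu /col_cat[_ cv]].
  have Hx : lover x = false by case: hxy => [[-> _]|[-> _]].
  have Hy : lover y = false by case: hxy => [[_ [-> _]]|[_ [-> _]]].
  apply/col_cat; split; last (apply/col_cat; split; first by rewrite /= Hx Hy).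
    apply: col_weq cu => [|l _ _|l lk ol]; try exact: weq_refl.
    by rewrite t'n ?nu //; apply: weq_refl.
  apply: col_weq cv => [|l _ _|l lk ol]; try exact: weq_refl.
    apply: weq_conj; last exact: weq_sym.
    by apply: weq_conj; [apply: weq_refl | apply/weq_sym/hu2].
  by rewrite t'n ?nv //; apply: weq_refl.
rewrite -h1; apply: (@weq_sub n q _ predT) => //.
have [->|ki] := eqVneq k i2; last first.
  by rewrite Ek2 //; apply: hu2 => l lk ol; apply: (noth k) => //; rewrite ki.
rewrite E2 E2' !hword_cat; apply: weq_cat; first exact: hu2.
by apply: weq_cat => //; apply: hu2.
Qed.

Lemma same_long_step d d' : Vn_sv_step m n d d' -> same_long n d d'.
Proof.
case=> wd [wd' [st|[st|[st|[st|[[f [_ ->]]|[st|st]]]]]]].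
- exact/same_long_sv/(R1_sv wd').
- exact: same_long_R2.
- exact: same_long_R3.
- exact: same_long_OC.
- exact: same_long_relabel.
- exact: same_long_Vn.
- exact: same_long_sv.
Qed.

(** The reflexive closure also relates an ill-formed list to itself, whence the first
    alternative. *)
Lemma same_long_equiv d d' : Vn_sv_equiv m n d d' ->
  d = d' \/ [/\ wf m d, wf m d' & same_long n d d'].
Proof.
elim=> {d d'} [d d' st|d|d d' _ IH|d d' d'' _ IH1 _ IH2].
- by right; split; [case: st | case: st => _ [] | apply: same_long_step].
- by left.
- by case: IH => [->|[? ? /same_long_sym ?]]; [left | right].
case: IH1 => [->//|[w1 w2 s1]]; case: IH2 => [<-|[w3 w4 s2]]; right; split=> //.
exact: same_long_trans s1 s2.
Qed.

Theorem mu_invariant d d' : wf m d -> Vn_sv_equiv m n d d' ->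
  forall I : seq 'I_m, I != [::] -> uniq I -> eqm n (mu_w d I) (mu_w d' I).
Proof.
move=> wd /same_long_equiv[->|[_ wd' sl]] I I0 uI; first exact: eqm_refl.
have c := @coloring_of0 n _ _ _ (tcol_coloring (size I) wd).
have c' := @coloring_of0 n _ _ _ (tcol_coloring (size I) wd').
have [uM sM aM] := mu_seqP I0 uI.
apply: eqm_trans (mu_w_rcoef wd I0 uI (leqnn _) c) _.
apply: eqm_trans (eqm_sym (mu_w_rcoef wd' I0 uI (leqnn _) c')).
exact: (sl _ _ _ c c' (mu_index I) _ uM sM aM).
Qed.

End SameLong.

(** * Tails-first diagrams *)

Definition upd (d : gdiag) i s : gdiag := set_nth [::] d i s.

Lemma nth_upd d i s k : nth [::] (upd d i s) k = if k == i then s else nth [::] d k.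
Proof. exact: nth_set_nth. Qed.

Lemma size_upd d i s : i < size d -> size (upd d i s) = size d.
Proof. by move=> id; rewrite size_set_nth; apply/maxn_idPr. Qed.

Lemma gdiag_ext (d d' : gdiag) : size d = size d' ->
  (forall k, nth [::] d k = nth [::] d' k) -> d = d'.
Proof. by move=> sz H; apply: (@eq_from_nth _ [::]) => // k _. Qed.

Lemma perm_upd d i s w : i < size d -> perm_eq s (w ++ nth [::] d i) ->
  perm_eq (flatten (upd d i s)) (w ++ flatten d).
Proof.
elim: d i => [//|s0 d IH] [|i] /= id ps.
  by rewrite catA perm_cat2r.
by rewrite perm_sym perm_catCA perm_cat2l perm_sym; apply: IH.
Qed.

Definition Tls (A : seq (nat * bool)) := [seq Tl c.1 c.2 | c <- A].
Definition Hls (A : seq (nat * bool)) := [seq Hl c.1 c.2 | c <- A].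

Definition fresh_for (d : gdiag) (c : nat) := forall l, l \in flatten d -> lid l <> c.

Lemma wf_add m (d d' : gdiag) A : wf m d -> size d' = size d -> uniq (unzip1 A) ->
  (forall c, c \in unzip1 A -> fresh_for d c) ->
  perm_eq (flatten d') (Tls A ++ Hls A ++ flatten d) -> wf m d'.
Proof.
move=> /wfP[sd uk kk sgn] sz uA frA pe.
have kT : map key (Tls A) = [seq (c, true) | c <- unzip1 A] by rewrite -!map_comp.
have kH : map key (Hls A) = [seq (c, false) | c <- unzip1 A] by rewrite -!map_comp.
have pk : perm_eq (keys d') (map key (Tls A) ++ map key (Hls A) ++ keys d).
  by rewrite -!map_cat; apply: perm_map.
rewrite kT kH in pk.
have inj (b : bool) : injective (fun c : nat => (c, b)) by move=> x y [].
have memA (b : bool) c : ((c, b) \in [seq (x, b) | x <- unzip1 A]) = (c \in unzip1 A).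
  by rewrite (mem_map (inj b)).
have nmem (b b' : bool) c : b != b' -> (c, b) \notin [seq (x, b') | x <- unzip1 A].
  by move=> bb; apply/mapP => -[x _ [_ E]]; rewrite E eqxx in bb.
have frk c (b : bool) : c \in unzip1 A -> (c, b) \notin keys d.
  by move=> /frA fr; apply/negP => /mapP[l ld [/esym lc _]]; apply: (fr l).
apply/wfP; split.
- by rewrite sz.
- rewrite (perm_uniq pk) !cat_uniq !(map_inj_uniq (inj _)) uA uk /= andbT !has_cat negb_or.
  apply/andP; split; last first.
    by apply/hasPn => -[c b] ck; apply/mapP => -[x xA [E1 E2]]; subst; have := frk x false xA; rewrite ck.
  apply/andP; split; apply/hasPn => -[c b].
    by case/mapP=> x _ [_ ->]; apply: nmem.
  by move=> ck; apply/mapP => -[x xA [E1 E2]]; subst; have := frk x true xA; rewrite ck.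
- move=> c; rewrite !(perm_mem pk) !mem_cat !memA kk.
  by rewrite (negPf (nmem true false c _)) // (negPf (nmem false true c _)).
move=> x y; rewrite !(perm_mem pe) !mem_cat.
have look z : (z \in Tls A) || (z \in Hls A) -> (lid z, lsgn z) \in A.
  by case/orP=> /mapP[[c e] cA ->].
have lookA a b b' : (a, b) \in A -> (a, b') \in A -> b = b'.
  elim: A uA {pe frA kT kH pk memA nmem frk look} => //= -[c e] A IH /andP[cA uA].
  rewrite !inE !xpair_eqE => /orP[/andP[/eqP E1 /eqP E2]|aA] /orP[/andP[/eqP E3 /eqP E4]|bA].
  - by rewrite E2 E4.
  - by case/negP: cA; rewrite -E1; apply: (map_f fst bA).
  - by case/negP: cA; rewrite -E3; apply: (map_f fst aA).
  - exact: IH.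
rewrite !orbA => /orP[xA|xd] /orP[yA|yd] xy; last exact: sgn.
- by have := look _ xA; have := look _ yA; rewrite xy => H1 H2; apply: lookA H2 H1.
- have /look xA' := xA; have := frA (lid x) (map_f fst xA') y yd.
  by rewrite xy.
- have /look yA' := yA; have := frA (lid y) (map_f fst yA') x xd.
  by rewrite xy.
Qed.

Definition fresh (d : gdiag) : nat := (\max_(l <- flatten d) lid l).+1.

Lemma freshP d k : fresh_for d (fresh d + k).
Proof.
move=> l ld; apply/eqP; rewrite neq_ltn /fresh addSn ltnS.
by rewrite (leq_trans (@leq_bigmax_seq _ _ xpredT lid l ld isT)) ?leq_addr.
Qed.

Section Equivalence.
Variables (m n : nat).
Local Notation "d ~~> d'" := (Vn_sv_equiv m n d d') (at level 70).

Lemma eqv_refl d : d ~~> d. Proof. exact: rst_refl. Qed.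
Lemma eqv_sym d d' : d ~~> d' -> d' ~~> d. Proof. exact: rst_sym. Qed.
Lemma eqv_trans d d' d'' : d ~~> d' -> d' ~~> d'' -> d ~~> d''. Proof. exact: rst_trans. Qed.

Lemma OC_bubble d k P T x S : wf m d -> nth [::] d k = P ++ T ++ x :: S ->
  all lover T -> lover x -> wf m (upd d k (P ++ x :: T ++ S)) /\ d ~~> upd d k (P ++ x :: T ++ S).
Proof.
elim/last_ind: T d S => [|T y IH] d S wd E aT ox.
  suff -> : upd d k (P ++ x :: [::] ++ S) = d by split=> //; apply: eqv_refl.
  have kd : k < size d by apply: (@nth_in_range _ d x); rewrite E !mem_cat mem_head !orbT.
  by apply: gdiag_ext => [|k']; rewrite ?size_upd // nth_upd; case: eqP => // ->.
move: aT; rewrite all_rcons => /andP[oy aT].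
have ap : at_pair d k (size (P ++ T)) y x.
  by exists (P ++ T), S; rewrite E -cats1 -!catA.
have [u [v [E1 sz E1' Ek]]] := swap_atE ap.
set d1 := swap_at d k _ in sz E1' Ek *.
have wd1 : wf m d1 by apply: wf_swap_at ap wd.
have st : d ~~> d1.
  apply: rst_step; split=> //; split=> //; right; right; right; left.
  by exists k, (size (P ++ T)), y, x.
have kd : k < size d by apply: (@nth_in_range _ d x); rewrite E !mem_cat mem_head !orbT.
have Ed1 : nth [::] d1 k = P ++ T ++ x :: y :: S.
  rewrite /d1 /swap_at nth_set_nth /= eqxx E -cats1 -!catA catA /=.
  rewrite take_size_cat // !nth_cat ltnn ltnNge leqnSn /= subnn subSnn /=.
  by rewrite -addn2 drop_cat ltnNge leq_addr /= addKn /= drop0 -catA.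
have [w2 e2] := IH d1 (y :: S) wd1 Ed1 aT ox.
have -> : upd d k (P ++ x :: rcons T y ++ S) = upd d1 k (P ++ x :: T ++ y :: S).
  apply: gdiag_ext => [|k']; first by rewrite !size_upd ?sz.
  by rewrite !nth_upd cat_rcons; case: eqP => // /eqP ki; rewrite Ek.
by split=> //; apply: eqv_trans st e2.
Qed.

Lemma OC_strand d k P T T' S : wf m d -> nth [::] d k = P ++ T ++ S -> k < size d ->
  all lover T -> perm_eq T T' ->
  wf m (upd d k (P ++ T' ++ S)) /\ d ~~> upd d k (P ++ T' ++ S).
Proof.
elim: T' d P T => [|x T' IH] d P T wd E kd aT pe.
  have := perm_size pe => /= /size0nil T0; rewrite T0 in E.
  suff -> : upd d k (P ++ [::] ++ S) = d by split=> //; apply: eqv_refl.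
  by apply: gdiag_ext => [|k']; rewrite ?size_upd // nth_upd; case: eqP => // ->.
have xT : x \in T by rewrite (perm_mem pe) mem_head.
case/splitPr: xT E aT pe => [T1 T2] E aT pe.
move: aT; rewrite all_cat /= => /and3P[aT1 ox aT2].
have E' : nth [::] d k = P ++ T1 ++ x :: (T2 ++ S) by rewrite E -!catA.
have [w1 e1] := OC_bubble wd E' aT1 ox.
set d1 := upd d k _ in w1 e1 *.
have E1 : nth [::] d1 k = rcons P x ++ (T1 ++ T2) ++ S.
  by rewrite nth_upd eqxx cat_rcons -catA.
have kd1 : k < size d1 by rewrite size_upd.
have pe' : perm_eq (T1 ++ T2) T'.
  by rewrite -(perm_cons x) -(permPr pe) perm_sym -cat1s perm_catCA.
have aT12 : all lover (T1 ++ T2) by rewrite all_cat aT1.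
have [w2 e2] := IH d1 (rcons P x) (T1 ++ T2) w1 E1 kd1 aT12 pe'.
have <- : upd d1 k (rcons P x ++ T' ++ S) = upd d k (P ++ (x :: T') ++ S).
  apply: gdiag_ext => [|k']; first by rewrite !size_upd.
  by rewrite !nth_upd cat_rcons; case: eqP => // /eqP ki; rewrite nth_upd (negPf ki).
by split=> //; apply: eqv_trans e1 e2.
Qed.

Lemma OC_perm d d' : wf m d -> size d = size d' ->
  (forall k, exists T T' H, [/\ nth [::] d k = T ++ H, nth [::] d' k = T' ++ H,
     all lover T & perm_eq T T']) -> d ~~> d'.
Proof.
move=> wd sz H.
suff K r : r <= size d -> exists d1, [/\ wf m d1, d ~~> d1, size d1 = size d &
    forall k, nth [::] d1 k = if k < r then nth [::] d' k else nth [::] d k].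
  have [d1 [_ e1 s1 n1]] := K _ (leqnn _).
  suff <- : d1 = d' by [].
  apply: gdiag_ext; first by rewrite s1.
  move=> k; rewrite n1; case: ltnP => // dk.
  by rewrite !nth_default // -sz.
elim: r => [|r IH] rd; first by exists d; split=> //; apply: eqv_refl.
have [d1 [w1 e1 s1 n1]] := IH (ltnW rd).
have [T [T' [S [E E' aT pe]]]] := H r.
have [||w2 e2] := @OC_strand d1 r [::] T T' S w1 _ _ aT pe; first by rewrite n1 ltnn.
  by rewrite s1.
exists (upd d1 r ([::] ++ T' ++ S)); split=> //.
- exact: eqv_trans e1 e2.
- by rewrite size_upd s1.
- move=> k; rewrite nth_upd ltnS leq_eqVlt; case: eqP => [->|_] //=.
Qed.

Definition tfirst (s : seq letter) := s == filter lover s ++ filter (predC lover) s.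

Lemma tfirst_cat T H : all lover T -> all (predC lover) H -> tfirst (T ++ H).
Proof.
move=> aT aH; rewrite /tfirst !filter_cat.
rewrite (all_filterP aT) (all_filterP aH).
have -> : filter lover H = [::].
  by apply/eqP; rewrite -[_ == _]negbK -has_filter -all_predC.
have -> : filter (predC lover) T = [::].
  apply/eqP; rewrite -[_ == _]negbK -has_filter; apply/hasPn => l /(allP aT) ol.
  by rewrite /= negbK.
by rewrite cats0.
Qed.

Lemma tfirstP s : tfirst s -> exists T H, [/\ s = T ++ H, all lover T & all (predC lover) H].
Proof.
move/eqP=> E; exists (filter lover s), (filter (predC lover) s).
by split=> //; apply: filter_all.
Qed.

Lemma tfirst_filter P s : tfirst s -> tfirst (filter P s).
Proof.
case/tfirstP=> T [H [-> aT aH]]; rewrite filter_cat.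
by apply: tfirst_cat; apply/allP => l; rewrite mem_filter => /andP[_]; [apply: (allP aT)|apply: (allP aH)].
Qed.

Lemma tfirstN s : ~~ tfirst s -> exists A h t B,
  [/\ s = A ++ [:: h; t] ++ B, ~~ lover h & lover t].
Proof.
elim: s => [//|x s IH] nt.
have [ts|/IH[A [h [t [B [-> ? ?]]]]]] := boolP (tfirst s); last first.
  by exists (x :: A), h, t, B.
case/tfirstP: ts nt => T [H [-> aT aH]].
case ox: (lover x) => nt.
  by case/negP: nt; apply: (@tfirst_cat (x :: T)) => //=; rewrite ox.
case: T aT nt => [_|t T /= /andP[ot aT] _].
  by case/negP; apply: (@tfirst_cat [::] (x :: H)) => //=; rewrite ox.
by exists [::], x, t, (T ++ H); rewrite ox.
Qed.

Lemma tfirst_prefix u l v : tfirst (u ++ l :: v) -> lover l -> all lover u.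
Proof.
case/tfirstP=> T [H [E aT aH]] ol.
have [uT|Tu] := ltnP (size u) (size T).
  have -> : u = take (size u) T by rewrite -[LHS](take_size_cat (l :: v) erefl) E takel_cat // ltnW.
  by apply/allP => x /mem_take; apply: (allP aT).
have El : nth l (u ++ l :: v) (size u) = l by rewrite nth_cat ltnn subnn.
have : l \in H.
  rewrite -[X in X \in _]El E nth_cat ltnNge Tu /= mem_nth //.
  by rewrite ltn_subLR // -size_cat -E size_cat /= addnS ltnS leq_addr.
by move/(allP aH); rewrite /= ol.
Qed.

Lemma hword_tails t s : all lover s -> hword t s = [::].
Proof.
move=> aT; rewrite /hword /hblocks (_ : filter _ _ = [::]) //.
apply/eqP; rewrite -[_ == _]negbK -has_filter; apply/hasPn => l /(allP aT) ol.
by rewrite negbK.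
Qed.

Definition asc d := wf m d /\ forall k, tfirst (nth [::] d k).

Definition tletter (d : gdiag) c : aword := [:: (tstrand d c, true)].
(* On a diagram whose strands have their tails first, these words are the
   longitudes. *)
Definition hw d k := hword (tletter d) (nth [::] d k).

(** All tails lie on initial arcs, whose values are the plain letters, so this coloring is correct
    in every degree at once. *)
Lemma asc_coloring q d : asc d -> coloring n q d (tletter d).
Proof.
case=> wd tf k kd; have /wfP[_ uk _ _] := wd; apply: colI => u l v E ol.
have lk : l \in nth [::] d k by rewrite E mem_cat mem_head orbT.
rewrite /tletter (tstrand_eq uk lk ol).
suff -> : hword (tletter d) u = [::] by rewrite conj0; apply: weq_refl.
rewrite hword_tails //; have := tf k; rewrite E => /tfirst_prefix; exact.
Qed.

End Equivalence.

(** * Sliding a tail in front of a head *)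

Section Slide.
Variables (m n : nat).
Local Notation "d ~~> d'" := (Vn_sv_equiv m n d d') (at level 70).

(** Endpoints occur only once, so inserting letters next to given ones is a global substitution, and
    no positions have to be tracked. *)
Definition lsub (f : letter -> seq letter) (s : seq letter) := flatten (map f s).

Lemma lsub_cat f s s' : lsub f (s ++ s') = lsub f s ++ lsub f s'.
Proof. by rewrite /lsub map_cat flatten_cat. Qed.

Lemma lsub_cons f l s : lsub f (l :: s) = f l ++ lsub f s.
Proof. by []. Qed.

Lemma lsub_id f s : (forall l, l \in s -> f l = [:: l]) -> lsub f s = s.
Proof.
elim: s => //= l s IH H; rewrite lsub_cons H ?mem_head // IH // => x xs.
by rewrite H // inE xs orbT.
Qed.

Lemma flatten_lsub f (d : gdiag) : flatten (map (lsub f) d) = lsub f (flatten d).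
Proof. by elim: d => //= s d ->; rewrite lsub_cat. Qed.

Lemma nth_lsub f (d : gdiag) k : nth [::] (map (lsub f) d) k = lsub f (nth [::] d k).
Proof.
have [kd|kd] := ltnP k (size d); first by rewrite (nth_map [::]).
by rewrite !nth_default ?size_map.
Qed.

Definition add2 (x y : letter) (wx wy : seq letter) (l : letter) : seq letter :=
  if l == x then wx else if l == y then wy else [:: l].

Lemma add2_id x y wx wy s : x \notin s -> y \notin s -> lsub (add2 x y wx wy) s = s.
Proof.
move=> xs ys; apply: lsub_id => l ls; rewrite /add2.
by case: eqP => [E|_]; [rewrite -E ls in xs | case: eqP => [E|//]; rewrite -E ls in ys].
Qed.

(** The copies b and b' of a conjugate the head of c by a. This makes up for the tail of c now
    standing before the head of a, where the arc value is not yet conjugated. *)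
Definition slide_sub a ea c ec b b' :=
  add2 (Tl a ea) (Hl c ec) [:: Tl a ea; Tl b ea; Tl b' (~~ ea)]
    [:: Hl b' (~~ ea); Hl c ec; Hl b ea].

Lemma slide_sub_tails a ea c ec b b' T : all lover T ->
  all lover (lsub (slide_sub a ea c ec b b') T).
Proof.
move=> aT; apply/allP => l /flatten_mapP[x xT]; have := allP aT _ xT.
rewrite /slide_sub /add2; case: eqP => [_ _|_].
  by rewrite !inE => /or3P[] /eqP ->.
by case: eqP => [->|_] // ox; rewrite inE => /eqP ->.
Qed.

Lemma slide_sub_heads a ea c ec b b' H : all (predC lover) H ->
  all (predC lover) (lsub (slide_sub a ea c ec b b') H).
Proof.
move=> aH; apply/allP => l /flatten_mapP[x xT]; have := allP aH _ xT.
rewrite /slide_sub /add2; case: eqP => [->|_] //.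
case: eqP => [_ _|_ ox]; first by rewrite !inE => /or3P[] /eqP ->.
by rewrite inE => /eqP ->.
Qed.

Lemma perm_add_pairs (s r : seq letter) x y t t' h h' : perm_eq s (x :: y :: r) ->
  perm_eq ([:: x; t; t'] ++ [:: h'; h; y] ++ r) ([:: t; t'] ++ [:: h; h'] ++ s).
Proof.
move/permP=> ps; apply/permP => P; move: (ps P) => /= ->.
move: (nat_of_bool (P x)) (nat_of_bool (P y)) (nat_of_bool (P t)) (nat_of_bool (P t')).
move: (nat_of_bool (P h)) (nat_of_bool (P h')) (count P r); clear; lia.
Qed.

(* An R2 move creates two parallel copies of a next to the head of c, and R3 then
   moves the tail of c across the head of a. *)
Lemma slide d j A B a ea c ec : wf m d ->
  nth [::] d j = A ++ [:: Hl a ea; Tl c ec] ++ B -> a != c ->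
  exists d', [/\ d ~~> d', wf m d',
    nth [::] d' j =
      lsub (slide_sub a ea c ec (fresh d) (fresh d).+1) (A ++ [:: Tl c ec; Hl a ea] ++ B) &
    forall k, k != j ->
      nth [::] d' k = lsub (slide_sub a ea c ec (fresh d) (fresh d).+1) (nth [::] d k)].
Proof.
move=> wd E ac; set b := fresh d; set b' := (fresh d).+1; set f := slide_sub _ _ _ _ _ _.
have fb : fresh_for d b by rewrite /b -[fresh d]addn0; apply: freshP.
have fb' : fresh_for d b' by rewrite /b' -addn1; apply: freshP.
have bb : b != b' by rewrite /b /b' neq_ltn ltnSn.
have /wfP[sd uk _ _] := wd; have ud := uniq_keys_flatten uk.
have Ha : Hl a ea \in flatten d.
  by apply: (@mem_flatten_nth _ _ _ j); rewrite E mem_cat mem_head orbT.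
have Tc : Tl c ec \in flatten d.
  by apply: (@mem_flatten_nth _ _ _ j); rewrite E mem_cat !inE eqxx !orbT.
have Ta : Tl a ea \in flatten d := wf_other wd Ha.
have Hc : Hl c ec \in flatten d := wf_other wd Tc.
have ab : a <> b := fb _ Ta.
have ab' : a <> b' := fb' _ Ta.
have cb : c <> b := fb _ Tc.
have cb' : c <> b' := fb' _ Tc.
(* The R2 insertion alone: the heads of b' and b cancel in front of that of c. The R3 move then puts
   the head of c between them, which gives f. *)
pose g := add2 (Tl a ea) (Hl c ec) [:: Tl a ea; Tl b ea; Tl b' (~~ ea)]
    [:: Hl b' (~~ ea); Hl b ea; Hl c ec].
set d1 := map (lsub g) d.
have gTa : g (Tl a ea) = [:: Tl a ea; Tl b ea; Tl b' (~~ ea)] by rewrite /g /add2 eqxx.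
have gHc : g (Hl c ec) = [:: Hl b' (~~ ea); Hl b ea; Hl c ec] by rewrite /g /add2 eqxx; case: eqP.
have gother l : l <> Tl a ea -> l <> Hl c ec -> g l = [:: l].
  by move=> la lc; rewrite /g /add2 !(introF eqP).
have gHa : g (Hl a ea) = [:: Hl a ea].
  by apply: gother => // -[E']; rewrite E' eqxx in ac.
have gTc : g (Tl c ec) = [:: Tl c ec].
  by apply: gother => // -[E']; rewrite E' eqxx in ac.
have w1 : wf m d1.
  apply: (@wf_add m d d1 [:: (b, ea); (b', ~~ ea)] wd).
  - by rewrite size_map.
  - by rewrite /= inE bb.
  - by move=> x; rewrite !inE => /orP[] /eqP ->.
  rewrite flatten_lsub.
  have Hc' : Hl c ec \in rem (Tl a ea) (flatten d) by rewrite mem_rem_uniq // inE Hc andbT; apply/eqP.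
  set r := rem (Hl c ec) (rem (Tl a ea) (flatten d)).
  have pr : perm_eq (flatten d) (Tl a ea :: Hl c ec :: r).
    by apply: perm_trans (perm_to_rem Ta) _; rewrite perm_cons perm_to_rem.
  have rid : lsub g r = r.
    apply: add2_id.
      apply/negP => /mem_rem; rewrite mem_rem_uniq // inE eqxx //.
    by rewrite mem_rem_uniq ?rem_uniq // inE eqxx.
  have := perm_flatten (perm_map g pr); rewrite -!/(lsub g _) !lsub_cons rid gTa gHc => p1.
  exact: perm_trans p1 (perm_add_pairs _ _ _ _ pr).
have delg s : (forall l, l \in s -> l \in flatten d) ->
    filter (fun l => lid l \notin [:: b; b']) (lsub g s) = s.
  elim: s => //= l s IH H; rewrite lsub_cons filter_cat IH; last first.
    by move=> x xs; apply: H; rewrite inE xs orbT.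
  have ld : l \in flatten d by apply: H; rewrite mem_head.
  have keep : lid l \notin [:: b; b'].
    by rewrite !inE negb_or; apply/andP; split; apply/eqP; [apply: fb|apply: fb'].
  have [->|/eqP la] := eqVneq l (Tl a ea).
    by rewrite gTa /= !inE !eqxx ?orbT /= !(introF eqP).
  have [->|/eqP lc] := eqVneq l (Hl c ec).
    by rewrite gHc /= !inE !eqxx ?orbT /= !(introF eqP).
  by rewrite gother //= keep.
have /flatten_nthP[ka kad] := Ta; case/splitPr Ea : _ / => [a1 a2].
have /flatten_nthP[kc kcd] := Hc; case/splitPr Ec : _ / => [c1 c2].
have Ea1 : nth [::] d1 ka = lsub g a1 ++ [:: Tl a ea; Tl b ea; Tl b' (~~ ea)] ++ lsub g a2.
  by rewrite nth_lsub Ea lsub_cat lsub_cons gTa.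
have Ec1 : nth [::] d1 kc = lsub g c1 ++ [:: Hl b' (~~ ea); Hl b ea; Hl c ec] ++ lsub g c2.
  by rewrite nth_lsub Ec lsub_cat lsub_cons gHc.
have e1 : d ~~> d1.
  apply: rst_step; split=> //; split=> //; right; left; exists b, b', ea; split.
    apply: gdiag_ext; first by rewrite !size_map.
    by move=> k; rewrite nth_del nth_lsub delg // => l; apply: mem_flatten_nth.
  split.
    by left; exists ka, (rcons (lsub g a1) (Tl a ea)), (lsub g a2); rewrite Ea1 cat_rcons.
  by right; exists kc, (lsub g c1), (Hl c ec :: lsub g c2); rewrite Ec1.
have ap1 : at_pair d1 j (size (lsub g A)) (Hl a ea) (Tl c ec).
  exists (lsub g A), (lsub g B); split=> //.
  by rewrite nth_lsub E !lsub_cat !lsub_cons gHa gTc.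
have ap2 : at_pair d1 kc (size (rcons (lsub g c1) (Hl b' (~~ ea)))) (Hl b ea) (Hl c ec).
  by exists (rcons (lsub g c1) (Hl b' (~~ ea))), (lsub g c2); rewrite Ec1 cat_rcons.
have /wfP[_ uk1 _ _] := w1.
set p1 := size _ in ap1; set p2 := size _ in ap2.
set d2 := swap_at d1 j p1; have w2 : wf m d2 := wf_swap_at ap1 w1.
have d2E : d2 = map (map (exch (Hl a ea) (Tl c ec))) d1.
  by apply: swap_at_exch ap1; apply: uniq_keys_flatten.
have ap2' : at_pair d2 kc p2 (Hl b ea) (Hl c ec).
  rewrite d2E; apply: at_pair_exch ap2 => //; case=> // E'.
    by case: ab.
  by rewrite E' eqxx in ac.
have /wfP[_ uk2 _ _] := w2.
set d3 := swap_at d2 kc p2; have w3 : wf m d3 := wf_swap_at ap2' w2.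
have d3E : d3 = map (map (exch (Hl b ea) (Hl c ec))) d2.
  by apply: swap_at_exch ap2'; apply: uniq_keys_flatten.
have e2 : d1 ~~> d3.
  apply: rst_step; split=> //; split=> //; right; right; left.
  exists a, b, c, ea, ea, ec, j, p1, kc, p2; split; last split=> //; last split=> //.
    by left; exists ka, (lsub g a1), (Tl b' (~~ ea) :: lsub g a2).
  by left.
have ex l : l \in flatten d ->
    map (exch (Hl b ea) (Hl c ec)) (map (exch (Hl a ea) (Tl c ec)) (g l)) =
    f (exch (Hl a ea) (Tl c ec) l).
  move=> ld.
  have nac : (a == c) = false by rewrite (negPf ac).
  have nca : (c == a) = false by rewrite eq_sym.
  have nab : (a == b) = false by apply/eqP.
  have nba : (b == a) = false by rewrite eq_sym.
  have nab' : (a == b') = false by apply/eqP.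
  have nb'a : (b' == a) = false by rewrite eq_sym.
  have ncb : (c == b) = false by apply/eqP.
  have nbc : (b == c) = false by rewrite eq_sym.
  have ncb' : (c == b') = false by apply/eqP.
  have nb'c : (b' == c) = false by rewrite eq_sym.
  have nbb : (b == b') = false by apply/negbTE.
  have nb'b : (b' == b) = false by rewrite eq_sym.
  have eqs := (nac, nca, nab, nba, nab', nb'a, ncb, nbc, ncb', nb'c, nbb, nb'b).
  have S : forall (x y : nat) (o o' e e' : bool), ((x, o, e) == (y, o', e') :> letter) = 
     [&& x == y, o == o' & e == e'] by move=> *; rewrite !xpair_eqE andbA.
  have [->|la] := eqVneq l (Tl a ea).
    by rewrite gTa /f /slide_sub /add2 /exch /Tl /Hl; do 8?[rewrite /= ?S ?eqs ?eqxx /=].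
  have [->|lc] := eqVneq l (Hl c ec).
    by rewrite gHc /f /slide_sub /add2 /exch /Tl /Hl; do 8?[rewrite /= ?S ?eqs ?eqxx /=].
  rewrite gother; try exact/eqP.
  have [->|lha] := eqVneq l (Hl a ea).
    by rewrite /f /slide_sub /add2 /exch /Tl /Hl; do 8?[rewrite /= ?S ?eqs ?eqxx /=].
  have [->|ltc] := eqVneq l (Tl c ec).
    by rewrite /f /slide_sub /add2 /exch /Tl /Hl; do 8?[rewrite /= ?S ?eqs ?eqxx /=].
  rewrite /= /f /slide_sub /add2 /exch (negPf lha) (negPf ltc) (negPf la) (negPf lc).
  case: eqP => // lb; by case: (fb _ ld); rewrite lb.
have exs s : (forall l, l \in s -> l \in flatten d) ->
    map (exch (Hl b ea) (Hl c ec)) (map (exch (Hl a ea) (Tl c ec)) (lsub g s)) =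
    lsub f (map (exch (Hl a ea) (Tl c ec)) s).
  elim: s => //= l s IH H; rewrite !lsub_cons !map_cat ex ?H ?mem_head // IH // => x xs.
  by apply: H; rewrite inE xs orbT.
have n3 k : nth [::] d3 k = lsub f (map (exch (Hl a ea) (Tl c ec)) (nth [::] d k)).
  by rewrite d3E d2E !nth_map_map nth_lsub exs // => l; apply: mem_flatten_nth.
exists d3; split=> //.
- exact: eqv_trans e1 e2.
- rewrite n3; congr (lsub f _).
  have us := uniq_keys_strand j uk; rewrite E in us.
  have := map_uniq us; rewrite cat_uniq => /and3P[_ /hasPn H].
  have HaA : Hl a ea \notin A by apply: H; rewrite mem_head.
  have TcA : Tl c ec \notin A by apply: H; rewrite !inE eqxx orbT.
  rewrite cons_uniq inE negb_or => /and3P[/andP[xy xv] yv _].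
  by rewrite E !map_cat /= !exch_id // /exch !eqxx [Tl c ec == _]eq_sym (negPf xy).
move=> k kj; rewrite n3 exch_id //; apply/negP => xk; case/eqP: kj.
  by apply: (uniq_flatten_nth ud xk); rewrite E mem_cat mem_head orbT.
by apply: (uniq_flatten_nth ud xk); rewrite E mem_cat !inE eqxx !orbT.
Qed.

End Slide.

(** * Reduction to tails-first diagrams and their classification by words *)

Section Ascending.
Variables (m n : nat).
Local Notation "d ~~> d'" := (Vn_sv_equiv m n d d') (at level 70).

Definition noself (d : gdiag) j := forall x y, x \in nth [::] d j -> y \in nth [::] d j ->
  lid x = lid y -> lover x -> lover y.

Lemma eqv_sv d d' : wf m d' -> sv_step d d' -> wf m d -> d ~~> d'.
Proof. by move=> w' st w; apply: rst_step; do 2!split=> //; do 6!right. Qed.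

Lemma remove_self d j : wf m d -> exists d', [/\ d ~~> d', wf m d', noself d' j &
  forall k, tfirst (nth [::] d k) -> tfirst (nth [::] d' k)].
Proof.
have [r] := ubnP (size (nth [::] d j)); elim: r d => [//|r IH] d sr wd.
have [/hasP[x xj /hasP[y yj /and3P[/eqP xy ox oy]]]|/hasPn H] := boolP (has (fun x =>
    has (fun y => [&& lid x == lid y, lover x & ~~ lover y]) (nth [::] d j)) (nth [::] d j)).
  have w1 : wf m (del [:: lid x] d) by apply: wf_del.
  have st := self_sv wd xj yj xy ox oy.
  have [|d' [e' w' ns tf]] := IH (del [:: lid x] d) _ w1.
    apply: leq_trans (_ : size (nth [::] d j) <= r); last by [].
    rewrite nth_del size_filter -(count_predC (fun l => lid l \notin [:: lid x])).
    rewrite -addn1 leq_add2l -has_count; apply/hasP; exists x => //=.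
    by rewrite inE eqxx.
  exists d'; split=> //; first exact: eqv_trans (eqv_sym (eqv_sv wd st w1)) e'.
  by move=> k tk; apply: tf; rewrite nth_del; apply: tfirst_filter.
exists d; split=> //; first exact: eqv_refl.
move=> x y xj yj xy ox; have /hasPn/(_ y yj) := H x xj.
by rewrite xy eqxx ox /= negbK.
Qed.

Fixpoint inversions (s : seq letter) : nat :=
  if s is x :: s' then (if lover x then 0 else count lover s') + inversions s' else 0.

Lemma inversions_swap A h t B : ~~ lover h -> lover t ->
  inversions (A ++ [:: h; t] ++ B) = (inversions (A ++ [:: t; h] ++ B)).+1.
Proof.
move=> /negPf oh ot; elim: A => [|x A IH] /=.
  by rewrite oh ot /= add0n add1n addSn.
rewrite IH addnS !count_cat /= oh ot.
by case: (lover x).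
Qed.

(* After removing its self-arrows, sliding on strand j changes no other endpoint of
   strand j and keeps the tails-first strands tails-first, so inversions decrease. *)
Lemma push_tails d j : wf m d -> noself d j -> exists d', [/\ d ~~> d', wf m d',
  tfirst (nth [::] d' j) &
  forall k, k != j -> tfirst (nth [::] d k) -> tfirst (nth [::] d' k)].
Proof.
have [r] := ubnP (inversions (nth [::] d j)); elim: r d => [//|r IH] d ir wd ns.
have [tj|/tfirstN[A [h [t [B [E oh ot]]]]]] := boolP (tfirst (nth [::] d j)).
  by exists d; split=> //; apply: eqv_refl.
case: h t oh ot E => [[a oa] ea] [[c oc] ec] oh ot E.
have {oh} oa0 : oa = false by apply/negbTE.
have {ot} oc1 : oc = true by [].
subst oa oc.
have Haj : Hl a ea \in nth [::] d j by rewrite E mem_cat mem_head orbT.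
have Tcj : Tl c ec \in nth [::] d j by rewrite E mem_cat !inE eqxx !orbT.
have ac : a != c by apply/eqP => ac; have := ns _ _ Tcj Haj (esym ac) isT.
have [d1 [e1 w1 Ej Ek]] := slide n wd E ac.
set f := slide_sub _ _ _ _ _ _ in Ej Ek.
have Ej' : nth [::] d1 j = A ++ [:: Tl c ec; Hl a ea] ++ B.
  have P l : l \in A ++ [:: Tl c ec; Hl a ea] ++ B -> l \in nth [::] d j.
    by rewrite E !mem_cat !inE; case/or3P=> [->|/orP[->|->]|->]; rewrite ?orbT.
  rewrite Ej; apply: add2_id; apply/negP => /P H.
    by have := ns _ _ H Haj erefl isT.
  by have := ns _ _ Tcj H erefl isT.
have ns1 : noself d1 j.
  have P l : l \in nth [::] d1 j -> l \in nth [::] d j.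
    by rewrite Ej' E !mem_cat !inE; case/or3P=> [->|/orP[->|->]|->]; rewrite ?orbT.
  by move=> x y /P xj /P yj; apply: ns.
have [|d' [e' w' tj' tk']] := IH d1 _ w1 ns1.
  by move: ir; rewrite E Ej' inversions_swap // ltnS.
exists d'; split=> //; first exact: eqv_trans e1 e'.
move=> k kj tk; apply: tk' => //; rewrite Ek //.
case/tfirstP: tk => T [H [-> aT aH]]; rewrite lsub_cat.
by apply: tfirst_cat; [apply: slide_sub_tails | apply: slide_sub_heads].
Qed.

(** Slides on one strand can create self-arrows on another, so these are removed when the turn of a
    strand comes and not once at the start. *)
Theorem asc_exists d : wf m d -> exists2 d', d ~~> d' & asc m d'.
Proof.
move=> wd.
have K r : exists d', [/\ d ~~> d', wf m d' & forall k, k < r -> tfirst (nth [::] d' k)].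
  elim: r => [|r [d1 [e1 w1 t1]]]; first by exists d; split=> //; apply: eqv_refl.
  have [d2 [e2 w2 ns t2]] := remove_self r w1.
  have [d3 [e3 w3 tr t3]] := push_tails w2 ns.
  exists d3; split=> //; first exact: eqv_trans e1 (eqv_trans e2 e3).
  move=> k; rewrite ltnS leq_eqVlt => /predU1P[->//|kr].
  by apply: t3; [rewrite neq_ltn kr | apply/t2/t1].
have [d' [e' w' t']] := K m; exists d' => //; split=> // k.
have [/t' //|mk] := ltnP k m.
by rewrite nth_default // (wf_size w').
Qed.

Lemma hwE d k : hw d k = [seq (tstrand d (lid l), lsgn l) | l <- nth [::] d k & ~~ lover l].
Proof.
rewrite /hw /hword /hblocks; elim: (filter _ _) => //= l s <-.
by rewrite /tletter; case: (lsgn l).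
Qed.

Definition rlet (f : nat -> nat) (l : letter) : letter := (f (lid l), lover l, lsgn l).

Lemma wf_relabel f d : injective f -> wf m d -> wf m (relabel f d).
Proof.
move=> injf /wfP[sd uk kk sgn].
have Ef : flatten (relabel f d) = map (rlet f) (flatten d) by rewrite map_flatten.
have Ek : keys (relabel f d) = map (fun k => (f k.1, k.2)) (keys d).
  by rewrite /keys Ef -!map_comp.
have injk : injective (fun k : nat * bool => (f k.1, k.2)).
  by move=> [a b] [a' b'] [/injf -> ->].
apply/wfP; split.
- by rewrite size_map.
- by rewrite Ek map_inj_uniq.
- move=> c; rewrite Ek; apply/mapP/mapP => -[[x o] xk [-> Eo]];
    [exists (x, false)|exists (x, true)] => //.
    by rewrite -kk; rewrite -Eo in xk.
  by rewrite kk; rewrite -Eo in xk.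
- move=> x y; rewrite !Ef => /mapP[x' xd ->] /mapP[y' yd ->] /injf.
  exact: sgn.
Qed.

Lemma tstrand_relabel f d c : injective f -> tstrand (relabel f d) (f c) = tstrand d c.
Proof.
move=> injf; rewrite /tstrand find_map; apply: eq_find => s /=; rewrite has_map.
by apply: eq_has => l; rewrite /= /isov /lid /lover /= (inj_eq injf).
Qed.

Lemma nth_relabel f d k : nth [::] (relabel f d) k = map (rlet f) (nth [::] d k).
Proof. exact: nth_map_map. Qed.

Lemma hw_relabel f d k : injective f -> hw (relabel f d) k = hw d k.
Proof.
move=> injf; rewrite !hwE nth_relabel filter_map -map_comp.
by apply: eq_map => l /=; rewrite tstrand_relabel.
Qed.

Lemma tails_sub d d' k l : wf m d -> wf m d' ->
  (forall i, filter (predC lover) (nth [::] d i) = filter (predC lover) (nth [::] d' i)) ->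
  (forall i, hw d i = hw d' i) ->
  l \in nth [::] d k -> lover l -> l \in nth [::] d' k.
Proof.
move=> wd wd' Hh Hw lk ol.
have /wfP[_ uk _ _] := wd; have /wfP[_ uk' _ _] := wd'.
have := wf_other wd (mem_flatten_nth lk); rewrite ol.
set h := (_, _, _) => /flatten_nthP[i id hi].
have hh : h \in filter (predC lover) (nth [::] d i) by rewrite mem_filter hi.
have hd' : h \in nth [::] d' i by move: hh; rewrite Hh mem_filter => /andP[].
have ts : tstrand d (lid h) = tstrand d' (lid h).
  have := Hw i; rewrite !hwE -[in RHS]Hh => /eq_in_map/(_ h hh)[].
  by [].
have := wf_other wd' (mem_flatten_nth hd'); rewrite /lover /=.
have -> : (lid h, true, lsgn l) = l by rewrite /h; case: (l) ol => [[? []] ?].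
case/flatten_nthP=> k' k'd lk'.
have e1 := tstrand_eq uk lk ol; have e2 := tstrand_eq uk' lk' ol.
have -> : k = k' by rewrite -e1 -e2; exact: ts.
exact: lk'.
Qed.

(** The words record, head by head, the sign and the strand of the tail. Matching heads in order of
    occurrence gives a relabelling, after which the strands differ only in the order of their
    initial tails. *)
Theorem asc_unique d d' : asc m d -> asc m d' -> (forall k, hw d k = hw d' k) -> d ~~> d'.
Proof.
move=> [wd td] [wd' td'] Hw.
pose hs (d : gdiag) := map (fun s => map lid (filter (predC lover) s)) d.
have hsn d0 k : nth [::] (hs d0) k = map lid (filter (predC lover) (nth [::] d0 k)).
  have [kd|kd] := ltnP k (size d0); first by rewrite (nth_map [::]).
  by rewrite !nth_default ?size_map.
have hsu d0 : wf m d0 -> uniq (flatten (hs d0)).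
  move=> /wfP[_ uk _ _].
  have -> : flatten (hs d0) = map lid (filter (predC lover) (flatten d0)).
    by rewrite filter_flatten map_flatten -map_comp.
  have: uniq (map key (filter (predC lover) (flatten d0))).
    by apply: subseq_uniq uk; apply: map_subseq; apply: filter_subseq.
  have -> : map key (filter (predC lover) (flatten d0)) =
      map (fun c => (c, false)) (map lid (filter (predC lover) (flatten d0))).
    rewrite -map_comp; apply/eq_in_map => l; rewrite mem_filter => /andP[/= ol _].
    by rewrite /key (negPf ol).
  exact: map_uniq.
have sz : size d = size d' by rewrite (wf_size wd) (wf_size wd').
have shE : shape (hs d) = shape (hs d').
  have nsh (ss : seq (seq nat)) k : nth 0 (shape ss) k = size (nth [::] ss k).
    have [ks|ks] := ltnP k (size ss); first by rewrite (nth_map [::]).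
    by rewrite !nth_default ?size_map.
  apply: (@eq_from_nth _ 0); first by rewrite !size_map.
  move=> k _; rewrite !nsh !hsn !size_map.
  by have := congr1 size (Hw k); rewrite !hwE !size_map.
set I := flatten (hs d); set I' := flatten (hs d').
have uI : uniq I := hsu d wd; have uI' : uniq I' := hsu d' wd'.
have sI : size I = size I' by rewrite !size_flatten shE.
(* A relabelling must be injective on all numbers: ids that are not in use are shifted to N and
   beyond, above every id of d'. *)
pose N := (\max_(x <- I') x).+1.
pose f x := if x \in I then nth 0 I' (index x I) else N + x.
have fN x : x \in I -> f x < N.
  move=> xI; rewrite /f xI ltnS; apply: (@leq_bigmax_seq _ _ xpredT id) => //.
  by apply: mem_nth; rewrite -sI index_mem.
have injf : injective f.
  move=> x y; have [xI|xI] := boolP (x \in I); have [yI|yI] := boolP (y \in I).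
  - rewrite /f xI yI => /eqP; rewrite nth_uniq ?index_mem // -?sI ?index_mem // => /eqP E.
    by rewrite -(nth_index 0 xI) E nth_index.
  - by move=> E; have := fN x xI; rewrite E /f (negPf yI) ltnNge leq_addr.
  - by move=> E; have := fN y yI; rewrite -E /f (negPf xI) ltnNge leq_addr.
  - by rewrite /f (negPf xI) (negPf yI) => /addnI.
have mapI : map f I = I'.
  apply: (@eq_from_nth _ 0); rewrite size_map // => i iI.
  by rewrite (nth_map 0) // /f mem_nth // index_uniq.
have mapH : map (map f) (hs d) = hs d'.
  apply: eq_from_flatten_shape.
    by rewrite -map_flatten.
  rewrite -shE /shape -map_comp; apply: eq_map => s /=; exact: size_map.
set d2 := relabel f d.
have w2 : wf m d2 by apply: wf_relabel.
have e2 : d ~~> d2.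
  apply: rst_step; do 2!split=> //; do 4!right; left; exists f; split=> //.
have Hw2 k : hw d2 k = hw d' k by rewrite hw_relabel.
have heads k : filter (predC lover) (nth [::] d2 k) = filter (predC lover) (nth [::] d' k).
  have ext (s s' : seq letter) : all (predC lover) s -> all (predC lover) s' ->
      map lid s = map lid s' -> map lsgn s = map lsgn s' -> s = s'.
    elim: s s' => [|[[a o] e] s IH] [|[[a' o'] e'] s'] //=.
    rewrite /lover /lid /lsgn /= => /andP[/negbTE -> as_] /andP[/negbTE -> as'] [-> E1] [-> E2].
    by congr cons; apply: IH.
  apply: ext; try exact: filter_all.
    rewrite nth_relabel filter_map -map_comp.
    have := congr1 (fun ss => nth [::] ss k) mapH; rewrite nth_map_map !hsn -map_comp => <-.
    exact: eq_map.
  by have := congr1 (map snd) (Hw2 k); rewrite !hwE -!map_comp.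
apply: eqv_trans e2 _; apply: OC_perm => //; first by rewrite size_map.
move=> k; exists (filter lover (nth [::] d2 k)), (filter lover (nth [::] d' k)),
   (filter (predC lover) (nth [::] d' k)); split.
- rewrite -heads nth_relabel; case/tfirstP: (td k) => T [H [-> aT aH]].
  by apply/eqP; rewrite -/(tfirst _) map_cat; apply: tfirst_cat; rewrite all_map.
- exact/eqP/td'.
- exact: filter_all.
have u0 d0 : wf m d0 -> uniq (filter lover (nth [::] d0 k)).
  by move=> /wfP[_ uk _ _]; apply: filter_uniq; apply: map_uniq (uniq_keys_strand k uk).
apply: uniq_perm; try exact: u0.
move=> l; rewrite !mem_filter; case ol: (lover l) => //=.
apply/idP/idP => lk; first exact: tails_sub lk _.
by apply: tails_sub lk _ => // i; rewrite ?heads ?Hw2.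
Qed.

End Ascending.

(** * Inserting and moving arrows *)

Section Insertion.
Variables (m n : nat).
Local Notation "d ~~> d'" := (Vn_sv_equiv m n d d') (at level 70).

Lemma tstrand_sub d d' l : wf m d -> wf m d' ->
  (forall k, {subset nth [::] d k <= nth [::] d' k}) ->
  l \in flatten d -> tstrand d' (lid l) = tstrand d (lid l).
Proof.
move=> wd wd' sub; wlog ol : l / lover l => [W ld|].
  have [ol|ol] := boolP (lover l); first exact: W.
  by have /= := W _ _ (wf_other wd ld); apply; rewrite /lover /= ol.
have /wfP[_ uk _ _] := wd; have /wfP[_ uk' _ _] := wd'.
case/flatten_nthP=> k _ lk.
by rewrite (tstrand_eq uk lk ol) (tstrand_eq uk' (sub k _ lk) ol).
Qed.

Lemma hword_sub d d' s : wf m d -> wf m d' ->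
  (forall k, {subset nth [::] d k <= nth [::] d' k}) ->
  {subset s <= flatten d} -> hword (tletter d') s = hword (tletter d) s.
Proof.
move=> wd wd' sub sd; rewrite /hword /hblocks; congr flatten; apply/eq_in_map => l.
by rewrite mem_filter => /andP[_ /sd ld]; rewrite /tletter (tstrand_sub wd wd').
Qed.

Lemma mem_strand_flatten (d : gdiag) k : {subset nth [::] d k <= flatten d}.
Proof. by move=> l; apply: mem_flatten_nth. Qed.

(** The tails are inserted into the diagram that already has the new heads, so that i = j is
    covered. *)
Lemma insert2 d A i u v j a b (d1 := upd d i (u ++ Hls A ++ v))
    (d' := upd d1 j (a ++ Tls A ++ b)) :
  wf m d -> i < m -> j < m -> uniq (unzip1 A) ->
  (forall c, c \in unzip1 A -> fresh_for d c) ->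
  nth [::] d i = u ++ v -> nth [::] d1 j = a ++ b ->
  [/\ wf m d', del (unzip1 A) d' = d, forall k, {subset nth [::] d k <= nth [::] d' k} &
   forall c, c \in unzip1 A -> tstrand d' c = j].
Proof.
move=> wd im jm uA fr Ei Ej.
have sd := wf_size wd.
have s1 : size d1 = size d by rewrite size_upd ?sd.
have s' : size d' = size d by rewrite size_upd ?s1 ?sd.
have p1 : perm_eq (flatten d1) (Hls A ++ flatten d).
  by apply: perm_upd; rewrite ?sd // Ei perm_catCA.
have p' : perm_eq (flatten d') (Tls A ++ flatten d1).
  by apply: perm_upd; rewrite ?s1 ?sd // Ej perm_catCA.
have w' : wf m d'.
  apply: (wf_add wd s' uA fr); apply: perm_trans p' _; exact: perm_cat.
have sub1 k : {subset nth [::] d k <= nth [::] d1 k}.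
  move=> l; rewrite nth_upd; case: eqP => [->|//]; rewrite Ei !mem_cat.
  by case/orP=> ->; rewrite ?orbT.
have sub2 k : {subset nth [::] d1 k <= nth [::] d' k}.
  move=> l; rewrite [nth _ d' _]nth_upd; case: eqP => [->|//]; rewrite Ej !mem_cat.
  by case/orP=> ->; rewrite ?orbT.
split=> //.
- apply: gdiag_ext; first by rewrite size_map.
  have fil0 (s : seq letter) : {subset map lid s <= unzip1 A} ->
      filter (fun l => lid l \notin unzip1 A) s = [::].
    move=> sA; apply/eqP; rewrite -[_ == _]negbK -has_filter; apply/hasPn => l ls.
    by rewrite negbK; apply/sA/map_f.
  have filT : filter (fun l => lid l \notin unzip1 A) (Tls A) = [::].
    by apply: fil0 => c; rewrite -map_comp.
  have filH : filter (fun l => lid l \notin unzip1 A) (Hls A) = [::].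
    by apply: fil0 => c; rewrite -map_comp.
  have fil k : filter (fun l => lid l \notin unzip1 A) (nth [::] d1 k) = nth [::] d k.
    have idd : filter (fun l => lid l \notin unzip1 A) (nth [::] d k) = nth [::] d k.
      apply/all_filterP/allP => l lk; apply/negP => /fr.
      by move/(_ l (mem_flatten_nth lk)).
    rewrite nth_upd; case: eqP => // ki.
    by rewrite !filter_cat filH /= -filter_cat -Ei -ki.
  move=> k; rewrite nth_del [nth _ d' _]nth_upd; case: eqP => [->|_] //.
  by rewrite !filter_cat filT /= -filter_cat -Ej.
- by move=> k l /sub1/sub2.
move=> c /mapP[[c' e] cA -> /=].
have /wfP[_ uk' _ _] := w'.
apply: (@tstrand_eq d' j (Tl c' e)) => //.
rewrite nth_upd eqxx !mem_cat; apply/orP; right; apply/orP; left.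
exact: (map_f (fun c => Tl c.1 c.2) cA).
Qed.

Definition mkA (d : gdiag) (es : seq bool) : seq (nat * bool) :=
  zip (iota (fresh d) (size es)) es.

Lemma mkA_ids d es : unzip1 (mkA d es) = iota (fresh d) (size es).
Proof. by rewrite unzip1_zip ?size_iota. Qed.
Lemma mkA_sgn d es : unzip2 (mkA d es) = es.
Proof. by rewrite unzip2_zip ?size_iota. Qed.
Lemma mkA_fresh d es c : c \in unzip1 (mkA d es) -> fresh_for d c.
Proof.
rewrite mkA_ids mem_iota => /andP[fc _]; rewrite -(subnKC fc); exact: freshP.
Qed.

Lemma hword_Hls t j A : (forall c, c \in unzip1 A -> t c = [:: (j, true)]) ->
  hword t (Hls A) = [seq (j, e) | e <- unzip2 A].
Proof.
elim: A => //= -[c e] A IH H; rewrite -cat1s hword_cat IH.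
  by rewrite /hword /hblocks /= H ?mem_head //; case: (e).
by move=> x xA; apply: H; rewrite inE xA orbT.
Qed.

Lemma hword_Tls t A : hword t (Tls A) = [::].
Proof. by apply: hword_tails; apply/allP => l /mapP[c _ ->]. Qed.

Lemma all_Tls A : all lover (Tls A). Proof. by apply/allP => l /mapP[c _ ->]. Qed.
Lemma all_Hls A : all (predC lover) (Hls A). Proof. by apply/allP => l /mapP[c _ ->]. Qed.

(** Under [tletter] each head contributes exactly one letter, so a cut of the word is a cut of the
    list of heads. *)
Lemma split_hword d k p s : tfirst (nth [::] d k) -> hw d k = p ++ s ->
  exists T u v, [/\ nth [::] d k = T ++ u ++ v, all lover T, all (predC lover) u,
    all (predC lover) v & hword (tletter d) u = p /\ hword (tletter d) v = s].
Proof.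
case/tfirstP=> T [H [E aT aH]] Eh.
exists T, (take (size p) H), (drop (size p) H); rewrite cat_take_drop; split=> //.
- by apply/allP => l /mem_take; apply: (allP aH).
- by apply/allP => l /mem_drop; apply: (allP aH).
have hE s0 : all (predC lover) s0 -> hword (tletter d) s0 = [seq (tstrand d (lid l), lsgn l) | l <- s0].
  elim: s0 => //= l s0 IH /andP[ol a0]; rewrite -cat1s hword_cat IH //.
  by rewrite /hword /hblocks /= (negPf ol) /tletter /=; case: (lsgn l).
have := Eh; rewrite /hw E hword_cat hword_tails // hE //= => EH.
rewrite !hE; last 2 first.
- by apply/allP => l /mem_drop; apply: (allP aH).
- by apply/allP => l /mem_take; apply: (allP aH).
by rewrite map_take map_drop EH take_size_cat // drop_size_cat.
Qed.

(** Letters are inserted into a word by new arrows whose tails stand at the front of strand j. The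
    second group of conclusions provides the blocks of endpoints that R2, V^n and sv ask for. *)
Lemma insert_arrows d i j es p s : asc m d -> i < m -> j < m -> hw d i = p ++ s ->
  exists d' A, [/\ asc m d', hw d' i = p ++ [seq (j, e) | e <- es] ++ s &
      forall k, k != i -> hw d' k = hw d k] /\
    [/\ unzip2 A = es, uniq (unzip1 A), del (unzip1 A) d' = d,
      exists u v, nth [::] d' j = u ++ Tls A ++ v &
      exists u v, [/\ nth [::] d' i = u ++ Hls A ++ v, all (predC lover) v,
        hword (tletter d') u = p & hword (tletter d') v = s]].
Proof.
move=> [wd td] im jm Ehw; have [T [u [v [E aT au av [hu hv]]]]] := split_hword (td i) Ehw.
pose A := mkA d es.
have uA : uniq (unzip1 A) by rewrite mkA_ids iota_uniq.
have frA c : c \in unzip1 A -> fresh_for d c := @mkA_fresh d es c.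
pose d1 := upd d i ((T ++ u) ++ Hls A ++ v).
pose d' := upd d1 j ([::] ++ Tls A ++ nth [::] d1 j).
have Ei : nth [::] d i = (T ++ u) ++ v by rewrite -catA.
have [w' del' sub tsA] := @insert2 d A i _ _ j [::] _ wd im jm uA frA Ei erefl.
rewrite -/d1 -/d' in w' del' sub tsA.
have n' k : nth [::] d' k = (if k == j then Tls A else [::]) ++ nth [::] d1 k.
  by rewrite [LHS]nth_upd; case: eqP => // ->.
have n1i : nth [::] d1 i = T ++ u ++ Hls A ++ v by rewrite nth_upd eqxx -catA.
have n1 k : k != i -> nth [::] d1 k = nth [::] d k by move=> /negPf ki; rewrite nth_upd ki.
have hif t k : hword t (if k == j then Tls A else [::]) = [::].
  by case: ifP => _ //; apply: hword_Tls.
exists d', A; split; split.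
- split=> // k; rewrite n'.
  have tif s0 : tfirst s0 -> tfirst ((if k == j then Tls A else [::]) ++ s0).
    case/tfirstP=> T0 [H0 [-> a0 b0]]; rewrite catA; apply: tfirst_cat => //.
    by rewrite all_cat a0 andbT; case: ifP => _ //; apply: all_Tls.
  apply: tif; have [->|ki] := eqVneq k i; last by rewrite n1.
  by rewrite n1i; apply: tfirst_cat => //; rewrite !all_cat au av all_Hls.
- rewrite /hw n' hword_cat hif n1i !hword_cat hword_tails //=.
  rewrite (hword_Hls (j := j)); last by move=> c cA; rewrite /tletter tsA.
  rewrite mkA_sgn !(hword_sub wd w' sub) ?hu ?hv // => l lu;
  by apply: (@mem_strand_flatten _ i); rewrite E !mem_cat lu ?orbT.
- move=> k ki; rewrite /hw n' hword_cat hif n1 //= (hword_sub wd w' sub) //.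
  exact: mem_strand_flatten.
- exact: mkA_sgn.
- exact: uA.
- exact: del'.
- by exists [::], (nth [::] d1 j); rewrite n' eqxx.
- exists ((if i == j then Tls A else [::]) ++ T ++ u), v.
  split=> //; first by rewrite n' n1i -!catA.
    rewrite !hword_cat hif hword_tails //= (hword_sub wd w' sub) // => l lu.
    by apply: (@mem_strand_flatten _ i); rewrite E !mem_cat lu ?orbT.
  rewrite (hword_sub wd w' sub) // => l lu.
  by apply: (@mem_strand_flatten _ i); rewrite E !mem_cat lu ?orbT.
Qed.

Lemma slide_sub_hword t a ea c ec b b' s : Hl c ec \notin s ->
  hword t (lsub (slide_sub a ea c ec b b') s) = hword t s.
Proof.
elim: s => //= l s IH; rewrite inE negb_or => /andP[lc /IH E].
rewrite lsub_cons hword_cat E -[in RHS]cat1s hword_cat; congr (_ ++ _).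
rewrite /slide_sub /add2; case: eqP => [->|_] //.
by rewrite eq_sym (negPf lc).
Qed.

Lemma mem_slide_sub a ea c ec b b' s l : l \in s -> l \in lsub (slide_sub a ea c ec b b') s.
Proof.
move=> ls; apply/flatten_mapP; exists l => //; rewrite /slide_sub /add2.
case: eqP => [->|_]; first by rewrite mem_head.
by case: eqP => [->|_]; rewrite ?mem_head // !inE eqxx orbT.
Qed.

(* Moving a tail of strand j in front of all heads conjugates the letter of its
   head by the word of the heads that have been crossed. *)
Lemma slide_to_front d i j T G c ec R P S : wf m d -> i != j ->
  (forall k, k != j -> tfirst (nth [::] d k)) ->
  nth [::] d j = T ++ G ++ Tl c ec :: R -> all lover T -> all (predC lover) G ->
  all (predC lover) R -> nth [::] d i = P ++ Hl c ec :: S ->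
  exists d', [/\ d ~~> d', asc m d',
    hw d' i = hword (tletter d) P ++ wconj [:: (j, ec)] (hword (tletter d) G)
                ++ hword (tletter d) S &
    forall k, k != i -> hw d' k = hw d k].
Proof.
move=> + ij; elim/last_ind: G d T R P S => [|G h IH] d T R P S wd tf Ej aT aG aR Ei.
  exists d; split=> //; first exact: eqv_refl.
    split=> // k; have [->|/tf //] := eqVneq k j.
    by rewrite Ej /= -cat_rcons; apply: tfirst_cat => //; rewrite all_rcons aT.
  have /wfP[_ uk _ _] := wd.
  have ts : tstrand d c = j.
    apply: (@tstrand_eq d j (Tl c ec)) => //.
    by rewrite Ej !mem_cat mem_head !orbT.
  rewrite /hw Ei hword_cat -cat1s hword_cat conj0; congr (_ ++ (_ ++ _)).
  by rewrite /hword /hblocks /= /tletter [tstrand _ _]ts; case: ec {Ej Ei}.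
move: aG; rewrite all_rcons => /andP[oh aG].
case: h oh Ej => [[a oa] ea] oh Ej.
have {oh} oa0 : oa = false by apply/negbTE.
subst oa.
have Ej' : nth [::] d j = (T ++ G) ++ [:: Hl a ea; Tl c ec] ++ R.
  by rewrite Ej cat_rcons -catA.
have /wfP[_ uk _ _] := wd.
have Haj : Hl a ea \in nth [::] d j by rewrite Ej' mem_cat mem_head orbT.
have Hci : Hl c ec \in nth [::] d i by rewrite Ei mem_cat mem_head orbT.
have ac : a != c.
  apply/eqP => ac; case/eqP: ij; apply: (key_strand uk Hci Haj).
  by rewrite ac.
have [d1 [e1 w1 Ej1 Ek1]] := slide n wd Ej' ac.
set b := fresh d in Ej1 Ek1; set b' := (fresh d).+1 in Ej1 Ek1.
set f := slide_sub a ea c ec b b' in Ej1 Ek1.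
have nHc k : k != i -> Hl c ec \notin nth [::] d k.
  by move=> ki; apply/negP => Hk; case/eqP: ki; apply: (key_strand uk Hk Hci).
have ji : j != i by rewrite eq_sym.
have hd s : all (predC lover) s -> {subset s <= nth [::] d j} -> lsub f s = s.
  move=> as_ sj; apply: add2_id; apply/negP => H; first by have := allP as_ _ H.
  by have /negP := nHc j ji; apply; apply: sj.
have sub k : {subset nth [::] d k <= nth [::] d1 k}.
  move=> l lk; have [kj|kj] := eqVneq k j; last by rewrite Ek1 //; apply: mem_slide_sub.
  rewrite kj Ej1; apply: mem_slide_sub; move: lk; rewrite kj Ej' !mem_cat !inE.
  by case/or3P=> [->|/orP[->|->]|->]; rewrite ?orbT.
have sG : {subset G <= nth [::] d j} by move=> l lG; rewrite Ej' !mem_cat lG orbT.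
have sR : {subset R <= nth [::] d j} by move=> l lR; rewrite Ej' !mem_cat lR !orbT.
have fTc : f (Tl c ec) = [:: Tl c ec].
  rewrite /f /slide_sub /add2; case: eqP => [[E]|_]; first by rewrite E eqxx in ac.
  by case: eqP.
have fHa : f (Hl a ea) = [:: Hl a ea].
  by have := hd [:: Hl a ea] isT; rewrite /lsub /= cats0; apply=> l; rewrite inE => /eqP ->.
have Ej1' : nth [::] d1 j = lsub f T ++ G ++ Tl c ec :: (Hl a ea :: R).
  by rewrite Ej1 !lsub_cat !lsub_cons fTc fHa (hd G) // (hd R) // -catA.
have us := uniq_keys_strand i uk.
have HcP : Hl c ec \notin P /\ Hl c ec \notin S.
  move: us; rewrite Ei => /map_uniq; rewrite cat_uniq cons_uniq => /and3P[_ /hasPn H /andP[HS _]].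
  by split=> //; apply: H; rewrite mem_head.
have fHc : f (Hl c ec) = [:: Hl b' (~~ ea); Hl c ec; Hl b ea].
  by rewrite /f /slide_sub /add2; case: eqP => // _; rewrite eqxx.
have Ei1 : nth [::] d1 i = rcons (lsub f P) (Hl b' (~~ ea)) ++ Hl c ec :: (Hl b ea :: lsub f S).
  by rewrite Ek1 // Ei lsub_cat lsub_cons fHc cat_rcons.
have tf1 k : k != j -> tfirst (nth [::] d1 k).
  move=> kj; rewrite Ek1 //; case/tfirstP: (tf k kj) => T0 [H0 [-> a0 b0]].
  by rewrite lsub_cat; apply: tfirst_cat; [apply: slide_sub_tails | apply: slide_sub_heads].
have aR' : all (predC lover) (Hl a ea :: R) by [].
(* The head of c is now flanked by b' and b: the heads still to be crossed conjugate inside, a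
   outermost, which is [conj_cat]. *)
have [d' [e' as' hi' hk']] :=
  IH d1 _ (Hl a ea :: R) _ _ w1 tf1 Ej1' (slide_sub_tails _ _ _ _ _ _ aT) aG aR' Ei1.
have sPS l : l \in P ++ S -> l \in flatten d.
  move=> lPS; apply: (@mem_strand_flatten _ i); move: lPS; rewrite Ei !mem_cat inE.
  by case/orP=> ->; rewrite ?orbT.
have oldw s : {subset s <= flatten d} -> hword (tletter d1) s = hword (tletter d) s.
  exact: hword_sub wd w1 sub.
have /wfP[_ uk1 _ _] := w1.
have tsa : tstrand d1 b = tstrand d a /\ tstrand d1 b' = tstrand d a.
  have /flatten_nthP[k _ Tak] := wf_other wd (mem_flatten_nth Haj).
  rewrite -(tstrand_sub wd w1 sub (mem_flatten_nth Haj)).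
  rewrite /lid /= in Tak *.
  have Tak1 := sub k _ Tak.
  have mem3 x : x \in f (Tl a ea) -> x \in nth [::] d1 k.
    move=> xf; have [kj|kj] := eqVneq k j; last first.
      by rewrite Ek1 //; apply/flatten_mapP; exists (Tl a ea).
    rewrite kj Ej1; apply/flatten_mapP; exists (Tl a ea) => //.
    move: Tak; rewrite kj Ej' !mem_cat !inE.
    by case/or3P=> [->|/orP[/eqP|]|->]; rewrite ?orbT // => ->; rewrite ?orbT.
  have fTa : f (Tl a ea) = [:: Tl a ea; Tl b ea; Tl b' (~~ ea)].
    by rewrite /f /slide_sub /add2 eqxx.
  have E0 : tstrand d1 a = k by apply: (@tstrand_eq d1 k (Tl a ea)).
  rewrite E0; split.
    by apply: (@tstrand_eq d1 k (Tl b ea)) => //; apply: mem3; rewrite fTa !inE eqxx ?orbT.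
  by apply: (@tstrand_eq d1 k (Tl b' (~~ ea))) => //; apply: mem3; rewrite fTa !inE eqxx ?orbT.
have hP : hword (tletter d1) (lsub f P) = hword (tletter d) P.
  rewrite slide_sub_hword; last by case: HcP.
  by apply: oldw => l lP; apply: sPS; rewrite mem_cat lP.
have hS : hword (tletter d1) (lsub f S) = hword (tletter d) S.
  rewrite slide_sub_hword; last by case: HcP.
  by apply: oldw => l lP; apply: sPS; rewrite mem_cat lP orbT.
have hG : hword (tletter d1) G = hword (tletter d) G.
  by apply: oldw => l lG; apply: (@mem_strand_flatten _ j); apply: sG.
have hl t x e : hword t [:: Hl x e] = gpow (t x) e by rewrite /hword /hblocks /= cats0.
exists d'; split=> //.
- exact: eqv_trans e1 e'.
- rewrite hi' -cats1 hword_cat hl -[in X in _ ++ _ ++ X = _]cat1s hword_cat hl hP hS hG.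
  rewrite -cats1 hword_cat hl /tletter tsa.1 tsa.2 conj_cat /wconj -!catA.
  by rewrite -ginv_gpow.
- move=> k ki; rewrite hk' // /hw.
  have [->|kj] := eqVneq k j.
    have aT1 : all lover (lsub f T) by apply: slide_sub_tails.
    rewrite Ej1' Ej' -catA hword_cat hword_cat hword_cat hword_cat.
    rewrite (hword_tails _ aT) (hword_tails _ aT1) hG; congr (_ ++ (_ ++ _)).
    have -> : hword (tletter d1) (Tl c ec :: Hl a ea :: R) = hword (tletter d1) (Hl a ea :: R) by [].
    have -> : hword (tletter d) [:: Hl a ea, Tl c ec & R] = hword (tletter d) (Hl a ea :: R) by [].
    rewrite oldw // => l; rewrite inE => /predU1P[->|/sR lj].
      exact: mem_flatten_nth Haj.
    exact: mem_flatten_nth lj.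
  rewrite Ek1 // slide_sub_hword ?nHc // oldw //; exact: mem_strand_flatten.
Qed.

End Insertion.

(** * Relations between head words *)

Section WordFamilies.
Variables (m n : nat).
Local Notation "d ~~> d'" := (Vn_sv_equiv m n d d') (at level 70).
Local Notation inm := (all (fun x : nat * bool => x.1 < m)).

Definition valid (ws : nat -> aword) :=
  (forall k, inm (ws k)) /\ (forall k, m <= k -> ws k = [::]).
Definition realizes d ws := asc m d /\ forall k, hw d k = ws k.
(** Quantifying over all realizations makes any convenient diagram usable; in return, transitivity
    needs a middle family that is realizable, which [valid] ensures. *)
Definition wrel ws ws' := forall d d', realizes d ws -> realizes d' ws' -> d ~~> d'.
Definition setw (ws : nat -> aword) i w := fun k => if k == i then w else ws k.

Lemma valid_hw d : asc m d -> valid (hw d).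
Proof.
case=> wd _; have /wfP[sd uk _ _] := wd; split=> k; last first.
  by move=> mk; rewrite /hw nth_default // sd.
rewrite hwE; apply/allP => x /mapP[l]; rewrite mem_filter => /andP[ol lk] -> /=.
have := wf_other wd (mem_flatten_nth lk); rewrite ol => /flatten_nthP[k' k'd lk'].
by rewrite [tstrand d _](tstrand_eq uk lk') // -sd.
Qed.

Lemma valid_setw ws i w : valid ws -> i < m -> inm w -> valid (setw ws i w).
Proof.
move=> [v1 v2] im iw; split=> k; rewrite /setw; case: eqP => // ki; last exact: v2.
by rewrite ki leqNgt im.
Qed.

Lemma insert_word d i w : asc m d -> i < m -> inm w ->
  exists d', [/\ asc m d', hw d' i = w ++ hw d i & forall k, k != i -> hw d' k = hw d k].
Proof.
move=> ad im; elim: w => [_|[j e] w IH] /=; first by exists d.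
case/andP=> jm /IH[d1 [a1 h1 k1]].
have [d' [A [[a' h' k'] _]]] := @insert_arrows m d1 i j [:: e] [::] _ a1 im jm erefl.
by exists d'; split=> // [|k ki]; [rewrite h' h1 | rewrite k' ?k1].
Qed.

Lemma realizes_exists ws : valid ws -> exists d, realizes d ws.
Proof.
move=> [v1 v2].
have K r : r <= m -> exists2 d, asc m d & forall k, hw d k = if k < r then ws k else [::].
  elim: r => [_|r IH rm].
    have fl : flatten (nseq m ([::] : seq letter)) = [::] by elim: m.
    exists (nseq m [::]); last by move=> k; rewrite /hw nth_nseq if_same.
    split=> [|k]; last by rewrite nth_nseq if_same.
    by apply/wfP; rewrite /keys fl size_nseq.
  have [d ad hd] := IH (ltnW rm); have [d' [a' h' k']] := insert_word ad rm (v1 r).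
  exists d' => // k; have [->|kr] := eqVneq k r.
    by rewrite h' hd ltnn ltnSn cats0.
  by rewrite k' // hd [k < r.+1]ltnS [k <= r]leq_eqVlt (negPf kr).
have [d ad hd] := K m (leqnn m); exists d; split=> // k; rewrite hd.
by case: ltnP => // /v2.
Qed.

Lemma wrel_refl ws ws' : (forall k, ws k = ws' k) -> wrel ws ws'.
Proof.
by move=> E d d' [a h] [a' h']; apply: asc_unique => // k; rewrite h h'.
Qed.

Lemma wrel_sym ws ws' : wrel ws ws' -> wrel ws' ws.
Proof. by move=> R d d' r r'; apply/eqv_sym/R. Qed.

Lemma wrel_trans ws1 ws2 ws3 : valid ws2 -> wrel ws1 ws2 -> wrel ws2 ws3 -> wrel ws1 ws3.
Proof.
move=> /realizes_exists[d2 r2] R1 R2 d1 d3 r1 r3.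
exact: eqv_trans (R1 _ _ r1 r2) (R2 _ _ r2 r3).
Qed.

Lemma realizes_ext d ws ws' : (forall k, ws k = ws' k) -> realizes d ws -> realizes d ws'.
Proof. by move=> E [a h]; split=> // k; rewrite h. Qed.

Lemma wrel_insert ws i j es p s : i < m -> j < m ->
  (forall d d' A, asc m d -> asc m d' -> unzip2 A = es -> uniq (unzip1 A) ->
     del (unzip1 A) d' = d -> (exists u v, nth [::] d' j = u ++ Tls A ++ v) ->
     (exists u v, nth [::] d' i = u ++ Hls A ++ v) -> d ~~> d') ->
  wrel (setw ws i (p ++ s)) (setw ws i (p ++ [seq (j, e) | e <- es] ++ s)).
Proof.
move=> im jm H d d' [ad hd] [ad' hd'].
have hi : hw d i = p ++ s by rewrite hd /setw eqxx.
have [d1 [A [[a1 h1 k1] [sA uA dA tA [u [v [hA _ _ _]]]]]]] := insert_arrows es ad im jm hi.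
apply: eqv_trans (H d d1 A ad a1 sA uA dA tA _) _; first by exists u, v.
apply: asc_unique => // k; rewrite hd' /setw; case: eqP => [->//|/eqP ki].
by rewrite k1 // hd /setw (negPf ki).
Qed.

Lemma wrel_free ws i x p s : i < m -> x.1 < m ->
  wrel (setw ws i (p ++ s)) (setw ws i (p ++ [:: x; linv x] ++ s)).
Proof.
case: x => j e im jm; apply: (@wrel_insert ws i j [:: e; ~~ e] p s im jm).
move=> d d' A [wd _] [wd' _] sA uA dA [u [v tA]] [u' [v' hA]].
case: A sA uA dA tA hA => [//|[c e1] [//|[c' e2] [|//]]] /= [-> ->] uA dA tA hA.
apply: rst_step; do 2!split=> //; right; left; exists c, c', e; split=> //.
by split; left; [exists j, u, v | exists i, u', v'].
Qed.

Lemma wrel_pow ws i j p s : i < m -> j < m ->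
  wrel (setw ws i (p ++ s)) (setw ws i (p ++ nseq n (j, true) ++ s)).
Proof.
move=> im jm; have -> : nseq n (j, true) = [seq (j, e) | e <- nseq n true] by rewrite map_nseq.
apply: wrel_insert => // d d' A [wd _] [wd' _] sA uA dA [u [v tA]] [u' [v' hA]].
have szA : size A = n by rewrite -(size_map snd) -/(unzip2 A) sA size_nseq.
have eA c : c \in A -> c.2 = true.
  by move=> cA; have := map_f snd cA; rewrite -/(unzip2 A) sA mem_nseq => /andP[_ /eqP].
apply: rst_step; do 2!split=> //; do 5!right; left.
exists (unzip1 A), true, (Tls A), (Hls A).
rewrite !size_map szA uA dA; do 5!split=> //; split.
  apply/allP => l /mapP[c cA ->]; rewrite /lover /lid /lsgn /= eA // andbT.
  exact: (map_f fst cA).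
split.
  apply/allP => l /mapP[c cA ->]; rewrite /lover /lid /lsgn /= eA // andbT.
  exact: (map_f fst cA).
by split; [exists j, u, v | exists i, u', v'].
Qed.

Lemma wrel_sv ws i e p s : i < m ->
  wrel (setw ws i (p ++ s)) (setw ws i (p ++ [:: (i, e)] ++ s)).
Proof.
move=> im; apply: (@wrel_insert ws i i [:: e] p s im im).
move=> d d' A [wd _] [wd' _] sA uA dA [u [v tA]] [u' [v' hA]].
case: A sA uA dA tA hA => [//|[c e1] [|//]] /= [->] uA dA tA hA.
apply: eqv_sv => //; rewrite -dA.
apply: (self_sv wd' (i := i) (x := Tl c e) (y := Hl c e)) => //.
  by rewrite tA mem_cat mem_head orbT.
by rewrite hA mem_cat mem_head orbT.
Qed.

Lemma inm_ginv g : inm (ginv g) = inm g.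
Proof. by rewrite /ginv all_rev all_map. Qed.

Lemma wrel_mulV ws i g p s : valid ws -> i < m -> inm g -> inm p -> inm s ->
  wrel (setw ws i (p ++ s)) (setw ws i (p ++ g ++ ginv g ++ s)).
Proof.
move=> vw im + ip is_; elim/last_ind: g => [_|g x IH]; first exact: wrel_refl.
rewrite all_rcons => /andP[xm ig].
apply: wrel_trans (IH ig) _.
  by apply: valid_setw => //; rewrite !all_cat ip ig inm_ginv ig.
have := @wrel_free ws i x (p ++ g) (ginv g ++ s) im xm.
by rewrite -[rcons g x]cats1 ginv_cat -!catA.
Qed.

Lemma tfirst_catl u v : tfirst (u ++ v) -> tfirst u.
Proof.
case/tfirstP=> T [H [E aT aH]].
have Eu : u = take (size u) (T ++ H) by rewrite -E take_size_cat.
rewrite Eu take_cat; case: ltnP => _; last first.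
  by apply: tfirst_cat => //; apply/allP => l /mem_take; apply: (allP aH).
rewrite -[take _ _]cats0; apply: tfirst_cat => //.
by apply/allP => l /mem_take; apply: (allP aT).
Qed.

(* Strand j can be given an arc with meridian the conjugate of a_j by g; a
   self-arrow on strand j, free by sv, then conjugates this meridian by a_j. *)
Lemma wrel_comm ws i j g p s : valid ws -> i < m -> j < m -> i != j ->
  inm g -> inm p -> inm s ->
  wrel (setw ws i (p ++ wconj [:: (j, true)] g ++ s))
       (setw ws i (p ++ wconj [:: (j, true)] (rcons g (j, true)) ++ s)).
Proof.
move=> vw im jm ij ig ip is_.
have ji : j != i by rewrite eq_sym.
have igV : inm (ginv g) by rewrite inm_ginv.
have vj : inm (ws j) by case: vw.
(* Between g and g^-1 runs an arc of strand j whose meridian is the conjugate of a_j by g. *)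
pose wsE := setw (setw ws i (p ++ s)) j (g ++ (ginv g ++ ws j)).
have vE : valid wsE.
  by do 2?apply: valid_setw => //; rewrite !all_cat ?ip ?ig ?igV.
have [e [ae he]] := realizes_exists vE.
have hej : hw e j = g ++ (ginv g ++ ws j) by rewrite he /wsE /setw eqxx.
have [e' [A [[a' h' k'] [sA uA dA [ut [vt tA]] [u0 [v0 [hA av0 hu0 hv0]]]]]]] :=
  insert_arrows [:: true] ae jm jm hej.
case: A sA uA dA tA hA => [//|[a e1] [|//]] /= [->] uA dA tA hA.
have [wd' tf'] := a'; have /wfP[_ uk' _ _] := wd'.
have h'i : hw e' i = p ++ s by rewrite k' // he /wsE /setw (negPf ij) eqxx.
have [Ti [ui [vi [Ei aTi aui avi [hui hvi]]]]] := split_hword (tf' i) h'i.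
have [T0 [G0 [Eu0 aT0 aG0]]] : exists T H, [/\ u0 = T ++ H, all lover T & all (predC lover) H].
  by apply: tfirstP; apply: (@tfirst_catl _ ([:: Hl a true] ++ v0)); rewrite -hA.
pose B := mkA e' [:: true]; pose c := fresh e'.
have EB : B = [:: (c, true)] by [].
have uB : uniq (unzip1 B) by rewrite EB.
have frB x : x \in unzip1 B -> fresh_for e' x := @mkA_fresh e' [:: true] x.
have frc : fresh_for e' c by apply: frB; rewrite EB mem_head.
have Taj : Tl a true \in nth [::] e' j by rewrite tA mem_cat mem_head orbT.
have Haj : Hl a true \in nth [::] e' j by rewrite hA mem_cat mem_head orbT.
have ac : a <> c := frc _ (mem_flatten_nth Taj).
pose d1 := upd e' i ((Ti ++ ui) ++ Hls B ++ vi).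
(* The tail of the new arrow c comes right after the head of the self-arrow a. Slid to the front, it
   reads a_j conjugated by g a_j in f', and by g alone once a is deleted. *)
pose f' := upd d1 j ((u0 ++ [:: Hl a true]) ++ Tls B ++ v0).
have Ei' : nth [::] e' i = (Ti ++ ui) ++ vi by rewrite -catA.
have Ej' : nth [::] d1 j = (u0 ++ [:: Hl a true]) ++ v0.
  by rewrite nth_upd (negPf ji) hA -catA.
have [wf' _ sub tsB] := insert2 wd' im jm uB frB Ei' Ej'.
rewrite -/d1 -/f' in wf' sub tsB.
have nj : nth [::] f' j = T0 ++ (G0 ++ [:: Hl a true]) ++ Tl c true :: v0.
  by rewrite nth_upd eqxx Eu0 -!catA.
have ni : nth [::] f' i = (Ti ++ ui) ++ Hl c true :: vi.
  by rewrite nth_upd (negPf ij) nth_upd eqxx.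
have nk k : k != i -> k != j -> nth [::] f' k = nth [::] e' k.
  by move=> /negPf ki /negPf kj; rewrite nth_upd kj nth_upd ki.
have tff k : k != j -> tfirst (nth [::] f' k).
  move=> kj; have [->|ki] := eqVneq k i; last by rewrite nk.
  by rewrite ni -catA; apply: tfirst_cat => //; rewrite all_cat aui.
have aG1 : all (predC lover) (G0 ++ [:: Hl a true]) by rewrite all_cat aG0.
have /wfP[_ ukf _ _] := wf'.
have oldw s0 k : {subset s0 <= nth [::] e' k} -> hword (tletter f') s0 = hword (tletter e') s0.
  by move=> s0k; apply: (hword_sub wd' wf' sub) => l /s0k; apply: mem_flatten_nth.
have sj s0 : {subset s0 <= u0} -> {subset s0 <= nth [::] e' j}.
  by move=> H l /H lu; rewrite hA mem_cat lu.
have hG0 : hword (tletter f') G0 = g.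
  rewrite (oldw _ j); last by apply: sj => l lG; rewrite Eu0 mem_cat lG orbT.
  by rewrite -hu0 Eu0 hword_cat (hword_tails _ aT0).
have hv : hword (tletter f') v0 = ginv g ++ ws j.
  by rewrite (oldw _ j) // => l lv; rewrite hA mem_cat inE lv !orbT.
have hP : hword (tletter f') (Ti ++ ui) = p.
  rewrite (oldw _ i); last by move=> l lT; rewrite Ei' mem_cat lT.
  by rewrite hword_cat (hword_tails _ aTi).
have hS : hword (tletter f') vi = s.
  by rewrite (oldw _ i) // => l lv; rewrite Ei' mem_cat lv orbT.
have tsa : tstrand f' a = j by apply: (tstrand_eq ukf (sub j _ Taj)).
have hHa : hword (tletter f') [:: Hl a true] = [:: (j, true)].
  by rewrite /hword /hblocks /= /tletter [tstrand _ _]tsa.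
have [e2' [q2' a2' i2' k2']] := slide_to_front n wf' ij tff nj aT0 aG1 av0 ni.
rewrite hP hS hword_cat hG0 hHa cats1 in i2'.
have j2' : hw e2' j = g ++ [:: (j, true)] ++ ginv g ++ ws j.
  rewrite k2' // /hw nj hword_cat (hword_tails _ aT0) /= hword_cat hword_cat hG0 hHa -catA.
  by rewrite -hv.
pose f := del [:: a] f'.
have wf_ : wf m f by apply: wf_del.
have ef : f ~~> f'.
  apply: eqv_sv => //.
  by apply: (self_sv wf' (i := j) (x := Tl a true) (y := Hl a true)) => //; apply: sub.
have keep k (s0 : seq letter) : {subset s0 <= nth [::] f' k} -> Hl a true \notin s0 ->
    forall l, l \in s0 -> ~~ lover l -> lid l \notin [:: a].
  move=> s0k Hs l ls ol; rewrite inE; apply/eqP => la; case/negP: Hs.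
  suff <- : l = Hl a true by [].
  apply: (wf_letter_eq wf'); first exact: mem_flatten_nth (s0k _ ls).
    exact: mem_flatten_nth (sub j _ Haj).
  by rewrite /key la (negPf ol).
have usj := map_uniq (uniq_keys_strand j ukf).
have [HaG Hav] : Hl a true \notin G0 /\ Hl a true \notin v0.
  move: usj; rewrite nj cat_uniq => /and3P[_ _]; rewrite -catA cat_uniq => /and3P[_ /hasPn H].
  rewrite /= inE negb_or => /andP[/andP[_ Hv] _]; split=> //.
  by apply: H; rewrite mem_head.
have allk (s0 : seq letter) : all (predC lover) s0 -> {subset s0 <= nth [::] f' j} ->
    Hl a true \notin s0 -> filter (fun l => lid l \notin [:: a]) s0 = s0.
  move=> a0 s0k Hs; apply/all_filterP/allP => l ls; apply: (keep j s0) => //.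
  exact: (allP a0).
have njf : nth [::] f j = filter (fun l => lid l \notin [:: a]) T0 ++ G0 ++ Tl c true :: v0.
  rewrite nth_del nj !filter_cat /= /lid /= inE eqxx /= cats0 inE.
  rewrite (introF eqP (fun ca => ac (esym ca))) /= -/lid.
  rewrite (allk G0) // ?(allk v0) // => l lG; rewrite nj !mem_cat ?lG ?orbT //.
  by rewrite !inE lG !orbT.
have fi k : k != j -> forall l, l \in nth [::] f' k -> ~~ lover l -> lid l \notin [:: a].
  move=> kj; apply: (keep k) => //; apply/negP => Hk; case/eqP: kj.
  exact: (key_strand ukf Hk (sub j _ Haj)).
have nif : nth [::] f i = filter (fun l => lid l \notin [:: a]) (Ti ++ ui) ++
    Hl c true :: filter (fun l => lid l \notin [:: a]) vi.
  rewrite nth_del ni filter_cat [X in _ ++ X]/= /lid /= inE.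
  by rewrite (introF eqP (fun ca => ac (esym ca))).
have tf_ k : k != j -> tfirst (nth [::] f k).
  by move=> kj; rewrite nth_del; apply/tfirst_filter/tff.
have aT0' : all lover (filter (fun l => lid l \notin [:: a]) T0).
  by apply/allP => l; rewrite mem_filter => /andP[_]; apply: (allP aT0).
have subf k : {subset nth [::] f k <= nth [::] f' k}.
  by move=> l; rewrite nth_del mem_filter => /andP[].
have hf s0 k : {subset s0 <= nth [::] f k} -> hword (tletter f) s0 = hword (tletter f') s0.
  by move=> s0k; apply/esym/(hword_sub wf_ wf' subf) => l /s0k; apply: mem_flatten_nth.
have [e2 [q2 a2 i2 k2]] := slide_to_front n wf_ ij tf_ njf aT0' aG0 av0 nif.
have hGf : hword (tletter f) G0 = g.
  by rewrite (hf _ j) // => l lG; rewrite njf !mem_cat lG orbT.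
have hPf : hword (tletter f) (filter (fun l => lid l \notin [:: a]) (Ti ++ ui)) = p.
  rewrite (hf _ i); last by move=> l lG; rewrite nif mem_cat lG.
  by rewrite hword_filter // => l lP; apply: (fi i ij); rewrite ni mem_cat lP.
have hSf : hword (tletter f) (filter (fun l => lid l \notin [:: a]) vi) = s.
  rewrite (hf _ i); last by move=> l lG; rewrite nif mem_cat inE lG !orbT.
  by rewrite hword_filter // => l lP; apply: (fi i ij); rewrite ni mem_cat inE lP !orbT.
rewrite hPf hSf hGf in i2.
have j2 : hw e2 j = g ++ ginv g ++ ws j.
  rewrite k2 // /hw (hf _ j) // njf hword_cat (hword_tails _ aT0') /= hword_cat hG0.
  by rewrite -hv.
have other k : k != i -> k != j -> hw e2 k = ws k /\ hw e2' k = ws k.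
  move=> ki kj.
  have E0 : hword (tletter f') (nth [::] f' k) = ws k.
    rewrite nk // (oldw _ k) // -/(hw e' k) k' // he /wsE /setw.
    by rewrite (negPf kj) (negPf ki).
  rewrite k2 // k2' // /hw E0; split=> //.
  by rewrite (hf _ k) // nth_del hword_filter //; apply: fi.
set W1 := p ++ wconj [:: (j, true)] g ++ s.
set W2 := p ++ wconj [:: (j, true)] (rcons g (j, true)) ++ s.
have iW1 : inm W1 by rewrite /W1 /wconj !all_cat ip igV ig is_ /= jm.
have iW2 : inm W2.
  by rewrite /W2 /wconj !all_cat ip inm_ginv all_rcons ig is_ /= jm.
have setj w : forall k, setw ws i w k = setw (setw ws i w) j (ws j) k.
  by move=> k; rewrite /setw; case: (k =P j) => [->|//]; rewrite (negPf ji).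
have V1 : valid (setw ws i W1) by apply: valid_setw.
have V2 : valid (setw ws i W2) by apply: valid_setw.
move=> d d' r r'.
have q : e2 ~~> e2' by apply: eqv_trans (eqv_sym q2) (eqv_trans ef q2').
apply: eqv_trans (eqv_trans _ q) _.
  have R := @wrel_mulV (setw ws i W1) j g [::] (ws j) V1 jm ig isT vj.
  apply: R (realizes_ext (setj W1) r) _; split=> // k; rewrite /setw.
  case: eqP => [->|/eqP kj]; first by rewrite j2.
  by case: eqP => [->|/eqP ki]; [rewrite i2 | case: (other k ki kj)].
apply: eqv_sym.
have R := @wrel_mulV (setw ws i W2) j g [::] (ws j) V2 jm ig isT vj.
(* The a_j left between g and g^-1 is a letter of its own strand and goes away by sv; then g g^-1
   cancels. *)
have R' := @wrel_sv (setw ws i W2) j true g (ginv g ++ ws j) jm.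
have VV : valid (setw (setw ws i W2) j (g ++ ginv g ++ ws j)).
  by apply: valid_setw => //; rewrite !all_cat ig igV.
apply: (wrel_trans VV R R') (realizes_ext (setj W2) r') _; split=> // k; rewrite /setw.
case: eqP => [->|/eqP kj]; first by rewrite j2'.
by case: eqP => [->|/eqP ki]; [rewrite i2' | case: (other k ki kj)].
Qed.

End WordFamilies.

(** * Completeness *)

Section Completeness.
Variables (m n : nat).
Local Notation "d ~~> d'" := (Vn_sv_equiv m n d d') (at level 70).
Local Notation inm := (all (fun x : nat * bool => x.1 < m)).

Definition others i : pred nat := fun j => (j < m) && (j != i).
Local Notation lets i := (all (fun x : nat * bool => others i x.1)).

Lemma lets_inm i w : lets i w -> inm w.
Proof. by apply: sub_all => x /andP[]. Qed.

Lemma wcong_lets (D : pred nat) u v : wcong n D u v ->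
  all (fun x : nat * bool => D x.1) u = all (fun x : nat * bool => D x.1) v.
Proof.
have gi (g : aword) : all (fun x : nat * bool => D x.1) (ginv g) =
    all (fun x : nat * bool => D x.1) g by rewrite /ginv all_rev all_map.
elim=> {u v} //.
- by move=> u v w _ -> _ ->.
- by move=> u u' v v' _ E1 _ E2; rewrite !all_cat E1 E2.
- by move=> x Dx /=; rewrite Dx.
- by move=> j Dj; rewrite all_nseq Dj orbT.
- by move=> j g Dj Dg; rewrite /wconj !all_cat !gi all_rcons Dg /= Dj.
Qed.

(** The context p, s carries the induction through products. The letter i is kept out of u and v
    because [wrel_comm] works on a strand j other than i. *)
Lemma wrel_wcong ws i u v : valid m ws -> i < m -> wcong n (others i) u v ->
  forall p s, inm p -> inm s -> lets i u ->
  wrel m n (setw ws i (p ++ u ++ s)) (setw ws i (p ++ v ++ s)).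
Proof.
move=> vw im; elim=> {u v}
  [u|u v uv IH|u v w uv IH1 vw' IH2|u u' v v' uu IH1 vv IH2|x Dx|j Dj|j g Dj Dg] p s ip is_ lu.
- exact: wrel_refl.
- by apply: wrel_sym; apply: IH => //; rewrite (wcong_lets uv).
- have lv : lets i v by rewrite -(wcong_lets uv).
  apply: wrel_trans (IH1 p s ip is_ lu) (IH2 p s ip is_ lv).
  by apply: valid_setw => //; rewrite !all_cat ip is_ (lets_inm lv).
- move: lu; rewrite all_cat => /andP[lu lv].
  have lu' : lets i u' by rewrite -(wcong_lets uu).
  have iv := lets_inm lv; have iu' := lets_inm lu'.
  have R1 := IH1 p (v ++ s) ip; rewrite all_cat iv is_ in R1.
  have R2 := IH2 (p ++ u') s; rewrite all_cat ip iu' in R2.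
  rewrite -!catA; rewrite -!catA in R2; apply: wrel_trans (R1 isT lu) (R2 isT is_ lv).
  by apply: valid_setw => //; rewrite !all_cat ip iu' iv is_.
- by apply: wrel_sym; apply: wrel_free => //; case/andP: Dx.
- by apply: wrel_sym; apply: wrel_pow => //; case/andP: Dj.
- case/andP: Dj => jm ji; apply: wrel_comm => //; first by rewrite eq_sym.
  exact: lets_inm Dg.
Qed.

Lemma wrel_erase ws i w : valid m ws -> i < m -> inm w ->
  wrel m n (setw ws i w) (setw ws i (filter (fun x => x.1 != i) w)).
Proof.
move=> vw im.
suff H p : inm p -> inm w -> wrel m n (setw ws i (p ++ w))
    (setw ws i (p ++ filter (fun x => x.1 != i) w)) by exact: (H [::]).
elim: w p => [|[j e] w IH] p ip /=; first by move=> _; apply: wrel_refl.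
case/andP=> jm iw; case: eqP => [->|_] /=; last first.
  by rewrite -!cat_rcons; apply: IH => //; rewrite all_rcons jm.
apply: wrel_trans (IH p ip iw); first by apply: valid_setw => //; rewrite all_cat ip.
by apply: wrel_sym; apply: wrel_sv.
Qed.

Theorem asc_complete d d' : asc m d -> asc m d' ->
  (forall i, i < m -> forall M, uniq M -> all (others i) M ->
     eqm n (rcoef (hw d i) M) (rcoef (hw d' i) M)) -> d ~~> d'.
Proof.
move=> ad ad' H; have [v1 v2] := valid_hw ad; have [v1' v2'] := valid_hw ad'.
(* Words are replaced one strand at a time; each stage is again realizable. *)
pose wsr r := fun k => if k < r then hw d' k else hw d k.
have vr r : valid m (wsr r) by split=> k; rewrite /wsr; case: ifP => _ //; [apply: v2'|apply: v2].
have K r : r <= m -> wrel m n (wsr 0) (wsr r).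
  elim: r => [_|r IH rm]; first exact: wrel_refl.
  apply: wrel_trans (IH (ltnW rm)) _ => //.
  have E1 k : wsr r k = setw (wsr r) r (hw d r) k.
    by rewrite /wsr /setw; case: eqP => // ->; rewrite ltnn.
  have E2 k : setw (wsr r) r (hw d' r) k = wsr r.+1 k.
    by rewrite /wsr /setw [k < r.+1]ltnS [k <= r]leq_eqVlt; case: eqP => // ->.
  pose er w : aword := filter (fun x : nat * bool => x.1 != r) w.
  have ie w : inm w -> inm (er w).
    by move=> iw; apply/allP => x; rewrite mem_filter => /andP[_]; apply: (allP iw).
  have le w : inm w -> lets r (er w).
    move=> iw; apply/allP => x; rewrite mem_filter /others => /andP[-> xw].
    by rewrite andbT; apply: (allP iw).
  have G : wcong n (others r) (er (hw d r)) (er (hw d' r)).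
    apply: wcong_of_rcoef; try exact: le.
    move=> M uM aM; have rM : r \notin M.
      by apply/negP => /(allP aM); rewrite /others eqxx andbF.
    by rewrite !rcoef_erase //; apply: H.
  have V w : inm w -> valid m (setw (wsr r) r w) by move=> iw; apply: valid_setw.
  have R1 := wrel_erase (vr r) rm (v1 r).
  have R2 := wrel_wcong (vr r) rm G (p := [::]) (s := [::]) isT isT (le _ (v1 r)).
  have R3 := wrel_sym (wrel_erase (vr r) rm (v1' r)).
  rewrite !cats0 !cat0s in R2.
  apply: wrel_trans (@wrel_refl m n _ _ E1) _; first exact: V.
  apply: wrel_trans R1 _; first exact/V/ie.
  apply: wrel_trans R2 _; first exact/V/ie.
  apply: wrel_trans R3 (@wrel_refl m n _ _ E2); exact: V.
apply: (K m (leqnn m)); split=> // k; rewrite /wsr; case: ltnP => // mk.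
by rewrite v2 // v2'.
Qed.

End Completeness.

Lemma mu_seq_of m (i : nat) (M : seq nat) : i < m -> uniq M -> all (others m i) M ->
  exists I : seq 'I_m, [/\ I != [::], uniq I, mu_index I = i & mu_seq I = M].
Proof.
case: m => [//|m'] im uM aM.
pose I : seq 'I_m'.+1 := map inord (rcons M i).
have vI : map val I = rcons M i.
  rewrite -map_comp -[RHS]map_id; apply/eq_in_map => k; rewrite mem_rcons inE.
  by case/predU1P=> [->|/(allP aM)/andP[km _]]; rewrite /= inordK.
exists I; split.
- by rewrite -size_eq0 size_map size_rcons.
- apply: (@map_uniq _ _ val); rewrite vI rcons_uniq uM andbT.
  by apply/negP => /(allP aM); rewrite /others eqxx andbF.
- by rewrite /mu_index vI last_rcons.
- by rewrite /mu_seq vI size_map size_rcons /= -cats1 take_size_cat.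
Qed.

Theorem theorem1p4 (m n : nat) (sigma sigma' : gdiag) :
  0 < n -> wf m sigma -> wf m sigma' ->
  (Vn_sv_equiv m n sigma sigma' <->
   (forall I : seq 'I_m, I != [::] -> uniq I ->
      (mu_w sigma I == mu_w sigma' I %[mod (Posz n)])%Z)).
Proof.
move=> _ ws ws'; split=> [eqv I I0 uI|H].
  by rewrite eqz_mod_dvd; apply: mu_invariant eqv _ I0 uI.
have [d e ad] := asc_exists n ws; have [d' e' ad'] := asc_exists n ws'.
have [wd _] := ad; have [wd' _] := ad'.
suff dd : Vn_sv_equiv m n d d' by exact: eqv_trans e (eqv_trans dd (eqv_sym e')).
apply: asc_complete => // i im M uM aM.
have [I [I0 uI Ei EM]] := mu_seq_of im uM aM.
have c : coloring n (size I) d (tletter d) := asc_coloring n (size I) ad.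
have c' : coloring n (size I) d' (tletter d') := asc_coloring n (size I) ad'.
have := mu_w_rcoef wd I0 uI (leqnn _) c; have := mu_w_rcoef wd' I0 uI (leqnn _) c'.
rewrite Ei EM -!/(hw _ _) => r' r.
apply: eqm_trans (eqm_sym r) (eqm_trans _ r').
(* The direction already proved carries the hypothesis from the given diagrams to their tails-first
   forms, whose words have the Milnor numbers as coefficients. *)
apply: eqm_trans (eqm_sym (mu_invariant ws e I0 uI)) (eqm_trans _ (mu_invariant ws' e' I0 uI)).
by have := H I I0 uI; rewrite eqz_mod_dvd.
Qed.
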